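(* Let $u:\Omega\to[0,\tau_0]$ be a parallel refractor from $\Omega$ to $\Sigma$, let $x^*\in\Omega$, and suppose that $\Sigma$ is regular from $X^*=(x^*,u(x^* ))$. Then there exist positive constants $\delta,C_1,C_2$ depending on $X^*$, with $B_\delta(x^* )\subset\Omega$, a positive constant $C$ depending only on bounds for the derivatives of $\phi$, and a constant $M=M(C,C_1)$, such that the following hold. (P) If $\bar x,\hat x\in B_\delta(x^* )$, $\bar Y\in F_u(\bar x)$, $\hat Y\in F_u(\hat x)$ and $|\bar Y-\hat Y|\ge|\bar x-\hat x|$, then there exists $x_0\in[\bar x,\hat x]$ such that, with $X_0^*=(x_0,u(x_0))$, $$u(x)-\phi(x,Y,X_0^* )\ge-C|\bar Y-\hat Y||\bar x-\hat x|-C|Y(\lambda)-Y||x-x_0|+C_1|\bar Y-\hat Y|^2|x-x_0|^2$$ for all $Y(\lambda)\in[\bar Y,\hat Y]_{X_0^*}$ with $\lambda\in[\frac14,\frac34]$, all $Y\in\Sigma$ and all $x\in\Omega\cap B_{C_2}(x_0)$. (Conclusion) If $\hat x,\bar x\in B_{\delta/2}(x^* )$, $\bar Y\in F_u(\bar x)$ and $\hat Y\in F_u(\hat x)$ satisfy $$|\bar Y-\hat Y|\ge\max\left\{1,\left(\tfrac{2M}{\delta}\right)^2,\left(\tfrac{2M}{C_2}\right)^2\right\}|\bar x-\hat x|,$$ then there exists $x_0\in[\bar x,\hat x]$ such that $$\mathcal N_\mu\left(\left\{Y(\lambda)\in[\bar Y,\hat Y]_{X_0^*}:\lambda\in\left[\tfrac14,\tfrac34\right]\right\}\right)\cap\Sigma\subset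 F_u(B_\eta(x_0)),$$ where $X_0^*=(x_0,u(x_0))$, $\mu=|\bar Y-\hat Y|^{3/2}|\bar x-\hat x|^{1/2}$ and $\eta=M\left(\frac{|\bar x-\hat x|}{|\bar Y-\hat Y|}\right)^{1/2}$.
   Context: **Setting.** Points of $\mathbb R^{n+1}$ are written $X=(x,x_{n+1})$, $Y=(y,y_{n+1})$. Fix $\kappa>1$. $\Omega\subset\mathbb R^n$ is a bounded convex domain (the source, in $\{x_{n+1}=0\}$), and the target $\Sigma$ is a compact hypersurface in $\mathbb R^{n+1}$ with $\Sigma\subset\mathbb R^n\times[\tau_1,\tau_1+\omega]$, $\tau_1,\omega>0$. Let $\Delta=\max_{y\in\pi(\Sigma)}\mathrm{diam}(\Omega\cup\{y\})$, where $\pi(\Sigma)$ is the projection of $\Sigma$ on $\mathbb R^n$. Let $0<\tau_0<\tau_1$ and $\mathcal C_\Omega=\Omega\times[0,\tau_0]$. Standing assumptions: $\tau_1>\Delta/\sqrt{\kappa^2-1}$; $\tau_1\ge\max\{\kappa\tau_0,\ \tau_0+\frac{\kappa\Delta}{\kappa-1}\}$; and $e_{n+1}\cdot\frac{Y-X}{|Y-X|}\ge\frac1\kappa$ for all $X\in\mathcal C_\Omega$, $Y\in\Sigma$. **Hyperboloids.** For $b>0$, $$\phi_{Y,b}(x)=y_{n+1}-\frac{\kappa b}{\kappa^2-1}-\sqrt{\frac{b^2}{(\kappa^2-1)^2}+\frac{|x-y|^2}{\kappa^2-1}}.$$ Let $c(X,Y)=\kappa(y_{n+1}-x_{n+1})-|X-Y|$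 (positive for $X\in\mathcal C_\Omega$, $Y\in\Sigma$) and $\phi(x,Y,X_0)=\phi_{Y,c(X_0,Y)}(x)$; its graph passes through $X_0$. The derivatives of $\phi$ are uniformly bounded on $\Omega\times\Sigma\times\mathcal C_\Omega$ under the standing assumptions. **Refractor.** $u:\Omega\to[0,\tau_0]$ is a parallel refractor from $\Omega$ to $\Sigma$ if $u>0$ and for each $x_0\in\Omega$ there are $Y\in\Sigma$ and $0<b<\kappa y_{n+1}-\sqrt{y_{n+1}^2+\Delta^2}$ such that $u(x)\ge\phi_{Y,b}(x)$ for all $x\in\Omega$, with equality at $x=x_0$. For $x_0\in\Omega$ and $X_0=(x_0,u(x_0))$, $F_u(x_0)=\{Y\in\Sigma: u(x)\ge\phi(x,Y,X_0)\ \forall x\in\Omega\}$, and $F_u(S)=\bigcup_{x\in S}F_u(x)$ for $S\subset\Omega$. **Directions and parametrization of the target.** For $v\in\mathbb R^n$ with $|v|\le1/\sqrt{\kappa^2-1}$ put $Q(v)=\frac{\kappa-\sqrt{1-(\kappa^2-1)|v|^2}}{1+|v|^2}$ and $\Lambda(v)=(Q(v)v,\,-Q(v)+\kappa)$, a unit vector. If $Y=X_0+s\Lambda(v)$ with $s>0$, then $v=D_x\phi(x_0,Y,X_0)$. It is assumed that for each $X\in\mathcal C_\Omega$ every $Y\in\Sigma$ can be written $Y=X+s_X(\Lambda)\Lambda$ with $|\Lambda|=1$, where $s_X(\Lambda)>0$ is a Lipschitz function of $\Lambda$ (so each ray from $X$ meets $\Sigma$ in at most one point). For $\bar Y,\hat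 Y\in\Sigma$ and $Z=(z,z_{n+1})\in\mathcal C_\Omega$, let $\bar v=D_x\phi(z,\bar Y,Z)$, $\hat v=D_x\phi(z,\hat Y,Z)$, $v(\lambda)=(1-\lambda)\bar v+\lambda\hat v$, $Y(\lambda)=Y_Z(\lambda)=Z+s_Z(\Lambda(v(\lambda)))\Lambda(v(\lambda))$ for $\lambda\in[0,1]$, and $[\bar Y,\hat Y]_Z=\Sigma\cap\{Z+s\Lambda(v(\lambda)):s>0,\lambda\in[0,1]\}$. The function $s_Z$ is understood to be defined at these directions, with $Y_Z(\lambda)\in\Sigma$ for $\lambda\in[0,1]$. **Regularity of the target.** $\Sigma$ is regular from $X_0\in\mathcal C_\Omega$ if there are a neighborhood $U_{X_0}$ of $X_0$ and constants $c_1,c_2>0$ depending on $U_{X_0}$ such that for all $\bar Y,\hat Y\in\Sigma$ and $Z=(z,z_{n+1})\in U_{X_0}$, $$\phi(x,Y_Z(\lambda),Z)\le\max\{\phi(x,\bar Y,Z),\phi(x,\hat Y,Z)\}-c_1|\bar Y-\hat Y|^2|x-z|^2$$ for all $x\in\Omega$ with $|x-z|\le c_2$ and all $\lambda\in[\frac14,\frac34]$. $\mathcal N_\mu(S)$ denotes the $\mu$-neighborhood of a set $S$; $[\bar x,\hat x]$ is the line segment. *)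

(* Defs.v *)
(* MathComp-Analysis. *)
From HB Require Import structures.
From mathcomp Require Export all_boot all_order all_algebra.
From mathcomp Require Export all_classical all_reals all_analysis.
Export Order.TTheory GRing.Theory Num.Theory.
Export numFieldNormedType.Exports.

Set Implicit Arguments.
Unset Strict Implicit.
Unset Printing Implicit Defensive.

Local Open Scope classical_set_scope.
Local Open Scope ring_scope.

(* A point X = (x, x_{n+1}) of R^{n+1} is the pair with X.1 = x, X.2 = x_{n+1}. *)
Notation pt R n := ('rV[R]_n * R)%type.

(* Euclidean norms: the norms that the library puts on row vectors and on pairs
   are sup norms, so `|_| below is used only on real numbers. *)
Definition enorm (R : realType) (n : nat) (x : 'rV[R]_n) : R :=
  Num.sqrt (\sum_(i < n) x 0 i ^+ 2).

Definition pnorm (R : realType) (n : nat) (X : pt R n) : R :=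
  Num.sqrt (enorm X.1 ^+ 2 + X.2 ^+ 2).

Definition eball (R : realType) (n : nat) (x : 'rV[R]_n) (r : R) : set 'rV[R]_n :=
  [set z | enorm (z - x) < r].

Definition pneighborhood (R : realType) (n : nat) (mu : R) (S : set (pt R n)) :
    set (pt R n) :=
  [set Y | exists2 W, S W & pnorm (Y - W) < mu].

Definition segment (R : realType) (n : nat) (a b : 'rV[R]_n) : set 'rV[R]_n :=
  [set (1 - t) *: a + t *: b | t in [set t : R | 0 <= t <= 1]].

Definition ediam (R : realType) (n : nat) (A : set 'rV[R]_n) : R :=
  sup [set d | exists p q, [/\ A p, A q & d = enorm (p - q)]].

(* The maximum over the compact set pi(Sigma) is written as a supremum. *)
Definition Delta (R : realType) (n : nat)
    (Omega : set 'rV[R]_n) (Sigma : set (pt R n)) : R :=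
  sup [set ediam (Omega `|` [set Y.1]) | Y in Sigma].

Definition cylinder (R : realType) (n : nat)
    (Omega : set 'rV[R]_n) (tau0 : R) : set (pt R n) :=
  [set X | Omega X.1 /\ 0 <= X.2 <= tau0].

(* A hypersurface is an embedded topological n-manifold in R^{n+1}, possibly
   with boundary: near each of its points it is homeomorphic to a relatively
   open subset of the closed half-space {t | 0 <= t_0}. *)
Definition halfspace (R : realType) (n : nat) : set 'rV[R]_n :=
  [set t | forall i : 'I_n, i = 0%N :> nat -> 0 <= t 0 i].

Definition hypersurface (R : realType) (n : nat) (S : set (pt R n)) : Prop :=
  forall Y, S Y ->
  exists (V : set (pt R n)) (W : set 'rV[R]_n)
         (f : 'rV[R]_n -> pt R n) (g : pt R n -> 'rV[R]_n),
    let D := W `&` @halfspace R n in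
    [/\ open V, V Y & open W] /\
    [/\ f @` D = S `&` V, (forall t, D t -> g (f t) = t),
        {within D, continuous f} & {within S `&` V, continuous g}].

Definition phib (R : realType) (n : nat) (kappa : R) (Y : pt R n) (b : R)
    (x : 'rV[R]_n) : R :=
  Y.2 - kappa * b / (kappa ^+ 2 - 1)
  - Num.sqrt (b ^+ 2 / (kappa ^+ 2 - 1) ^+ 2
              + enorm (x - Y.1) ^+ 2 / (kappa ^+ 2 - 1)).

Definition cfun (R : realType) (n : nat) (kappa : R) (X Y : pt R n) : R :=
  kappa * (Y.2 - X.2) - pnorm (X - Y).

Definition phi (R : realType) (n : nat) (kappa : R)
    (x : 'rV[R]_n) (Y X0 : pt R n) : R :=
  phib kappa Y (cfun kappa X0 Y) x.

Definition coord_dir (R : realType) (n : nat) (i : 'I_n) : 'rV[R]_n :=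
  delta_mx 0 i.

Definition Dxphi (R : realType) (n : nat) (kappa : R)
    (x : 'rV[R]_n) (Y X0 : pt R n) : 'rV[R]_n :=
  \row_(i < n) 'D_(coord_dir R i) (fun z => phi kappa z Y X0) x.

(* The coordinate directions of the space R^n x R^{n+1} x R^{n+1} in which
   (x, Y, X0) lives; None stands for the last coordinate of R^{n+1}. *)
Definition ptdir (R : realType) (n : nat) (i : option 'I_n) : pt R n :=
  if i is Some j then (coord_dir R j, 0) else (0, 1).

Definition phidir (R : realType) (n : nat)
    (i : 'I_n + option 'I_n + option 'I_n) : 'rV[R]_n * pt R n * pt R n :=
  match i with
  | inl (inl j) => (coord_dir R j, 0, 0)
  | inl (inr j) => (0, ptdir R j, 0)
  | inr j => (0, 0, ptdir R j)
  end.

Definition partials (R : realType) (n : nat)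
    (s : seq ('I_n + option 'I_n + option 'I_n))
    (f : 'rV[R]_n * pt R n * pt R n -> R) : 'rV[R]_n * pt R n * pt R n -> R :=
  foldr (fun i g => 'D_(phidir R i) g) f s.

(* K m bounds all partial derivatives of order m >= 1 of phi, in all of its
   variables, on Omega x Sigma x C_Omega. *)
Definition phi_derivative_bounds (R : realType) (n : nat) (kappa : R)
    (Omega : set 'rV[R]_n) (Sigma : set (pt R n)) (tau0 : R) (K : nat -> R) :
    Prop :=
  forall s : seq ('I_n + option 'I_n + option 'I_n), (0 < size s)%N ->
  forall x Y X0, Omega x -> Sigma Y -> cylinder Omega tau0 X0 ->
    `|partials s (fun p => phi kappa p.1.1 p.1.2 p.2) (x, Y, X0)| <= K (size s).

Definition Qfun (R : realType) (n : nat) (kappa : R) (v : 'rV[R]_n) : R :=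
  (kappa - Num.sqrt (1 - (kappa ^+ 2 - 1) * enorm v ^+ 2)) / (1 + enorm v ^+ 2).

Definition Lam (R : realType) (n : nat) (kappa : R) (v : 'rV[R]_n) : pt R n :=
  (Qfun kappa v *: v, - Qfun kappa v + kappa).

(* X + t L, for a direction L *)
Definition raypt (R : realType) (n : nat) (X : pt R n) (t : R) (L : pt R n) :
    pt R n :=
  (X.1 + t *: L.1, X.2 + t * L.2).

Definition vseg (R : realType) (n : nat) (kappa : R)
    (Ybar Yhat Z : pt R n) (lambda : R) : 'rV[R]_n :=
  (1 - lambda) *: Dxphi kappa Z.1 Ybar Z + lambda *: Dxphi kappa Z.1 Yhat Z.

(* Y_Z(lambda); s X L stands for s_X(L). *)
Definition Yseg (R : realType) (n : nat) (kappa : R) (s : pt R n -> pt R n -> R)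
    (Ybar Yhat Z : pt R n) (lambda : R) : pt R n :=
  let L := Lam kappa (vseg kappa Ybar Yhat Z lambda) in raypt Z (s Z L) L.

(* [Ybar, Yhat]_Z *)
Definition Yarc (R : realType) (n : nat) (kappa : R) (Sigma : set (pt R n))
    (Ybar Yhat Z : pt R n) : set (pt R n) :=
  Sigma `&` [set W | exists t lambda, [/\ 0 < t, 0 <= lambda <= 1 &
    W = raypt Z t (Lam kappa (vseg kappa Ybar Yhat Z lambda))]].

(* The unit directions of the rays from X that meet Sigma: the domain of s_X. *)
Definition raydirs (R : realType) (n : nat) (Sigma : set (pt R n)) (X : pt R n) :
    set (pt R n) :=
  [set L | pnorm L = 1 /\ exists2 t, 0 < t & Sigma (raypt X t L)].

Record parallel_setting (R : realType) (n : nat) (kappa : R)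
    (Omega : set 'rV[R]_n) (Sigma : set (pt R n)) (tau0 tau1 omega : R)
    (s : pt R n -> pt R n -> R) : Prop := ParallelSetting {
  Omega_nonempty : Omega !=set0;
  Omega_open : open Omega;
  Omega_bounded : bounded_set Omega;
  Omega_convex : convex_set (Omega : set (convex_lmodType 'rV[R]_n));
  Sigma_nonempty : Sigma !=set0;
  Sigma_compact : compact Sigma;
  Sigma_hypersurface : hypersurface Sigma;
  omega_gt0 : 0 < omega;
  Sigma_slab : forall Y, Sigma Y -> tau1 <= Y.2 <= tau1 + omega;
  tau0_gt0 : 0 < tau0;
  tau0_lt_tau1 : tau0 < tau1;
  tau1_gt : Delta Omega Sigma / Num.sqrt (kappa ^+ 2 - 1) < tau1;
  tau1_ge : Num.max (kappa * tau0)
              (tau0 + kappa * Delta Omega Sigma / (kappa - 1)) <= tau1;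
  cone : forall X Y, cylinder Omega tau0 X -> Sigma Y ->
    kappa^-1 <= (Y.2 - X.2) / pnorm (Y - X);
  radial : forall X Y, cylinder Omega tau0 X -> Sigma Y ->
    exists L, [/\ pnorm L = 1, 0 < s X L & Y = raypt X (s X L) L];
  radial_lipschitz : forall X, cylinder Omega tau0 X ->
    exists k, forall L L', raydirs Sigma X L -> raydirs Sigma X L' ->
      `|s X L - s X L'| <= k * pnorm (L - L');
  arc_defined : forall Z Ybar Yhat lambda, cylinder Omega tau0 Z ->
    Sigma Ybar -> Sigma Yhat -> 0 <= lambda <= 1 ->
    0 < s Z (Lam kappa (vseg kappa Ybar Yhat Z lambda)) /\
    Sigma (Yseg kappa s Ybar Yhat Z lambda)
}.

Definition parallel_refractor (R : realType) (n : nat) (kappa : R)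
    (Omega : set 'rV[R]_n) (Sigma : set (pt R n)) (tau0 : R)
    (u : 'rV[R]_n -> R) : Prop :=
  (forall x, Omega x -> 0 < u x <= tau0) /\
  (forall x0, Omega x0 -> exists (Y : pt R n) (b : R),
    [/\ Sigma Y,
        0 < b < kappa * Y.2 - Num.sqrt (Y.2 ^+ 2 + Delta Omega Sigma ^+ 2),
        forall x, Omega x -> phib kappa Y b x <= u x &
        u x0 = phib kappa Y b x0]).

Definition Fu (R : realType) (n : nat) (kappa : R)
    (Omega : set 'rV[R]_n) (Sigma : set (pt R n))
    (u : 'rV[R]_n -> R) (x0 : 'rV[R]_n) : set (pt R n) :=
  [set Y | Sigma Y /\ forall x, Omega x -> phi kappa x Y (x0, u x0) <= u x].

Definition Fu_set (R : realType) (n : nat) (kappa : R)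
    (Omega : set 'rV[R]_n) (Sigma : set (pt R n))
    (u : 'rV[R]_n -> R) (S : set 'rV[R]_n) : set (pt R n) :=
  \bigcup_(x in S) Fu kappa Omega Sigma u x.

(* The vertex Z ranges over the part of the neighborhood U lying in C_Omega,
   where Y_Z is defined; X0 may lie on the boundary of C_Omega. *)
Definition regular_from (R : realType) (n : nat) (kappa : R)
    (Omega : set 'rV[R]_n) (Sigma : set (pt R n)) (tau0 : R)
    (s : pt R n -> pt R n -> R) (X0 : pt R n) : Prop :=
  exists (U : set (pt R n)) (c1 c2 : R),
    [/\ nbhs X0 U, 0 < c1, 0 < c2 &
    forall Ybar Yhat Z, Sigma Ybar -> Sigma Yhat ->
      U Z -> cylinder Omega tau0 Z ->
    forall x lambda, Omega x -> enorm (x - Z.1) <= c2 ->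
      1 / 4 <= lambda <= 3 / 4 ->
      phi kappa x (Yseg kappa s Ybar Yhat Z lambda) Z <=
        Num.max (phi kappa x Ybar Z) (phi kappa x Yhat Z)
        - c1 * pnorm (Ybar - Yhat) ^+ 2 * enorm (x - Z.1) ^+ 2].

Definition property_P (R : realType) (n : nat) (kappa : R)
    (Omega : set 'rV[R]_n) (Sigma : set (pt R n)) (s : pt R n -> pt R n -> R)
    (u : 'rV[R]_n -> R) (xstar : 'rV[R]_n) (delta C C1 C2 : R) : Prop :=
  forall xbar xhat Ybar Yhat,
    eball xstar delta xbar -> eball xstar delta xhat ->
    Fu kappa Omega Sigma u xbar Ybar -> Fu kappa Omega Sigma u xhat Yhat ->
    enorm (xbar - xhat) <= pnorm (Ybar - Yhat) ->
  exists2 x0, segment xbar xhat x0 &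
    let X0 := (x0, u x0) in
    forall lambda Y x,
      1 / 4 <= lambda <= 3 / 4 ->
      Yarc kappa Sigma Ybar Yhat X0 (Yseg kappa s Ybar Yhat X0 lambda) ->
      Sigma Y -> Omega x -> eball x0 C2 x ->
      - C * pnorm (Ybar - Yhat) * enorm (xbar - xhat)
      - C * pnorm (Yseg kappa s Ybar Yhat X0 lambda - Y) * enorm (x - x0)
      + C1 * pnorm (Ybar - Yhat) ^+ 2 * enorm (x - x0) ^+ 2
      <= u x - phi kappa x Y X0.

Definition property_conclusion (R : realType) (n : nat) (kappa : R)
    (Omega : set 'rV[R]_n) (Sigma : set (pt R n)) (s : pt R n -> pt R n -> R)
    (u : 'rV[R]_n -> R) (xstar : 'rV[R]_n) (delta C2 M : R) : Prop :=
  forall xbar xhat Ybar Yhat,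
    eball xstar (delta / 2) xhat -> eball xstar (delta / 2) xbar ->
    Fu kappa Omega Sigma u xbar Ybar -> Fu kappa Omega Sigma u xhat Yhat ->
    Num.max 1 (Num.max ((2 * M / delta) ^+ 2) ((2 * M / C2) ^+ 2))
      * enorm (xbar - xhat) <= pnorm (Ybar - Yhat) ->
  exists2 x0, segment xbar xhat x0 &
    let X0 := (x0, u x0) in
    let mu := pnorm (Ybar - Yhat) `^ (3 / 2) * enorm (xbar - xhat) `^ (1 / 2) in
    let eta := M * (enorm (xbar - xhat) / pnorm (Ybar - Yhat)) `^ (1 / 2) in
    pneighborhood mu
      [set W | exists2 lambda, 1 / 4 <= lambda <= 3 / 4 &
         W = Yseg kappa s Ybar Yhat X0 lambda /\
         Yarc kappa Sigma Ybar Yhat X0 W] `&` Sigma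
    `<=` Fu_set kappa Omega Sigma u (eball x0 eta).

(* Main.v *)
(* (P): on the segment from xbar to xhat take the point x0 where the supporting
   hyperboloids with foci Ybar and Yhat cross, at height z.  Supports from below
   make u semiconvex, which gives u(x0) - z <= C |Ybar - Yhat| |xbar - xhat|.
   Hence u lies, up to that error, above the maximum of the hyperboloids with
   these foci through (x0, u(x0)), and the regularity of Sigma compares this
   maximum with the hyperboloid with focus Y(lambda).

   Conclusion: for Y near the arc, (P) puts the hyperboloid with focus Y through
   (x0, u(x0)) strictly below u on the sphere of radius eta about x0, so that
   lowering it until it last touches u on the ball gives a local support at some
   x1 in the ball.  Regularity is local, and local supports are global for the
   following reasons.  Through Z the hyperboloid of slope v is the quadric
   |p|^2/(kappa^2-1) - tau^2 = 2 A (v.p - tau), linear in v, so that comparing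
   three of them with v = (v1 + v2)/2 amounts to comparing 1/A with the mean of
   1/A1 and 1/A2; in dimension n >= 2 this numerical inequality follows from the
   comparison near Z and implies it everywhere.  Therefore the slopes of the
   global supports at x1 form a closed convex set, and a separation argument
   puts the slope of every local support in it.  For n = 1 one uses instead that
   Y is determined by the slope. *)

Require Import Defs.
From mathcomp Require Import ring lra.

Set Implicit Arguments.
Unset Strict Implicit.
Unset Printing Implicit Defensive.

Local Open Scope classical_set_scope.
Local Open Scope ring_scope.

(** The constant [C] has to be a function of [K] alone, uniform in source, target and refractor. For
    this reason the increment of a hyperboloid is written exactly, as an inner product with a
    divided difference [slope]. The Lipschitz constant of [slope] is a multiple of an inverse
    [drop], and that inverse is the one quantity extracted from [K]. The refractor itself is never
    differentiated; only its supports are compared. Touching is expressed by parameters. For fixed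
    [Y] the hyperboloids [phib kappa Y b] decrease strictly in b, so the one through (x0, u x0) lies
    below [u] at x exactly when c((x, u x), Y) <= c((x0, u x0), Y). Lowering a hyperboloid until it
    last touches [u] thus means maximizing the Lipschitz function x -> c((x, u x), Y). The exponents
    in mu and eta balance (P): on the sphere of radius eta about x0, with [Y] within mu of the arc,
    its three terms are all controlled by multiples of |Ybar - Yhat| |xbar - xhat|. *)

Lemma subrACA (V : zmodType) (a b c d : V) : a - b - (c - d) = a - c - (b - d).
Proof. by rewrite !opprB [d - c]addrC addrACA [- b + d]addrC. Qed.

(** * Cauchy-Schwarz and triangle inequalities, for R^n and R^{n+1} at once *)

Section InnerProduct.
Variables (R : realType) (V : lmodType R) (B : V -> V -> R).
Hypothesis BC : forall x y, B x y = B y x.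
Hypothesis BD : forall x y z, B (x + y) z = B x z + B y z.
Hypothesis BZ : forall a x z, B (a *: x) z = a * B x z.
Hypothesis B_ge0 : forall x, 0 <= B x x.
Hypothesis B_eq0 : forall x, B x x = 0 -> x = 0.

Lemma form_cauchy_schwarz x y : B x y ^+ 2 <= B x x * B y y.
Proof.
have B0 z : B 0 z = 0 by rewrite -(scale0r (0 : V)) BZ mul0r.
have [y0|y0] := eqVneq (B y y) 0.
  by rewrite (B_eq0 y0) BC !B0 mulr0 expr0n.
have yp : 0 < B y y by rewrite lt_def y0 B_ge0.
(* The residue of the projection onto [y], with its denominator cleared: its square is [B y y] times
   the gap in the inequality. *)
have := B_ge0 (B y y *: x + (- B x y) *: y).
have -> : B (B y y *: x + (- B x y) *: y) (B y y *: x + (- B x y) *: y)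
    = B y y * (B x x * B y y - B x y ^+ 2).
  rewrite !(BD, BZ) !(BC x) !(BC y) !(BD, BZ) (BC y x); ring.
by rewrite pmulr_rge0 // subr_ge0.
Qed.

Lemma form_triangle x y :
  Num.sqrt (B (x + y) (x + y)) <= Num.sqrt (B x x) + Num.sqrt (B y y).
Proof.
rewrite -ler_sqr ?nnegrE ?addr_ge0 ?sqrtr_ge0 // sqrrD !sqr_sqrtr //.
have -> : B (x + y) (x + y) = B x x + B x y *+ 2 + B y y.
  by rewrite BD !(BC _ (x + y)) !BD (BC y x); ring.
rewrite lerD2r lerD2l lerMn2r /=; apply: (le_trans (ler_norm _)).
rewrite -sqrtrM // -sqrtr_sqr ler_wsqrtr //; exact: form_cauchy_schwarz.
Qed.

End InnerProduct.

Section Euclid.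
Variables (R : realType) (n : nat).
Implicit Types (x y z : 'rV[R]_n) (X Y Z : pt R n).

Definition dot x y : R := \sum_(i < n) x 0 i * y 0 i.

Lemma dotC x y : dot x y = dot y x.
Proof. by apply: eq_bigr => i _; rewrite mulrC. Qed.

Lemma dotDl x y z : dot (x + y) z = dot x z + dot y z.
Proof. by rewrite -big_split; apply: eq_bigr => i _; rewrite mxE mulrDl. Qed.

Lemma dotZl a x z : dot (a *: x) z = a * dot x z.
Proof. by rewrite mulr_sumr; apply: eq_bigr => i _; rewrite mxE mulrA. Qed.

Lemma dotDr x y z : dot x (y + z) = dot x y + dot x z.
Proof. by rewrite dotC dotDl !(dotC x). Qed.

Lemma dotZr a x z : dot x (a *: z) = a * dot x z.
Proof. by rewrite dotC dotZl dotC. Qed.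

Lemma dotNl x y : dot (- x) y = - dot x y.
Proof. by rewrite -scaleN1r dotZl mulN1r. Qed.

Lemma dotNr x y : dot x (- y) = - dot x y.
Proof. by rewrite dotC dotNl dotC. Qed.

Lemma dot0l y : dot 0 y = 0.
Proof. by rewrite -(scale0r (0 : 'rV_n)) dotZl mul0r. Qed.

Lemma dotxx_ge0 x : 0 <= dot x x.
Proof. by apply: sumr_ge0 => i _; rewrite -expr2 sqr_ge0. Qed.

Lemma dotxx_eq0 x : dot x x = 0 -> x = 0.
Proof.
move=> /eqP; rewrite psumr_eq0; last by move=> i _; rewrite -expr2 sqr_ge0.
move=> /allP h; apply/rowP => i; rewrite mxE.
by have := h i (mem_index_enum _); rewrite /= -expr2 sqrf_eq0 => /eqP.
Qed.

Lemma enormE x : enorm x = Num.sqrt (dot x x).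
Proof. by congr Num.sqrt; apply: eq_bigr => i _; rewrite expr2. Qed.

Lemma enorm_sqr x : enorm x ^+ 2 = dot x x.
Proof. by rewrite enormE sqr_sqrtr // dotxx_ge0. Qed.

Lemma enorm_ge0 x : 0 <= enorm x.
Proof. exact: sqrtr_ge0. Qed.

Lemma enorm0 : enorm (0 : 'rV[R]_n) = 0.
Proof. by rewrite enormE dot0l sqrtr0. Qed.

Lemma enorm_eq0 x : enorm x = 0 -> x = 0.
Proof.
by move=> h; apply: dotxx_eq0; rewrite -enorm_sqr h expr0n.
Qed.

Lemma enormZ a x : enorm (a *: x) = `|a| * enorm x.
Proof.
by rewrite !enormE dotZl dotZr mulrA -expr2 sqrtrM ?sqr_ge0 // sqrtr_sqr.
Qed.

Lemma enormN x : enorm (- x) = enorm x.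
Proof. by rewrite -scaleN1r enormZ normrN1 mul1r. Qed.

Lemma enormB x y : enorm (x - y) = enorm (y - x).
Proof. by rewrite -enormN opprB. Qed.

Lemma dot_le x y : dot x y <= enorm x * enorm y.
Proof.
apply: (le_trans (ler_norm _)).
rewrite -sqrtr_sqr !enormE -sqrtrM ?dotxx_ge0 // ler_wsqrtr //.
apply: form_cauchy_schwarz; [exact: dotC|exact: dotDl|exact: dotZl|
  exact: dotxx_ge0|exact: dotxx_eq0].
Qed.

Lemma dot_norm_le x y : `|dot x y| <= enorm x * enorm y.
Proof.
rewrite ler_norml dot_le andbT lerNl -dotNl.
by apply: (le_trans (dot_le _ _)); rewrite enormN.
Qed.

Lemma enormD x y : enorm (x + y) <= enorm x + enorm y.
Proof.
rewrite !enormE; apply: form_triangle; [exact: dotC|exact: dotDl|exact: dotZl|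
  exact: dotxx_ge0|exact: dotxx_eq0].
Qed.

Lemma enorm_sub_le x y : enorm (x - y) <= enorm x + enorm y.
Proof. by rewrite -(enormN y) enormD. Qed.

Lemma enorm_dist x y z : enorm (x - z) <= enorm (x - y) + enorm (y - z).
Proof. by rewrite -[x - z](subrKA y) enormD. Qed.

Lemma enorm_lip x y : `|enorm x - enorm y| <= enorm (x - y).
Proof.
have h x' y' : enorm x' <= enorm (x' - y') + enorm y'.
  by rewrite -{1}(subrK y' x') enormD.
have := h x y; have := h y x; rewrite (enormB y x) ler_norml => h1 h2.
by apply/andP; split; lra.
Qed.

Lemma enorm_coord x i : `|x 0 i| <= enorm x.
Proof.
rewrite -sqrtr_sqr enormE ler_wsqrtr // /dot (bigD1 i) //= -expr2 lerDl.
by apply: sumr_ge0 => j _; rewrite -expr2 sqr_ge0.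
Qed.

Lemma enorm_le_sum x : enorm x <= \sum_i `|x 0 i|.
Proof.
have h0 : 0 <= \sum_i `|x 0 i| by apply: sumr_ge0.
rewrite -(ger0_norm h0) -sqrtr_sqr enormE ler_wsqrtr //.
rewrite expr2 mulr_suml; apply: ler_sum => i _.
apply: (le_trans (ler_norm _)); rewrite normrM; apply: ler_wpM2l => //.
by rewrite (bigD1 i) //= lerDl sumr_ge0.
Qed.

(* The library's norm on row vectors is the sup norm. *)
Lemma enorm_le_mx_norm x : enorm x <= n%:R * `|x|.
Proof.
apply: (le_trans (enorm_le_sum x)).
rewrite -[X in X%:R]card_ord -sumr_const mulr_suml; apply: ler_sum => i _.
rewrite mul1r [leRHS]/Num.norm /= mx_normrE.
exact: (le_bigmax _ (fun ij : 'I_1 * 'I_n => `|x ij.1 ij.2|) (0, i)).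
Qed.

Lemma mx_norm_le_enorm x : `|x| <= enorm x.
Proof.
rewrite [leLHS]/Num.norm /= mx_normrE; apply: bigmax_le; first exact: enorm_ge0.
by move=> [i j] _ /=; rewrite ord1; exact: enorm_coord.
Qed.

Definition pdot X Y : R := dot X.1 Y.1 + X.2 * Y.2.

Lemma pdotC X Y : pdot X Y = pdot Y X.
Proof. by rewrite /pdot dotC mulrC. Qed.

Lemma pdotDl X Y Z : pdot (X + Y) Z = pdot X Z + pdot Y Z.
Proof. by rewrite /pdot /= dotDl; ring. Qed.

Lemma pdotZl a X Z : pdot (a *: X) Z = a * pdot X Z.
Proof. by rewrite /pdot /= dotZl mulrDr mulrA. Qed.

Lemma pdotxx_ge0 X : 0 <= pdot X X.
Proof. by rewrite /pdot addr_ge0 ?dotxx_ge0 // -expr2 sqr_ge0. Qed.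

Lemma pdotxx_eq0 X : pdot X X = 0 -> X = 0.
Proof.
move=> /eqP; rewrite /pdot paddr_eq0 ?dotxx_ge0 // -?expr2 ?sqr_ge0 //.
move=> /andP[/eqP /dotxx_eq0 h1]; rewrite sqrf_eq0 => /eqP h2.
by case: X h1 h2 => a b /= -> ->.
Qed.

Lemma pnormE X : pnorm X = Num.sqrt (pdot X X).
Proof. by rewrite /pnorm enorm_sqr /pdot -expr2. Qed.

Lemma pnorm_sqr X : pnorm X ^+ 2 = enorm X.1 ^+ 2 + X.2 ^+ 2.
Proof. by rewrite /pnorm sqr_sqrtr // addr_ge0 // sqr_ge0. Qed.

Lemma pnorm_ge0 X : 0 <= pnorm X.
Proof. exact: sqrtr_ge0. Qed.

Lemma pnormZ a X : pnorm (a *: X) = `|a| * pnorm X.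
Proof.
rewrite !pnormE pdotZl pdotC pdotZl mulrA -expr2 sqrtrM ?sqr_ge0 //.
by rewrite sqrtr_sqr.
Qed.

Lemma pnormN X : pnorm (- X) = pnorm X.
Proof. by rewrite -scaleN1r pnormZ normrN1 mul1r. Qed.

Lemma pnormB X Y : pnorm (X - Y) = pnorm (Y - X).
Proof. by rewrite -pnormN opprB. Qed.

Lemma pnormD X Y : pnorm (X + Y) <= pnorm X + pnorm Y.
Proof.
rewrite !pnormE; apply: form_triangle; [exact: pdotC|exact: pdotDl|
  exact: pdotZl|exact: pdotxx_ge0|exact: pdotxx_eq0].
Qed.

Lemma pnorm_lip X Y : `|pnorm X - pnorm Y| <= pnorm (X - Y).
Proof.
have h X' Y' : pnorm X' <= pnorm (X' - Y') + pnorm Y'.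
  by rewrite -{1}(subrK Y' X') pnormD.
have := h X Y; have := h Y X; rewrite (pnormB Y X) ler_norml => h1 h2.
by apply/andP; split; lra.
Qed.

Lemma enorm_le_pnorm X : enorm X.1 <= pnorm X.
Proof.
rewrite -ler_sqr ?nnegrE ?enorm_ge0 ?pnorm_ge0 // pnorm_sqr lerDl.
exact: sqr_ge0.
Qed.

Lemma snd_le_pnorm X : `|X.2| <= pnorm X.
Proof.
rewrite -ler_sqr ?nnegrE ?pnorm_ge0 // pnorm_sqr real_normK ?num_real //.
by rewrite lerDr sqr_ge0.
Qed.

Lemma pnorm_le X : pnorm X <= enorm X.1 + `|X.2|.
Proof.
rewrite -ler_sqr ?nnegrE ?pnorm_ge0 ?addr_ge0 ?enorm_ge0 //.
rewrite pnorm_sqr sqrrD real_normK ?num_real // lerD2r lerDl.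
by rewrite mulrn_wge0 // mulr_ge0 ?enorm_ge0.
Qed.

Lemma pnorm_fst x a : pnorm (x, a) = Num.sqrt (enorm x ^+ 2 + a ^+ 2).
Proof. by []. Qed.

Lemma pnorm_0l a : pnorm ((0 : 'rV[R]_n), a) = `|a|.
Proof. by rewrite pnorm_fst enorm0 expr0n add0r sqrtr_sqr. Qed.

Lemma pnorm0 : pnorm (0 : pt R n) = 0.
Proof. by rewrite pnorm_0l normr0. Qed.

Lemma pnorm_le_norm X : pnorm X <= (n%:R + 1) * `|X|.
Proof.
apply: (le_trans (pnorm_le X)); rewrite mulrDl mul1r lerD //.
  apply: (le_trans (enorm_le_mx_norm _)).
  by apply: ler_wpM2l => //; rewrite prod_normE le_max lexx.
by rewrite prod_normE le_max lexx orbT.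
Qed.

End Euclid.

(** * Hyperboloids *)

Section Hyperboloids.
Variables (R : realType) (n : nat) (kappa : R).
Hypothesis kappa_gt1 : 1 < kappa.
Implicit Types (x y z w : 'rV[R]_n) (X Y Z : pt R n) (b : R).

Local Notation k := (kappa ^+ 2 - 1).

Lemma kappa_gt0 : 0 < kappa. Proof. exact: lt_trans kappa_gt1. Qed.
Hint Resolve kappa_gt0 : core.

Lemma k_gt0 : 0 < k.
Proof. by rewrite subr_gt0 exprn_egt1. Qed.
Hint Resolve k_gt0 : core.

Lemma sqrtk_gt0 : 0 < Num.sqrt k. Proof. by rewrite sqrtr_gt0. Qed.
Hint Resolve sqrtk_gt0 : core.

Lemma sqrtk_sqr : Num.sqrt k ^+ 2 = k.
Proof. by rewrite sqr_sqrtr // ltW. Qed.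

(* The square root in [phib]: the vertical distance from the graph to the
   horizontal plane of symmetry of the hyperboloid. *)
Definition drop b w : R :=
  Num.sqrt (b ^+ 2 / k ^+ 2 + enorm w ^+ 2 / k).

Lemma phibE Y b x : phib kappa Y b x = Y.2 - kappa * b / k - drop b (x - Y.1).
Proof. by []. Qed.

Lemma drop_ge0 b w : 0 <= drop b w.
Proof. exact: sqrtr_ge0. Qed.

Lemma drop_sqr b w : drop b w ^+ 2 = b ^+ 2 / k ^+ 2 + enorm w ^+ 2 / k.
Proof.
by rewrite sqr_sqrtr // addr_ge0 // divr_ge0 ?sqr_ge0 // ltW.
Qed.

(** Being the Euclidean norm of a vector linear in [w] and [b], [drop] inherits its Lipschitz bounds
    from the triangle inequality. *)
Lemma drop_pnorm b w : drop b w = pnorm ((Num.sqrt k)^-1 *: w, b / k).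
Proof.
rewrite pnorm_fst enormZ ger0_norm ?invr_ge0 ?sqrtr_ge0 //.
by rewrite !exprMn exprVn sqrtk_sqr /drop exprVn addrC [_^-1 * _]mulrC.
Qed.

Lemma drop_lip b b' w w' :
  `|drop b w - drop b' w'| <= enorm (w - w') / Num.sqrt k + `|b - b'| / k.
Proof.
rewrite !drop_pnorm; apply: (le_trans (pnorm_lip _ _)).
apply: (le_trans (pnorm_le _)) => /=.
rewrite -scalerBr enormZ -mulrBl normrM.
rewrite (gtr0_norm (x := k^-1)) ?invr_gt0 //.
by rewrite (gtr0_norm (x := (Num.sqrt k)^-1)) ?invr_gt0 // [X in X + _]mulrC.
Qed.

Lemma drop_ge_b b w : `|b| / k <= drop b w.
Proof.
rewrite drop_pnorm; apply: le_trans (snd_le_pnorm _) => /=.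
by rewrite normrM (gtr0_norm (x := k^-1)) ?invr_gt0.
Qed.

Lemma drop_gt0 b w : 0 < b -> 0 < drop b w.
Proof.
move=> b0; apply: lt_le_trans (drop_ge_b _ _).
by rewrite gtr0_norm // divr_gt0.
Qed.

Lemma drop_gt_w b w : 0 < b -> enorm w < Num.sqrt k * drop b w.
Proof.
move=> b0; rewrite -ltr_sqr ?nnegrE ?enorm_ge0 ?mulr_ge0 ?drop_ge0 ?sqrtr_ge0 //.
rewrite exprMn sqrtk_sqr drop_sqr.
have -> : k * (b ^+ 2 / k ^+ 2 + enorm w ^+ 2 / k) = b ^+ 2 / k + enorm w ^+ 2.
  by field; rewrite gt_eqF.
by rewrite ltrDr divr_gt0 // exprn_gt0.
Qed.

Lemma drop_ltb b b' w : 0 <= b -> b < b' -> drop b w < drop b' w.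
Proof.
move=> b0 bb; have b'0 : 0 < b' by exact: le_lt_trans bb.
rewrite -ltr_sqr ?nnegrE ?drop_ge0 // !drop_sqr ltrD2r.
by rewrite ltr_pM2r ?invr_gt0 ?exprn_gt0 // ltr_sqr ?nnegrE // ltW.
Qed.

Lemma phib_ltb Y b b' x : 0 <= b -> b < b' ->
  phib kappa Y b' x < phib kappa Y b x.
Proof.
move=> b0 bb; rewrite !phibE; have := drop_ltb (x - Y.1) b0 bb.
have : kappa * b / k < kappa * b' / k.
  by rewrite ltr_pM2r ?invr_gt0 // ltr_pM2l.
lra.
Qed.

Lemma phib_leb Y b b' x : 0 <= b -> 0 <= b' ->
  (phib kappa Y b' x <= phib kappa Y b x) = (b <= b').
Proof.
move=> b0 b'0; case: (leP b b') => h.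
  move: h; rewrite le_eqVlt => /orP[/eqP->|h]; first by rewrite !lexx.
  by rewrite !ltW // phib_ltb.
by apply/negbTE; rewrite -ltNge phib_ltb.
Qed.

Lemma phib_inj Y b b' x : 0 <= b -> 0 <= b' ->
  phib kappa Y b x = phib kappa Y b' x -> b = b'.
Proof.
move=> b0 b'0 e; apply/eqP; rewrite eq_le.
by rewrite -(phib_leb Y x b0 b'0) -(phib_leb Y x b'0 b0) e lexx.
Qed.

Lemma phib_lipx Y b x x' :
  `|phib kappa Y b x - phib kappa Y b x'| <= enorm (x - x') / Num.sqrt k.
Proof.
rewrite !phibE; have := drop_lip b b (x' - Y.1) (x - Y.1).
rewrite subrr normr0 mul0r addr0 opprB addrA subrK enormB.
by congr (`|_| <= _); ring.
Qed.

(** The linear term and [drop] contribute kappa/k + 1/k = 1/(kappa - 1), with k = kappa^2 - 1. *)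
Lemma phib_lipb Y b b' x :
  `|phib kappa Y b x - phib kappa Y b' x| <= `|b - b'| / (kappa - 1).
Proof.
rewrite !phibE; have := drop_lip b b' (x - Y.1) (x - Y.1).
rewrite subrr enorm0 mul0r add0r.
have -> : Y.2 - kappa * b / k - drop b (x - Y.1)
   - (Y.2 - kappa * b' / k - drop b' (x - Y.1)) =
   - (kappa * (b - b') / k) - (drop b (x - Y.1) - drop b' (x - Y.1)) by ring.
move=> h; apply: (le_trans (ler_normB _ _)); rewrite normrN.
apply: (le_trans (lerD (lexx _) h)).
rewrite !normrM (gtr0_norm (x := k^-1)) ?invr_gt0 //.
rewrite (gtr0_norm (x := kappa)); last by [].
rewrite le_eqVlt; apply/orP; left; apply/eqP.
have k1 : kappa - 1 != 0 by rewrite subr_eq0 gt_eqF.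
have k2 : kappa + 1 != 0 by rewrite gt_eqF // addr_gt0.
have -> : k = (kappa - 1) * (kappa + 1) by ring.
by field; rewrite k1 k2.
Qed.

Lemma cfun_lip X X' Y Y' :
  `|cfun kappa X Y - cfun kappa X' Y'| <=
  (kappa + 1) * (pnorm (X - X') + pnorm (Y - Y')).
Proof.
have -> : cfun kappa X Y - cfun kappa X' Y' =
  kappa * ((Y - Y').2 - (X - X').2) - (pnorm (X - Y) - pnorm (X' - Y')).
  by rewrite /cfun /=; ring.
apply: (le_trans (ler_normB _ _)); rewrite mulrDl mul1r; apply: lerD.
  rewrite normrM gtr0_norm //.
  apply: ler_wpM2l; first exact: ltW.
  by rewrite (le_trans (ler_normB _ _)) // addrC lerD // snd_le_pnorm.
apply: (le_trans (pnorm_lip _ _)).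
have -> : X - Y - (X' - Y') = (X - X') - (Y - Y').
  exact: subrACA.
by rewrite (le_trans (pnormD _ _)) // pnormN.
Qed.

(* "Vertex" stands here and below for the point [X] through which a hyperboloid
   is drawn, not for its lowest or highest point. *)
Lemma drop_vertex X Y :
  drop (cfun kappa X Y) (X.1 - Y.1) = (kappa * pnorm (X - Y) - (Y.2 - X.2)) / k.
Proof.
have hle : Y.2 - X.2 <= pnorm (X - Y).
  rewrite pnormB; apply: le_trans (snd_le_pnorm _); exact: ler_norm.
have r0 := pnorm_ge0 (X - Y).
have ge0 : 0 <= (kappa * pnorm (X - Y) - (Y.2 - X.2)) / k.
  rewrite divr_ge0 ?(ltW k_gt0) // subr_ge0 (le_trans hle) //.
  by rewrite ler_peMl // ltW.
rewrite -(ger0_norm ge0) -sqrtr_sqr; congr Num.sqrt.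
have -> : enorm (X.1 - Y.1) ^+ 2 = pnorm (X - Y) ^+ 2 - (Y.2 - X.2) ^+ 2.
  by rewrite pnorm_sqr /=; ring.
by rewrite /cfun; field; rewrite gt_eqF.
Qed.

Lemma phi_vertex X Y : phi kappa X.1 Y X = X.2.
Proof.
rewrite /phi phibE drop_vertex /cfun; field.
by rewrite gt_eqF.
Qed.

(** The vector that turns increments of [drop] into inner products, found by multiplying a
    difference of two square roots by their sum. For x = x' it is the gradient of [drop] at x -
    y. *)
Definition slope x x' y b : 'rV[R]_n :=
  (k * (drop b (x - y) + drop b (x' - y)))^-1 *: (x + x' - 2 *: y).

Lemma drop_sub x x' y b : 0 < b ->
  drop b (x - y) - drop b (x' - y) = dot (x - x') (slope x x' y b).
Proof.
move=> b0; have s1 := drop_gt0 (x - y) b0; have s2 := drop_gt0 (x' - y) b0.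
have e : (drop b (x - y) - drop b (x' - y)) * (drop b (x - y) + drop b (x' - y))
   = dot (x - x') (x + x' - 2 *: y) / k.
  rewrite -subr_sqr !drop_sqr !enorm_sqr.
  have -> : dot (x - y) (x - y) = dot (x' - y) (x' - y)
       + dot (x - x') (x + x' - 2 *: y).
    rewrite !(dotDl, dotDr, dotNl, dotNr, dotZl, dotZr).
    rewrite (dotC y x) (dotC y x') (dotC x x'); ring.
  by field; rewrite gt_eqF.
rewrite /slope dotZr invfM mulrAC mulrC -[k^-1 * _]mulrC -e mulrC mulfK //.
by rewrite gt_eqF // addr_gt0.
Qed.

Lemma phib_sub Y b x x' : 0 < b ->
  phib kappa Y b x - phib kappa Y b x' = - dot (x - x') (slope x x' Y.1 b).
Proof. by move=> b0; rewrite !phibE -drop_sub //; ring. Qed.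

Lemma enorm_slope_num x x' y b : 0 < b ->
  enorm (x + x' - 2 *: y) < Num.sqrt k * (drop b (x - y) + drop b (x' - y)).
Proof.
move=> b0; have -> : x + x' - 2 *: y = (x - y) + (x' - y).
  by rewrite scaler_nat mulr2n opprD addrACA.
apply: (le_lt_trans (enormD _ _)); rewrite mulrDr.
by rewrite ltrD // drop_gt_w.
Qed.

Lemma slope_lt x x' y b : 0 < b -> enorm (slope x x' y b) < (Num.sqrt k)^-1.
Proof.
move=> b0; have s1 := drop_gt0 (x - y) b0; have s2 := drop_gt0 (x' - y) b0.
have sp : 0 < drop b (x - y) + drop b (x' - y) by rewrite addr_gt0.
rewrite /slope enormZ gtr0_norm ?invr_gt0 ?mulr_gt0 //.
rewrite mulrC ltr_pdivrMr ?mulr_gt0 //.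
apply: (lt_le_trans (enorm_slope_num x x' y b0)).
rewrite -[X in _ <= _ * (X * _)]sqrtk_sqr le_eqVlt; apply/orP; left; apply/eqP.
by field; rewrite gt_eqF.
Qed.

Definition slope_const : R := 4 / k * (1 + (Num.sqrt k)^-1).

Lemma slope_const_gt0 : 0 < slope_const.
Proof. by rewrite mulr_gt0 ?divr_gt0 // addr_gt0 ?invr_gt0. Qed.

(** A slope is a quotient w / (k T), and w1/T1 - w2/T2 = ((w1 - w2) + ((T2 - T1)/T2) w2) / T1. As
    |w2| <= sqrt(k) T2, the division by T2 is absorbed, so that a bound on 1/T1 alone controls the
    difference. *)
Lemma slope_lip x1 x1' y1 b1 x2 x2' y2 b2 H : 0 < b1 -> 0 < b2 ->
  (drop b1 (x1 - y1) + drop b1 (x1' - y1))^-1 <= H ->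
  enorm (slope x1 x1' y1 b1 - slope x2 x2' y2 b2) <=
  slope_const * H *
    (enorm (x1 - x2) + enorm (x1' - x2') + enorm (y1 - y2) + `|b1 - b2|).
Proof.
move=> b10 b20.
set T1 := drop b1 _ + _ => hH.
set T2 := drop b2 (x2 - y2) + drop b2 (x2' - y2).
have T1p : 0 < T1 by rewrite addr_gt0 ?drop_gt0.
have T2p : 0 < T2 by rewrite addr_gt0 ?drop_gt0.
set w1 := x1 + x1' - 2 *: y1; set w2 := x2 + x2' - 2 *: y2.
have hw2 : enorm w2 <= Num.sqrt k * T2 by rewrite ltW // enorm_slope_num.
set a := enorm (x1 - x2); set a' := enorm (x1' - x2').
set c := enorm (y1 - y2); set d := `|b1 - b2|.
have [a0 a'0 c0 d0] : [/\ 0 <= a, 0 <= a', 0 <= c & 0 <= d].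
  by rewrite /a /a' /c /d !enorm_ge0.
have hw : enorm (w1 - w2) <= a + a' + c *+ 2.
  have -> : w1 - w2 = (x1 - x2) + (x1' - x2') - 2 *: (y1 - y2).
    by apply/rowP => i; rewrite !mxE; ring.
  apply: (le_trans (enorm_sub_le _ _)); rewrite lerD ?enormD //.
  by rewrite enormZ normr_nat mulr_natl.
have hT : `|T1 - T2| <= (a + a' + c *+ 2) / Num.sqrt k + d *+ 2 / k.
  have h1 := drop_lip b1 b2 (x1 - y1) (x2 - y2).
  have h2 := drop_lip b1 b2 (x1' - y1) (x2' - y2).
  have ee u v : enorm ((u - y1) - (v - y2)) <= enorm (u - v) + c.
    by rewrite subrACA enorm_sub_le.
  have sk0 : 0 <= (Num.sqrt k)^-1 by rewrite invr_ge0 sqrtr_ge0.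
  have := ler_wpM2r sk0 (ee x1 x2); have := ler_wpM2r sk0 (ee x1' x2').
  rewrite -/a -/a' => h3 h4.
  have -> : T1 - T2 = (drop b1 (x1 - y1) - drop b2 (x2 - y2))
     + (drop b1 (x1' - y1) - drop b2 (x2' - y2)) by rewrite /T1 /T2; ring.
  apply: (le_trans (ler_normD _ _)).
  rewrite -/d in h1 h2; lra.
have -> : slope x1 x1' y1 b1 - slope x2 x2' y2 b2 =
  (k * T1)^-1 *: ((w1 - w2) + ((T2 - T1) / T2) *: w2).
  rewrite /slope -/T1 -/T2 -/w1 -/w2; apply/rowP => i; rewrite !mxE.
  by field; rewrite !gt_eqF.
rewrite enormZ ger0_norm; last by rewrite invr_ge0 mulr_ge0 // ltW.
have hb : enorm ((w1 - w2) + ((T2 - T1) / T2) *: w2) <=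
   4 * (1 + (Num.sqrt k)^-1) * (a + a' + c + d).
  apply: (le_trans (enormD _ _)); rewrite enormZ normrM normfV.
  rewrite (gtr0_norm T2p) distrC.
  have h2 : `|T1 - T2| / T2 * enorm w2 <= `|T1 - T2| * Num.sqrt k.
    rewrite -mulrA ler_wpM2l // mulrC ler_pdivrMr //.
  have h3 : `|T1 - T2| * Num.sqrt k <= a + a' + c *+ 2 + d *+ 2 / Num.sqrt k.
    have := ler_wpM2r (sqrtr_ge0 k) hT.
    have -> : ((a + a' + c *+ 2) / Num.sqrt k + d *+ 2 / k) * Num.sqrt k
      = a + a' + c *+ 2 + d *+ 2 / Num.sqrt k.
      rewrite mulrDl divfK ?gt_eqF //; congr (_ + _).
      rewrite -[in X in _ / X * _]sqrtk_sqr.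
      by field; rewrite gt_eqF.
    by [].
  have sk0 : 0 <= (Num.sqrt k)^-1 by rewrite invr_ge0 sqrtr_ge0.
  have [p1 p2 p3 p4] : [/\ 0 <= a * (Num.sqrt k)^-1, 0 <= a' * (Num.sqrt k)^-1,
    0 <= c * (Num.sqrt k)^-1 & 0 <= d * (Num.sqrt k)^-1].
    by split; apply: mulr_ge0.
  lra.
have H0 : 0 <= H by apply: le_trans hH; rewrite invr_ge0 ltW.
have s0 : 0 <= a + a' + c + d by rewrite !addr_ge0.
apply: (le_trans (ler_wpM2l _ hb)).
  by rewrite invr_ge0 mulr_ge0 // ltW.
rewrite invfM /slope_const.
have -> : k^-1 * T1^-1 * (4 * (1 + (Num.sqrt k)^-1) * (a + a' + c + d)) =
  (4 / k * (1 + (Num.sqrt k)^-1) * (a + a' + c + d)) * T1^-1 by ring.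
have -> : 4 / k * (1 + (Num.sqrt k)^-1) * H * (a + a' + c + d) =
  (4 / k * (1 + (Num.sqrt k)^-1) * (a + a' + c + d)) * H by ring.
apply: ler_wpM2l => //.
by rewrite mulr_ge0 // ltW // -/slope_const slope_const_gt0.
Qed.

End Hyperboloids.

(** * Derivatives of the hyperboloids in coordinate directions *)

Lemma is_derive_line (R : realType) (V : normedModType R) (f : V -> R)
    (a v : V) (d : R) :
  is_derive (0 : R) 1 (fun t => f (t *: v + a)) d -> is_derive a v f d.
Proof.
move=> [h1 h2].
have e : (fun h : R => h^-1 *: (f (h *: v + a) - f a)) =
  (fun h : R => h^-1 *: (((fun t => f (t *: v + a)) \o shift 0) (h *: (1 : R))
     - (fun t => f (t *: v + a)) 0)).
  by apply/funext => h /=; rewrite addr0 scale0r add0r -[h *: 1]/(h * 1) mulr1.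
split; first by rewrite /derivable /= /shift /= e; exact: h1.
by rewrite /derive /= /shift /= e -h2.
Qed.

Section Derivatives.
Variables (R : realType) (n : nat) (kappa : R).
Hypothesis kappa_gt1 : 1 < kappa.
Implicit Types (x y z w v : 'rV[R]_n) (X Y Z : pt R n) (b : R).

Local Notation k := (kappa ^+ 2 - 1).
Local Notation drop := (drop kappa).
Let k0 : 0 < k := k_gt0 kappa_gt1.

Lemma drop_sqr_coord b w i (t : R) : drop b (t *: coord_dir R i + w) ^+ 2 =
  drop b w ^+ 2 + (2 * w 0 i * t + t ^+ 2) / k.
Proof.
have de u : dot (coord_dir R i) u = u 0 i.
  rewrite /dot (bigD1 i) //= big1 => [|j ji]; rewrite !mxE eqxx.
    by rewrite /= eqxx mul1r addr0.
  by rewrite /= (negbTE ji) mul0r.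
rewrite !drop_sqr // !enorm_sqr !(dotDl, dotZl, dotDr, dotZr) de.
rewrite (dotC w) de /coord_dir mxE !eqxx /=; ring.
Qed.

Lemma is_derive_drop b w i : 0 < b ->
  is_derive (0 : R) 1 (fun t => drop b (t *: coord_dir R i + w))
    (w 0 i / (k * drop b w)).
Proof.
move=> b0; have s0 := drop_gt0 kappa_gt1 w b0.
have -> : (fun t => drop b (t *: coord_dir R i + w)) =
  Num.sqrt \o (fun t => drop b w ^+ 2 + (2 * w 0 i * t + t ^+ 2) / k).
  apply/funext => t /=; rewrite -drop_sqr_coord sqrtr_sqr ger0_norm //.
  exact: drop_ge0.
have hq : is_derive (0 : R) 1
   (fun t : R => drop b w ^+ 2 + (2 * w 0 i * t + t ^+ 2) / k) (2 * w 0 i / k).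
  have -> : (fun t : R => drop b w ^+ 2 + (2 * w 0 i * t + t ^+ 2) / k) =
     (cst (drop b w ^+ 2) + (k^-1 *: ((2 * w 0 i) *: (@id R) + (@id R) * (@id R)))).
    apply/funext => t; rewrite [in RHS]/GRing.add /= /cst.
    by rewrite [in RHS]/GRing.scale /= [in LHS]mulrC expr2.
  have h1 := is_derive_id (0 : R) (1 : R).
  have h2 := is_deriveM h1 h1.
  have h3 := is_deriveZ (2 * w 0 i) h1.
  have h4 := is_deriveD h3 h2.
  have h5 := is_deriveZ k^-1 h4.
  have h6 := is_deriveD (is_derive_cst (drop b w ^+ 2 : R) (0 : R) (1 : R)) h5.
  refine (is_derive_eq h6 _).
  rewrite /GRing.scale /=; ring.
have e : (2 * Num.sqrt (drop b w ^+ 2 + (2 * w 0 i * 0 + 0 ^+ 2) / k))^-1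
     = (2 * drop b w)^-1.
  by rewrite mulr0 expr0n /= addr0 mul0r addr0 sqrtr_sqr gtr0_norm.
set q := fun t : R => _ in hq *.
have hs : is_derive (q 0) 1 Num.sqrt ((2 * drop b w)^-1).
  rewrite -e; apply: is_derive1_sqrt.
  by rewrite /q mulr0 expr0n /= addr0 mul0r addr0 exprn_gt0.
refine (is_derive_eq (@is_derive1_comp _ _ _ _ _ _ hs hq) _).
by field; rewrite !gt_eqF.
Qed.

Lemma is_derive_drop2 b w i : 0 < b ->
  is_derive (0 : R) 1
    (fun t => - ((t *: coord_dir R i + w) 0 i
                 / (k * drop b (t *: coord_dir R i + w))))
    (- (k * drop b w ^+ 2 - w 0 i ^+ 2) / (k ^+ 2 * drop b w ^+ 3)).
Proof.
move=> b0; have s0 := drop_gt0 kappa_gt1 w b0.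
have -> : (fun t => - ((t *: coord_dir R i + w) 0 i
                 / (k * drop b (t *: coord_dir R i + w)))) =
  (- k^-1) *: ((@id R + cst (w 0 i)) *
     (fun t => (drop b (t *: coord_dir R i + w))^-1)).
  apply/funext => t; rewrite /coord_dir !mxE !eqxx /= mulr1.
  by rewrite -[RHS]/(- k^-1 * ((t + w 0 i) * _)) invfM; ring.
have e0 : drop b ((0 : R) *: coord_dir R i + w) = drop b w.
  by rewrite scale0r add0r.
have hv : is_derive (0 : R) 1 (fun t => (drop b (t *: coord_dir R i + w))^-1)
   (- drop b w ^- 2 *: (w 0 i / (k * drop b w))).
  rewrite -[in X in - X]e0; apply: is_deriveV.
    by rewrite e0 gt_eqF.
  exact: is_derive_drop.
apply: is_derive_eq; rewrite e0 /GRing.scale /=.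
rewrite [(id + _) 0]/GRing.add /= /cst.
by field; rewrite !gt_eqF.
Qed.

Lemma phib_line i x Y b :
  (fun t => phib kappa Y b (t *: coord_dir R i + x)) =
  (fun t => Y.2 - kappa * b / k - drop b (t *: coord_dir R i + (x - Y.1))).
Proof. by apply/funext => s; rewrite phibE addrA. Qed.

Lemma is_derive_phib i x Y b : 0 < b ->
  is_derive x (coord_dir R i) (phib kappa Y b)
    (- ((x - Y.1) 0 i / (k * drop b (x - Y.1)))).
Proof.
move=> b0; apply: is_derive_line; rewrite phib_line.
have hd := is_derive_drop (x - Y.1) i b0.
have -> : (fun t => Y.2 - kappa * b / k
             - drop b (t *: coord_dir R i + (x - Y.1))) =
  cst (Y.2 - kappa * b / k)
    - (fun t => drop b (t *: coord_dir R i + (x - Y.1))) by [].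
by apply: is_derive_eq; rewrite sub0r.
Qed.

Lemma DxphiE x Y X : 0 < cfun kappa X Y ->
  Dxphi kappa x Y X =
  - (k * drop (cfun kappa X Y) (x - Y.1))^-1 *: (x - Y.1).
Proof.
move=> c0; apply/rowP => i; rewrite !mxE.
have [_ ->] := is_derive_phib i x Y c0.
by rewrite !mxE mulNr mulrC.
Qed.

(** The one derivative to which the bounds [K] are applied. Differentiating twice in x leaves the
    focus and the vertex, hence the parameter, fixed. *)
Lemma partials2 i x Y X : 0 < cfun kappa X Y ->
  partials [:: inl (inl i); inl (inl i)]
    (fun p : 'rV[R]_n * pt R n * pt R n => phi kappa p.1.1 p.1.2 p.2) (x, Y, X) =
  - (k * drop (cfun kappa X Y) (x - Y.1) ^+ 2 - (x - Y.1) 0 i ^+ 2)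
    / (k ^+ 2 * drop (cfun kappa X Y) (x - Y.1) ^+ 3).
Proof.
move=> c0 /=.
set f := fun p : 'rV[R]_n * pt R n * pt R n => phi kappa p.1.1 p.1.2 p.2.
set v : 'rV[R]_n * pt R n * pt R n := (coord_dir R i, 0, 0).
have line t x' : t *: v + (x', Y, X) = (t *: coord_dir R i + x', Y, X).
  by rewrite /v -[LHS]/(_ + _, _ + _, _ + _) /= !scaler0 !add0r.
have d1 x' : 'D_v f (x', Y, X) =
   - ((x' - Y.1) 0 i / (k * drop (cfun kappa X Y) (x' - Y.1))).
  apply: derive_val; apply: is_derive_line.
  have -> : (fun t : R => f (t *: v + (x', Y, X))) =
     (fun t => phib kappa Y (cfun kappa X Y) (t *: coord_dir R i + x')).
    by apply/funext => t; rewrite line.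
  have hd := is_derive_drop (x' - Y.1) i c0.
  rewrite phib_line.
  have -> : (fun t => Y.2 - kappa * cfun kappa X Y / k
             - drop (cfun kappa X Y) (t *: coord_dir R i + (x' - Y.1))) =
   cst (Y.2 - kappa * cfun kappa X Y / k)
    - (fun t => drop (cfun kappa X Y) (t *: coord_dir R i + (x' - Y.1))) by [].
  by apply: is_derive_eq; rewrite sub0r.
apply: derive_val; apply: is_derive_line.
have -> : (fun t : R => 'D_v f (t *: v + (x, Y, X))) =
  (fun t => - ((t *: coord_dir R i + (x - Y.1)) 0 i
     / (k * drop (cfun kappa X Y) (t *: coord_dir R i + (x - Y.1))))).
  by apply/funext => t; rewrite line d1 addrA.
exact: is_derive_drop2.
Qed.

End Derivatives.

(** * Refractors *)

Lemma bounded_set_le (R : realType) (V : normedModType R) (A : set V) :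
  bounded_set A -> exists2 B : R, 0 <= B & forall x, A x -> `|x| <= B.
Proof.
move=> [M [Mr h]]; exists (Num.max 0 M + 1).
  by rewrite addr_ge0 // le_max lexx.
move=> x Ax; apply: h Ax; rewrite ltr_pwDr // le_max lexx orbT //.
Qed.

Section Setting.
Variables (R : realType) (n : nat) (kappa : R).
Hypothesis kappa_gt1 : 1 < kappa.
Variables (Omega : set 'rV[R]_n) (Sigma : set (pt R n)) (tau0 tau1 omega : R).
Variable s : pt R n -> pt R n -> R.
Hypothesis setting : parallel_setting kappa Omega Sigma tau0 tau1 omega s.
Implicit Types (x y z w v : 'rV[R]_n) (X Y Z : pt R n) (b t : R).

Local Notation k := (kappa ^+ 2 - 1).
Local Notation drop := (drop kappa).
Local Notation Delta := (Delta Omega Sigma).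
Let k0 : 0 < k := k_gt0 kappa_gt1.
Let kappa0 : 0 < kappa := kappa_gt0 kappa_gt1.

Lemma Omega_conv x y t : Omega x -> Omega y -> 0 <= t <= 1 ->
  Omega ((1 - t) *: x + t *: y).
Proof.
move=> Ox Oy t01; have h := Omega_convex setting.
have ht : Itv.spec (Itv.num_sem (R := R)) (Itv.Real `[0%Z, 1%Z]) t.
  by rewrite /= /Itv.num_sem /= num_real /= in_itv /= t01.
have := h y x (Itv.mk ht).
rewrite !inE => /(_ Oy Ox).
by rewrite /conv /= /unstable.onem addrC.
Qed.

Lemma Omega_ball x : Omega x ->
  exists2 r, 0 < r & forall p, enorm p < r -> Omega (x + p).
Proof.
move=> Ox; have /nbhs_ballP[r r0 hr] : nbhs x Omega.
  by apply: open_nbhs_nbhs; split => //; exact: (Omega_open setting).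
exists r => // p pr; apply: hr; rewrite -ball_normE /= opprD addrA subrr sub0r.
by rewrite normrN (le_lt_trans (mx_norm_le_enorm p)).
Qed.

(** Makes the two nested suprema in [Delta] suprema of bounded sets; on an unbounded set [sup] has
    only a default value. *)
Lemma diam_le : exists B : R, forall Y p q, Sigma Y ->
  (Omega `|` [set Y.1]) p -> (Omega `|` [set Y.1]) q -> enorm (p - q) <= B.
Proof.
have [B1 B10 h1] := bounded_set_le (Omega_bounded setting).
have [B2 B20 h2] := bounded_set_le (compact_bounded (Sigma_compact setting)).
have hb Y p : Sigma Y -> (Omega `|` [set Y.1]) p -> enorm p <= n%:R * (B1 + B2).
  move=> SY hp; apply: (le_trans (enorm_le_mx_norm _)); apply: ler_wpM2l => //.
  case: hp => [Op|->]; first by rewrite (le_trans (h1 _ Op)) // lerDl.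
  rewrite (@le_trans _ _ B2) ?lerDr // (le_trans _ (h2 _ SY)) //.
  by rewrite prod_normE le_max lexx.
exists (n%:R * (B1 + B2) + n%:R * (B1 + B2)) => Y p q SY hp hq.
by rewrite (le_trans (enorm_sub_le _ _)) // lerD // (hb Y).
Qed.

Lemma enorm_le_Delta Y p q : Sigma Y ->
  (Omega `|` [set Y.1]) p -> (Omega `|` [set Y.1]) q -> enorm (p - q) <= Delta.
Proof.
move=> SY hp hq; have [B hB] := diam_le.
apply: (@le_trans _ _ (ediam (Omega `|` [set Y.1]))).
  apply: ub_le_sup; last by exists p, q.
  by exists B => _ [p' [q' [hp' hq' ->]]]; exact: (hB Y).
apply: ub_le_sup; last by exists Y.
exists B => _ [Y' SY' <-]; apply: ge_sup.
  by exists (enorm (Y'.1 - Y'.1)), Y'.1, Y'.1; split => //; right.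
by move=> _ [p' [q' [hp' hq' ->]]]; exact: (hB Y').
Qed.

Lemma height_Delta Y t : Sigma Y -> t <= tau0 ->
  0 < Y.2 - t /\ kappa * Delta <= (kappa - 1) * (Y.2 - t).
Proof.
move=> SY ht; have /andP[h1 _] := Sigma_slab setting SY.
have h2 := tau0_lt_tau1 setting.
have := tau1_ge setting; rewrite ge_max => /andP[_ h3].
have k1 : 0 < kappa - 1 by rewrite subr_gt0.
split; first by lra.
have h4 : kappa * Delta / (kappa - 1) <= Y.2 - t by lra.
by move: h4; rewrite ler_pdivrMr // [X in _ <= X]mulrC.
Qed.

Lemma height_gt0 Y t : Sigma Y -> t <= tau0 -> 0 < Y.2 - t.
Proof. by move=> SY ht; have [] := height_Delta SY ht. Qed.

Lemma dist_height x Y t : Omega x -> Sigma Y -> t <= tau0 ->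
  kappa * enorm (x - Y.1) <= (kappa - 1) * (Y.2 - t).
Proof.
move=> Ox SY ht; have [_ h] := height_Delta SY ht; apply: le_trans h.
rewrite ler_pM2l //; apply: (enorm_le_Delta SY); [by left|by right].
Qed.

Lemma pnorm_height_le x Y t : Omega x -> Sigma Y -> t <= tau0 ->
  kappa * pnorm ((x, t) - Y) <= (2 * kappa - 1) * (Y.2 - t).
Proof.
move=> Ox SY ht; have h := dist_height Ox SY ht; have h0 := height_gt0 SY ht.
have := ler_wpM2l (ltW kappa0) (pnorm_le ((x, t) - Y)).
rewrite /= distrC (gtr0_norm h0); lra.
Qed.

(** Per unit of height, |X - Y| is at most (2 kappa - 1)/kappa, and kappa - (2 kappa - 1)/kappa =
    (kappa - 1)^2/kappa. *)
Lemma cfun_ge x Y t : Omega x -> Sigma Y -> t <= tau0 ->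
  (kappa - 1) ^+ 2 / kappa * (Y.2 - t) <= cfun kappa (x, t) Y.
Proof.
move=> Ox SY ht; have := pnorm_height_le Ox SY ht.
rewrite mulrC -ler_pdivlMr // /cfun /= => h.
apply: le_trans (lerB (lexx _) h); rewrite le_eqVlt; apply/orP; left; apply/eqP.
by field; rewrite gt_eqF.
Qed.

Lemma cfun_gt0 x Y t : Omega x -> Sigma Y -> t <= tau0 ->
  0 < cfun kappa (x, t) Y.
Proof.
move=> Ox SY ht; apply: lt_le_trans (cfun_ge Ox SY ht).
by rewrite mulr_gt0 ?height_gt0 // divr_gt0 // exprn_gt0 // subr_gt0.
Qed.

Lemma phi_le_cfun x t x0 t0 Y : Omega x -> Omega x0 -> t <= tau0 -> t0 <= tau0 ->
  Sigma Y -> (phi kappa x Y (x0, t0) <= t) =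
             (cfun kappa (x, t) Y <= cfun kappa (x0, t0) Y).
Proof.
move=> Ox Ox0 ht ht0 SY; rewrite -[X in _ <= X](phi_vertex kappa_gt1 (x, t) Y).
by apply: phib_leb => //; apply: ltW; apply: cfun_gt0.
Qed.

Lemma phi_ge_cfun x t x0 t0 Y : Omega x -> Omega x0 -> t <= tau0 -> t0 <= tau0 ->
  Sigma Y -> (t <= phi kappa x Y (x0, t0)) =
             (cfun kappa (x0, t0) Y <= cfun kappa (x, t) Y).
Proof.
move=> Ox Ox0 ht ht0 SY; rewrite -[X in X <= _](phi_vertex kappa_gt1 (x, t) Y).
by apply: phib_leb => //; apply: ltW; apply: cfun_gt0.
Qed.

(** Since k = (kappa - 1)(kappa + 1), this is (2 (kappa - 1))^3 divided by ((kappa - 1)^2/kappa)^2.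
    The cube comes from k D <= 2 (kappa - 1) h and the square from c >= ((kappa - 1)^2/kappa) h,
    where h is the height of [Y] above the vertex, D the [drop] there and c the parameter. *)
Definition height_const : R :=
  8 * k ^+ 3 / ((kappa + 1) ^+ 3 * ((kappa - 1) ^+ 2 / kappa) ^+ 2).

(** The first factor converts heights h into drops: a sum of two drops is at least 2 c/k, and c/k >=
    h (kappa - 1)/(kappa (kappa + 1)). The maximum with 1 keeps the constant positive for every
    function [K]. *)
Definition drop_const (K : nat -> R) : R :=
  kappa * (kappa + 1) / (2 * (kappa - 1)) * (height_const * Num.max 1 (K 2%N)).

Lemma height_const_gt0 : 0 < height_const.
Proof.
have kp : 0 < kappa + 1 by rewrite addr_gt0.
have k1 : 0 < kappa - 1 by rewrite subr_gt0.
by rewrite divr_gt0 // mulr_gt0 // exprn_gt0 // divr_gt0 // exprn_gt0.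
Qed.

Lemma drop_const_gt0 K : 0 < drop_const K.
Proof.
have kp : 0 < kappa + 1 by rewrite addr_gt0.
have k1 : 0 < kappa - 1 by rewrite subr_gt0.
have m0 : 0 < Num.max 1 (K 2%N) by rewrite lt_max ltr01.
have hc := height_const_gt0.
apply: mulr_gt0; last exact: mulr_gt0.
by apply: divr_gt0; apply: mulr_gt0.
Qed.

(* At the vertex the pure second x-derivatives of [phi] are comparable to the
   inverse of the height of [Y] above it, so that [K 2] bounds this inverse;
   every other constant then follows from the explicit formula for [phi]. *)
Lemma inv_height_le (n_gt0 : (0 < n)%N) K :
  phi_derivative_bounds kappa Omega Sigma tau0 K ->
  forall Y t, Sigma Y -> t <= tau0 ->
  (Y.2 - t)^-1 <= height_const * Num.max 1 (K 2%N).
Proof.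
move=> hK Y t SY ht; have [x Ox] := Omega_nonempty setting.
have h0 := height_gt0 SY ht.
have g0 := height_gt0 SY (lexx tau0).
(* [K] bounds derivatives only for vertices in the cylinder, whereas [t] may be negative; the top
   tau0 is the worst height. *)
apply: (@le_trans _ _ (Y.2 - tau0)^-1); first by rewrite lef_pV2 ?posrE //; lra.
have cyl : cylinder Omega tau0 (x, tau0).
  by split => //=; rewrite lexx andbT ltW // (tau0_gt0 setting).
have c0 := cfun_gt0 Ox SY (lexx tau0).
have := hK [:: inl (inl (Ordinal n_gt0)); inl (inl (Ordinal n_gt0))] isT
  x Y (x, tau0) Ox SY cyl.
rewrite partials2 //=.
set c := cfun kappa _ Y in c0 *; set D := drop c _; set be := (x - Y.1) 0 _.
have D0 : 0 < D by apply: drop_gt0.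
have hD : D * k = kappa * pnorm ((x, tau0) - Y) - (Y.2 - tau0).
  have := drop_vertex kappa_gt1 (x, tau0) Y; rewrite /= -/c -/D => ->.
  by rewrite divfK // gt_eqF.
have hc : (kappa - 1) ^+ 2 / kappa * (Y.2 - tau0) <= c by exact: cfun_ge.
set h := Y.2 - tau0 in h0 g0 hD hc *.
have hDle : D * k <= 2 * (kappa - 1) * h.
  by rewrite hD; have := pnorm_height_le Ox SY (lexx tau0); rewrite -/h; lra.
have hb : c ^+ 2 / k <= k * D ^+ 2 - be ^+ 2.
  have hbe : be ^+ 2 <= enorm (x - Y.1) ^+ 2.
    rewrite -(real_normK (num_real be)) ler_sqr ?nnegrE ?enorm_ge0 //.
    exact: enorm_coord.
  rewrite /D drop_sqr // mulrDr mulrA.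
  have -> : k * c ^+ 2 / k ^+ 2 = c ^+ 2 / k by field; rewrite gt_eqF.
  have -> : k * (enorm (x - Y.1) ^+ 2 / k) = enorm (x - Y.1) ^+ 2.
    by field; rewrite gt_eqF.
  by rewrite -addrA lerDl subr_ge0.
have hb0 : 0 <= k * D ^+ 2 - be ^+ 2.
  by apply: le_trans hb; rewrite divr_ge0 ?sqr_ge0 // ltW.
rewrite mulNr normrN ger0_norm; last first.
  by rewrite divr_ge0 // mulr_ge0 ?exprn_ge0 // ltW.
rewrite ler_pdivrMr; last by rewrite mulr_gt0 // exprn_gt0.
move=> hKK.
set m := Num.max 1 (K 2%N).
have m0 : 0 < m by rewrite lt_max ltr01.
have h1 : c ^+ 2 / k <= m * (k ^+ 2 * D ^+ 3).
  apply: (le_trans hb); apply: (le_trans hKK); apply: ler_wpM2r.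
    by rewrite mulr_ge0 ?exprn_ge0 // ltW.
  by rewrite le_max lexx orbT.
have h2 : c ^+ 2 <= m * (D * k) ^+ 3.
  move: h1; rewrite ler_pdivrMr // => h1; apply: (le_trans h1).
  by rewrite le_eqVlt; apply/orP; left; apply/eqP; ring.
have h3 : (D * k) ^+ 3 <= (2 * (kappa - 1) * h) ^+ 3.
  by rewrite lerXn2r ?nnegrE ?mulr_ge0 ?(ltW D0) ?(ltW k0) ?(ltW g0) ?subr_ge0 ?(ltW kappa_gt1).
have h4 : ((kappa - 1) ^+ 2 / kappa * h) ^+ 2 <= c ^+ 2.
  rewrite lerXn2r ?nnegrE ?(ltW c0) // mulr_ge0 ?(ltW g0) //.
  by rewrite divr_ge0 ?sqr_ge0 // ltW.
have h5 : ((kappa - 1) ^+ 2 / kappa * h) ^+ 2 <= m * (2 * (kappa - 1) * h) ^+ 3.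
  apply: (le_trans h4); apply: (le_trans h2); apply: ler_wpM2l h3; exact: ltW.
have k1 : 0 < kappa - 1 by rewrite subr_gt0.
have kp : 0 < kappa + 1 by rewrite addr_gt0.
have e : height_const * m * ((kappa - 1) ^+ 2 / kappa) ^+ 2 * h ^+ 3
     = m * (2 * (kappa - 1) * h) ^+ 3.
  rewrite /height_const (_ : k = (kappa - 1) * (kappa + 1)); last by ring.
  by field; rewrite !gt_eqF.
rewrite -(ler_pM2r (x := ((kappa - 1) ^+ 2 / kappa) ^+ 2 * h ^+ 3)); last first.
  by rewrite mulr_gt0 // exprn_gt0 // divr_gt0 // exprn_gt0.
rewrite [leRHS]mulrA e; apply: le_trans h5.
by rewrite le_eqVlt; apply/orP; left; apply/eqP; field; rewrite !gt_eqF.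
Qed.

Lemma inv_drop_le (n_gt0 : (0 < n)%N) K :
  phi_derivative_bounds kappa Omega Sigma tau0 K ->
  forall x t Y w w', Omega x -> t <= tau0 -> Sigma Y ->
  (drop (cfun kappa (x, t) Y) w + drop (cfun kappa (x, t) Y) w')^-1
    <= drop_const K.
Proof.
move=> hK x t Y w w' Ox ht SY; have h0 := height_gt0 SY ht.
have c0 := cfun_gt0 Ox SY ht; have cge := cfun_ge Ox SY ht.
have k1 : 0 < kappa - 1 by rewrite subr_gt0.
have kp : 0 < kappa + 1 by rewrite addr_gt0.
set c := cfun _ _ _ in c0 cge *.
have h1 : (kappa - 1) / (kappa * (kappa + 1)) * (Y.2 - t) <= c / k.
  rewrite ler_pdivlMr //; apply: le_trans cge.
  rewrite le_eqVlt; apply/orP; left; apply/eqP; field.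
  by rewrite !gt_eqF.
have h2 := drop_ge_b kappa_gt1 c w; have h3 := drop_ge_b kappa_gt1 c w'.
rewrite gtr0_norm // in h2; rewrite gtr0_norm // in h3.
have e : kappa * (kappa + 1) / (2 * (kappa - 1)) * (Y.2 - t)^-1
   = (2 * ((kappa - 1) / (kappa * (kappa + 1)) * (Y.2 - t)))^-1.
  by field; rewrite !gt_eqF.
apply: (@le_trans _ _ (kappa * (kappa + 1) / (2 * (kappa - 1)) * (Y.2 - t)^-1)).
  rewrite e lef_pV2 ?posrE; first by lra.
    by rewrite addr_gt0 // drop_gt0.
  by rewrite !mulr_gt0 // invr_gt0 mulr_gt0.
rewrite /drop_const ler_pM2l; first exact: inv_height_le.
by rewrite divr_gt0 ?mulr_gt0.
Qed.

Section Refractor.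
Variable u : 'rV[R]_n -> R.
Hypothesis refractor : parallel_refractor kappa Omega Sigma tau0 u.
Local Notation F := (Fu kappa Omega Sigma u).

Lemma refractor_le x : Omega x -> u x <= tau0.
Proof. by move=> Ox; have [/(_ x Ox)/andP[]] := refractor. Qed.

Lemma refractor_cylinder x : Omega x -> cylinder Omega tau0 (x, u x).
Proof.
by move=> Ox; split => //=; have [/(_ x Ox)/andP[/ltW -> ->]] := refractor.
Qed.

(** The supporting hyperboloid in the definition of a refractor comes with some parameter b; as it
    passes through (x, u x), injectivity in b identifies it with the one used in [Fu]. *)
Lemma Fu_nonempty x : Omega x -> exists Y, F x Y.
Proof.
move=> Ox; have [_ /(_ x Ox)[Y [b [SY /andP[b0 _] hle he]]]] := refractor.
have e : b = cfun kappa (x, u x) Y.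
  apply: (@phib_inj _ _ _ kappa_gt1 Y _ _ x (ltW b0)).
    by rewrite ltW // cfun_gt0 // refractor_le.
  by rewrite -he -[RHS]/(phi kappa (x, u x).1 Y (x, u x)) phi_vertex.
by exists Y; split => // z Oz; rewrite /phi -e; exact: hle.
Qed.

Lemma Fu_cfun x0 Y : Omega x0 -> F x0 Y <->
  Sigma Y /\ forall x, Omega x ->
    cfun kappa (x, u x) Y <= cfun kappa (x0, u x0) Y.
Proof.
move=> Ox0; split=> -[SY h]; split=> // x Ox; have := h x Ox;
  by rewrite phi_le_cfun ?refractor_le.
Qed.

(** A support at z stays below [u] at z' and falls by at most |z - z'| / sqrt(k); then z and z' are
    exchanged. *)
Lemma refractor_lip x x' : Omega x -> Omega x' ->
  `|u x - u x'| <= enorm (x - x') / Num.sqrt k.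
Proof.
have h z z' : Omega z -> Omega z' -> u z - u z' <= enorm (z - z') / Num.sqrt k.
  move=> Oz Oz'; have [Y [SY hY]] := Fu_nonempty Oz.
  have := hY _ Oz'; have := phi_vertex kappa_gt1 (z, u z) Y => /= e.
  have := phib_lipx kappa_gt1 Y (cfun kappa (z, u z) Y) z z'.
  rewrite ler_norml => /andP[_]; rewrite -!/(phi kappa _ Y (z, u z)) e; lra.
move=> Ox Ox'; rewrite ler_norml h // andbT.
by have := h _ _ Ox' Ox; rewrite enormB; lra.
Qed.

End Refractor.

End Setting.

(** * Property (P) *)

Lemma lipschitz_continuous (R : realType) (V : normedModType R) (f : V -> R)
    (L : R) :
  (forall a b, `|f a - f b| <= L * `|a - b|) -> continuous f.
Proof.
move=> h a; apply/cvgrPdist_lt => e e0.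
have L1 : 0 < `|L| + 1 by apply: ltr_wpDl.
near=> b; apply: (le_lt_trans (h a b)).
apply: (@le_lt_trans _ _ ((`|L| + 1) * `|a - b|)).
  by rewrite ler_wpM2r // (le_trans (ler_norm L)) // lerDl.
rewrite mulrC -ltr_pdivlMr //.
near: b; apply/nbhs_ballP; exists (e / (`|L| + 1)); first exact: divr_gt0.
by move=> b; rewrite -ball_normE.
Unshelve. all: by end_near. Qed.

Lemma eball_segment (R : realType) (n : nat) (x a b c : 'rV[R]_n) (r : R) :
  eball x r a -> eball x r b -> segment a b c -> eball x r c.
Proof.
move=> ha hb [t /= /andP[t0 t1] <-]; rewrite /eball /= in ha hb *.
have -> : (1 - t) *: a + t *: b - x = (1 - t) *: (a - x) + t *: (b - x).
  by apply/rowP => i; rewrite !mxE; ring.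
apply: (le_lt_trans (enormD _ _)); rewrite !enormZ.
rewrite (ger0_norm t0) ger0_norm ?subr_ge0 //.
have [->|tn0] := eqVneq t 0; first by rewrite subr0 mul1r mul0r addr0.
have tp : 0 < t by rewrite lt_def tn0.
have t1' : 0 <= 1 - t by rewrite subr_ge0.
have h1 := ler_wpM2l t1' (ltW ha).
have h2 : t * enorm (b - x) < t * r by rewrite ltr_pM2l.
lra.
Qed.

Section PropertyP.
Variables (R : realType) (n : nat) (kappa : R).
Hypothesis kappa_gt1 : 1 < kappa.
Hypothesis n_gt0 : (0 < n)%N.
Variables (Omega : set 'rV[R]_n) (Sigma : set (pt R n)) (tau0 tau1 omega : R).
Variable s : pt R n -> pt R n -> R.
Hypothesis setting : parallel_setting kappa Omega Sigma tau0 tau1 omega s.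
Variable K : nat -> R.
Hypothesis K_bound : phi_derivative_bounds kappa Omega Sigma tau0 K.
Implicit Types (x y z w v : 'rV[R]_n) (X Y Z : pt R n) (b t : R).

Local Notation k := (kappa ^+ 2 - 1).
Local Notation drop := (drop kappa).
Let k0 : 0 < k := k_gt0 kappa_gt1.
Let kappa0 : 0 < kappa := kappa_gt0 kappa_gt1.
Let kp : 0 < kappa + 1. Proof. by rewrite addr_gt0. Qed.
Let km : 0 < kappa - 1. Proof. by rewrite subr_gt0. Qed.

Definition slope_lip_const : R := slope_const kappa * drop_const kappa K.

Lemma slope_lip_const_gt0 : 0 < slope_lip_const.
Proof. by rewrite mulr_gt0 ?slope_const_gt0 ?drop_const_gt0. Qed.

Lemma phi_lip_height x x0 Y t t' :
  `|phi kappa x Y (x0, t) - phi kappa x Y (x0, t')| <=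
  (kappa + 1) / (kappa - 1) * `|t - t'|.
Proof.
apply: (le_trans (phib_lipb kappa_gt1 _ _ _ _)).
rewrite mulrAC ler_pM2r ?invr_gt0 //.
apply: (le_trans (cfun_lip kappa_gt1 _ _ _ _)).
rewrite subrr pnorm0 addr0.
have -> : (x0, t) - (x0, t') = (0, t - t') :> pt R n.
  by rewrite -[LHS]/(_ - _, _ - _) subrr.
by rewrite pnorm_0l.
Qed.

Lemma slope_lip_setting x t Y b2 x1 x1' x2 x2' y2 : Omega x -> t <= tau0 ->
  Sigma Y -> 0 < b2 ->
  enorm (slope kappa x1 x1' Y.1 (cfun kappa (x, t) Y)
    - slope kappa x2 x2' y2 b2) <=
  slope_lip_const * (enorm (x1 - x2) + enorm (x1' - x2') + enorm (Y.1 - y2)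
    + `|cfun kappa (x, t) Y - b2|).
Proof.
move=> Ox ht SY b20; apply: slope_lip => //.
  exact: (cfun_gt0 kappa_gt1 setting).
exact: (inv_drop_le kappa_gt1 setting).
Qed.

Lemma phi_expand x x' t Y : Omega x -> t <= tau0 -> Sigma Y ->
  phi kappa x' Y (x, t) =
  t - dot (x' - x) (slope kappa x' x Y.1 (cfun kappa (x, t) Y)).
Proof.
move=> Ox ht SY; have c0 := cfun_gt0 kappa_gt1 setting Ox SY ht.
have := phib_sub kappa_gt1 Y x' x c0.
rewrite -!/(phi kappa _ Y (x, t)).
have /= -> := phi_vertex kappa_gt1 (x, t) Y; lra.
Qed.

Lemma phi_mixed_difference x x0 t Y1 Y2 : Omega x0 -> t <= tau0 ->
  Sigma Y1 -> Sigma Y2 ->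
  `|phi kappa x Y1 (x0, t) - phi kappa x Y2 (x0, t)| <=
  (kappa + 2) * slope_lip_const * pnorm (Y1 - Y2) * enorm (x - x0).
Proof.
move=> Ox0 ht S1 S2.
have c1 := cfun_gt0 kappa_gt1 setting Ox0 S1 ht.
have c2 := cfun_gt0 kappa_gt1 setting Ox0 S2 ht.
rewrite !phi_expand //.
set g1 := slope _ _ _ Y1.1 _; set g2 := slope _ _ _ Y2.1 _.
have -> : t - dot (x - x0) g1 - (t - dot (x - x0) g2) = - dot (x - x0) (g1 - g2).
  by rewrite dotDr dotNr; ring.
rewrite normrN; apply: (le_trans (dot_norm_le _ _)).
rewrite mulrC; apply: ler_wpM2r; first exact: enorm_ge0.
apply: (le_trans (slope_lip_setting _ _ _ _ _ Ox0 ht S1 c2)).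
rewrite !subrr enorm0 !add0r [(kappa + 2) * _]mulrC -[_ * _ * pnorm _]mulrA.
apply: ler_wpM2l; first exact: ltW slope_lip_const_gt0.
have h1 := enorm_le_pnorm (Y1 - Y2).
have := cfun_lip kappa_gt1 (x0, t) (x0, t) Y1 Y2.
rewrite subrr pnorm0 add0r /= in h1 *; lra.
Qed.

Section Refractor.
Variable u : 'rV[R]_n -> R.
Hypothesis refractor : parallel_refractor kappa Omega Sigma tau0 u.
Local Notation F := (Fu kappa Omega Sigma u).

(** At [xbar] the support with focus [Ybar] equals [u] and so is not below the other one; at [xhat]
    the order is reversed. The equalities of parameters say that both supports pass through (x0,
    z). *)
Lemma supports_cross xbar xhat Ybar Yhat : Omega xbar -> Omega xhat ->
  F xbar Ybar -> F xhat Yhat ->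
  exists (t z : R), let x0 := (1 - t) *: xbar + t *: xhat in
    [/\ 0 <= t <= 1, z <= u x0,
        cfun kappa (x0, z) Ybar = cfun kappa (xbar, u xbar) Ybar &
        cfun kappa (x0, z) Yhat = cfun kappa (xhat, u xhat) Yhat].
Proof.
move=> Ob Oh Fb Fh; have [Sb hb] := Fb; have [Sh hh] := Fh.
pose x t := (1 - t) *: xbar + t *: xhat.
pose fb t := phi kappa (x t) Ybar (xbar, u xbar).
pose fh t := phi kappa (x t) Yhat (xhat, u xhat).
have xx a b : x a - x b = (a - b) *: (xhat - xbar).
  by apply/rowP => i; rewrite /x !mxE; ring.
have lip Y b a a' : `|phib kappa Y b (x a) - phib kappa Y b (x a')| <=
    enorm (xhat - xbar) / Num.sqrt k * `|a - a'|.
  apply: (le_trans (phib_lipx kappa_gt1 _ _ _ _)).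
  by rewrite xx enormZ [X in X / _ <= _]mulrC mulrAC.
have cont : continuous (fun t => fh t - fb t).
  apply: (@lipschitz_continuous _ _ _ (2 * (enorm (xhat - xbar) / Num.sqrt k))).
  move=> a a'; have h1 := lip Yhat (cfun kappa (xhat, u xhat) Yhat) a a'.
  have h2 := lip Ybar (cfun kappa (xbar, u xbar) Ybar) a a'.
  have -> : fh a - fb a - (fh a' - fb a') = (fh a - fh a') - (fb a - fb a').
    by ring.
  by apply: (le_trans (ler_normB _ _)); rewrite /fh /fb /phi; lra.
have x00 : x 0 = xbar by rewrite /x subr0 scale1r scale0r addr0.
have x11 : x 1 = xhat by rewrite /x subrr scale0r scale1r add0r.
have f0 : fh 0 - fb 0 <= 0.
  rewrite /fh /fb x00 subr_le0.
  by have /= -> := phi_vertex kappa_gt1 (xbar, u xbar) Ybar; exact: hh.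
have f1 : 0 <= fh 1 - fb 1.
  rewrite /fh /fb x11 subr_ge0.
  by have /= -> := phi_vertex kappa_gt1 (xhat, u xhat) Yhat; exact: hb.
have [t] : exists2 t, t \in `[0, 1] & fh t - fb t = 0.
  apply: (@IVT _ (fun t => fh t - fb t) 0 1 0) => //.
    exact: continuous_subspaceT.
  by rewrite ge_min f0 le_max f1 orbT.
rewrite in_itv /= => t01 /eqP; rewrite subr_eq0 => /eqP e.
have Ox : Omega (x t) by apply: (Omega_conv setting).
have zb : fb t <= u (x t) by apply: hb.
have zt : fb t <= tau0 by rewrite (le_trans zb) // (refractor_le refractor).
exists t, (fb t); split => //.
- apply: (phib_inj kappa_gt1 (Y := Ybar) (x := x t)).
  + by rewrite ltW // (cfun_gt0 kappa_gt1 setting).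
  + by rewrite ltW // (cfun_gt0 kappa_gt1 setting) // (refractor_le refractor).
  by rewrite -[LHS]/(phi kappa (x t, fb t).1 Ybar (x t, fb t)) phi_vertex.
- apply: (phib_inj kappa_gt1 (Y := Yhat) (x := x t)).
  + by rewrite ltW // (cfun_gt0 kappa_gt1 setting).
  + by rewrite ltW // (cfun_gt0 kappa_gt1 setting) // (refractor_le refractor).
  by rewrite -[LHS]/(phi kappa (x t, fb t).1 Yhat (x t, fb t)) phi_vertex // -e.
Qed.

(* Semiconvexity of [u]: its support at [x0] bounds [u x0] by the values at
   the endpoints, where [u] agrees with the two supports crossing at height
   [z]; expanding the latter at [x0] leaves only differences of slopes. *)
Lemma crossing_deficit xbar xhat Ybar Yhat t (z : R) :
  let x0 := (1 - t) *: xbar + t *: xhat in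
  Omega xbar -> Omega xhat -> F xbar Ybar -> F xhat Yhat ->
  enorm (xbar - xhat) <= pnorm (Ybar - Yhat) ->
  0 <= t <= 1 -> z <= u x0 ->
  cfun kappa (x0, z) Ybar = cfun kappa (xbar, u xbar) Ybar ->
  cfun kappa (x0, z) Yhat = cfun kappa (xhat, u xhat) Yhat ->
  u x0 - z <=
  (kappa + 4) * slope_lip_const * pnorm (Ybar - Yhat) * enorm (xbar - xhat).
Proof.
move=> x0 Ob Oh [Sb _] [Sh _] hD /andP[t0 t1] hz eb eh.
have Ox0 : Omega x0 by apply: (Omega_conv setting) => //; rewrite t0.
have ut := refractor_le refractor Ox0.
have zt : z <= tau0 by exact: le_trans ut.
have cb := cfun_gt0 kappa_gt1 setting Ox0 Sb zt.
have ch := cfun_gt0 kappa_gt1 setting Ox0 Sh zt.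
have [Y0 [S0 h0]] := Fu_nonempty kappa_gt1 setting refractor Ox0.
have c0 := cfun_gt0 kappa_gt1 setting Ox0 S0 ut.
set a := xbar - xhat in hD *.
have xb : xbar - x0 = t *: a by apply/rowP => i; rewrite !mxE; ring.
have xh : xhat - x0 = - (1 - t) *: a by apply/rowP => i; rewrite !mxE; ring.
have e1 : u xbar = z - t * dot a (slope kappa xbar x0 Ybar.1 (cfun kappa (x0, z) Ybar)).
  have := phib_sub kappa_gt1 Ybar xbar x0 cb.
  rewrite xb dotZl -[phib _ _ _ x0]/(phi kappa (x0, z).1 Ybar (x0, z)) phi_vertex //=.
  rewrite {1}eb -[phib _ _ _ _]/(phi kappa (xbar, u xbar).1 Ybar (xbar, u xbar)).
  rewrite phi_vertex //=; lra.
have e2 : u xhat = z + (1 - t) * dot a (slope kappa xhat x0 Yhat.1 (cfun kappa (x0, z) Yhat)).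
  have := phib_sub kappa_gt1 Yhat xhat x0 ch.
  rewrite xh dotZl -[phib _ _ _ x0]/(phi kappa (x0, z).1 Yhat (x0, z)) phi_vertex //=.
  rewrite {1}eh -[phib _ _ _ _]/(phi kappa (xhat, u xhat).1 Yhat (xhat, u xhat)).
  rewrite phi_vertex //=; lra.
have i1 : u x0 - t * dot a (slope kappa xbar x0 Y0.1 (cfun kappa (x0, u x0) Y0)) <= u xbar.
  have := phib_sub kappa_gt1 Y0 xbar x0 c0; have := h0 _ Ob.
  rewrite xb dotZl -[phib _ _ _ x0]/(phi kappa (x0, u x0).1 Y0 (x0, u x0)).
  rewrite phi_vertex //= -/(phi kappa xbar Y0 (x0, u x0)); lra.
have i2 : u x0 + (1 - t) * dot a (slope kappa xhat x0 Y0.1 (cfun kappa (x0, u x0) Y0)) <= u xhat.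
  have := phib_sub kappa_gt1 Y0 xhat x0 c0; have := h0 _ Oh.
  rewrite xh dotZl -[phib _ _ _ x0]/(phi kappa (x0, u x0).1 Y0 (x0, u x0)).
  rewrite phi_vertex //= -/(phi kappa xhat Y0 (x0, u x0)); lra.
move: e1 e2 i1 i2.
set gb := slope _ xbar _ Ybar.1 _; set gh := slope _ xhat _ Yhat.1 _.
set g0b := slope _ xbar _ _ _; set g0h := slope _ xhat _ _ _.
set L := slope_lip_const.
have L0 : 0 <= L by apply: ltW slope_lip_const_gt0.
set D := pnorm (Ybar - Yhat) in hD *.
have D0 : 0 <= D by exact: pnorm_ge0.
have a0 : 0 <= enorm a by exact: enorm_ge0.
(* These slopes differ only in their first point, by |xbar - xhat| <= D. In the next bound the
   distances of the points, of the foci and of the parameters count 1, 1 and kappa + 1; altogether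
   kappa + 4. *)
have n1 : enorm (g0b - g0h) <= L * D.
  apply: (le_trans (slope_lip_setting _ _ _ _ _ Ox0 ut S0 c0)).
  by rewrite !subrr enorm0 normr0 !addr0 ler_wpM2l.
have n2 : enorm (gb - gh) <= L * ((kappa + 3) * D).
  apply: (le_trans (slope_lip_setting _ _ _ _ _ Ox0 zt Sb ch)).
  rewrite subrr enorm0 addr0; apply: ler_wpM2l => //.
  have h1 := enorm_le_pnorm (Ybar - Yhat).
  have := cfun_lip kappa_gt1 (x0, z) (x0, z) Ybar Yhat.
  rewrite subrr pnorm0 add0r.
  rewrite -/D -/a /= in h1 *; lra.
move=> e1 e2 i1 i2.
(* With the barycentric weights 1 - t and t of x0, the displacements to both endpoints acquire the
   same factor t (1 - t). *)
have m : u x0 - z <= t * (1 - t) * dot a ((g0b - g0h) - (gb - gh)).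
  rewrite !(dotDr, dotNr).
  have m1 := ler_wpM2l (_ : 0 <= 1 - t) i1.
  have m2 := ler_wpM2l t0 i2.
  have t1' : 0 <= 1 - t by rewrite subr_ge0.
  have {m1} := m1 t1'; rewrite e1; move: m2; rewrite e2.
  set p := dot a g0b; set q := dot a g0h; set r := dot a gb; set w := dot a gh.
  move=> m2 m1.
  have := lerD m1 m2; rewrite -subr_ge0 => M; rewrite -subr_ge0.
  by apply: le_trans M _; rewrite le_eqVlt; apply/orP; left; apply/eqP; ring.
have dle : `|dot a ((g0b - g0h) - (gb - gh))| <= enorm a * (L * ((kappa + 4) * D)).
  apply: (le_trans (dot_norm_le _ _)); apply: ler_wpM2l => //.
  by apply: (le_trans (enorm_sub_le _ _)); lra.
have tt : 0 <= t * (1 - t) <= 1.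
  by apply/andP; split; nra.
have : t * (1 - t) * dot a ((g0b - g0h) - (gb - gh)) <=
   1 * `|dot a ((g0b - g0h) - (gb - gh))|.
  case/andP: tt => tt0 tt1.
  apply: (le_trans (ler_wpM2l tt0 (ler_norm _))).
  by apply: ler_wpM2r.
by rewrite mul1r; lra.
Qed.

(** The deficit u(x0) - z has the coefficient (kappa + 4) L, and moving a vertex vertically changes
    [phi] by at most (kappa + 1)/(kappa - 1) times the displacement. The mixed term asks for (kappa
    + 2) L, which is smaller because that ratio is at least 1. *)
Definition P_const : R :=
  (kappa + 1) / (kappa - 1) * (kappa + 4) * slope_lip_const.

Lemma ratio_ge1 : 1 <= (kappa + 1) / (kappa - 1).
Proof. by rewrite ler_pdivlMr // mul1r lerD2l (@le_trans _ _ 0). Qed.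

Lemma P_const_gt0 : 0 < P_const.
Proof.
rewrite mulr_gt0 ?slope_lip_const_gt0 // mulr_gt0 ?divr_gt0 //.
by rewrite addr_gt0.
Qed.

Lemma property_P_holds xstar delta c1 c2 :
  0 <= c1 -> eball xstar delta `<=` Omega ->
  (forall x0 Ybar Yhat x lambda, eball xstar delta x0 ->
    Sigma Ybar -> Sigma Yhat -> Omega x -> enorm (x - x0) <= c2 ->
    1 / 4 <= lambda <= 3 / 4 ->
    phi kappa x (Yseg kappa s Ybar Yhat (x0, u x0) lambda) (x0, u x0) <=
        Num.max (phi kappa x Ybar (x0, u x0)) (phi kappa x Yhat (x0, u x0))
        - c1 * pnorm (Ybar - Yhat) ^+ 2 * enorm (x - x0) ^+ 2) ->
  property_P kappa Omega Sigma s u xstar delta P_const c1 c2.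
Proof.
move=> c10 dO reg xbar xhat Ybar Yhat bb bh Fb Fh hD.
have Ob := dO _ bb; have Oh := dO _ bh.
have [t [z [t01 hz eb eh]]] := supports_cross Ob Oh Fb Fh.
set x0 := _ + _ in hz eb eh.
have bx0 : eball xstar delta x0 by apply: (eball_segment bb bh); exists t.
have Ox0 := dO _ bx0.
have def := crossing_deficit Ob Oh Fb Fh hD t01 hz eb eh.
exists x0; first by exists t.
move=> X0 lambda Y x hl _ SY Ox hx.
have [Sb _] := Fb; have [Sh _] := Fh.
have ut := refractor_le refractor Ox0.
have Sl : Sigma (Yseg kappa s Ybar Yhat X0 lambda).
  apply: (arc_defined setting _ Sb Sh _).2.
    exact: (refractor_cylinder refractor).
  by lra.
have L0 := slope_lip_const_gt0.
set L := slope_lip_const in def L0 *.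
have D0 := pnorm_ge0 (Ybar - Yhat); have a0 := enorm_ge0 (xbar - xhat).
set D := pnorm (Ybar - Yhat) in hD def D0 *.
set a := enorm (xbar - xhat) in hD def a0 *.
have reg1 := reg x0 Ybar Yhat x lambda bx0 Sb Sh Ox (ltW hx) hl.
rewrite -/X0 -/D in reg1.
have mixed := phi_mixed_difference x Ox0 ut Sl SY.
rewrite -/X0 -/L in mixed.
(* The hyperboloid through (x0, z) supports [u] from below; raising its vertex to (x0, u x0) spoils
   this by at most the ratio times the deficit. *)
have sup Y' x' : F x' Y' -> Omega x' ->
   cfun kappa (x0, z) Y' = cfun kappa (x', u x') Y' ->
   phi kappa x Y' X0 <= u x + (kappa + 1) / (kappa - 1) * (u x0 - z).
  move=> [SY' hY'] Ox' e; have h1 := hY' x Ox.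
  have h2 := phi_lip_height x x0 Y' (u x0) z.
  rewrite /phi /= -e -/(phi kappa x Y' (x0, z)) in h1.
  rewrite (ger0_norm (x := u x0 - z)) ?subr_ge0 // ler_norml in h2.
  by case/andP: h2 => _; rewrite -/X0; lra.
have supb := sup _ _ Fb Ob eb; have suph := sup _ _ Fh Oh eh.
have mx : Num.max (phi kappa x Ybar X0) (phi kappa x Yhat X0) <=
   u x + (kappa + 1) / (kappa - 1) * (u x0 - z).
  by rewrite ge_max supb.
have rr := ratio_ge1; set r := (kappa + 1) / (kappa - 1) in rr mx *.
have q1 : r * (u x0 - z) <= P_const * D * a.
  have := ler_wpM2l (le_trans ler01 rr) def.
  by rewrite /P_const -/r -/L; lra.
set P := pnorm (_ - Y) in mixed *.
have P0 : 0 <= P by exact: pnorm_ge0.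
have e0 := enorm_ge0 (x - x0).
have q2 : (kappa + 2) * L * P * enorm (x - x0) <= P_const * P * enorm (x - x0).
  rewrite -2!mulrA -[X in _ <= X]mulrA [X in X <= _]mulrA.
  apply: ler_wpM2r; first exact: mulr_ge0.
  rewrite /P_const -/r -/L; apply: ler_wpM2r; first exact: ltW.
  have k4 : 0 <= kappa + 4 by rewrite addr_ge0 // ltW.
  by have := ler_wpM2r k4 rr; lra.
rewrite ler_norml in mixed; case/andP: mixed => mixed _.
rewrite !mulNr.
set A1 := P_const * D * a in q1 *; set A2 := P_const * P * _ in q2 *.
set A3 := c1 * D ^+ 2 * _ in reg1 *; set ph := phi kappa x Y X0 in mixed *.
set pl := phi kappa x (Yseg _ _ _ _ _ _) X0 in reg1 mixed *.
set M := Num.max _ _ in reg1 mx *; set q := r * _ in q1 mx *.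
set E := (kappa + 2) * _ * _ * _ in q2 mixed *.
by clear -q1 q2 reg1 mixed mx; lra.
Qed.

End Refractor.
End PropertyP.

(** * The target in terms of slopes *)

Lemma lipschitz_within (R : realType) (V : normedModType R) (A : set V)
    (f : V -> R) (L : R) :
  (forall a b, A a -> A b -> `|f a - f b| <= L * `|a - b|) ->
  {within A, continuous f}.
Proof.
move=> h; apply/subspace_continuousP => a Aa; apply/cvgrPdist_lt => e e0.
have L1 : 0 < `|L| + 1 by rewrite ltr_wpDl.
near=> b.
have Ab : A b by near: b; exact: withinT.
apply: (le_lt_trans (h a b Aa Ab)).
apply: (@le_lt_trans _ _ ((`|L| + 1) * `|a - b|)).
  by rewrite ler_wpM2r // (le_trans (ler_norm L)) // lerDl.
rewrite mulrC -ltr_pdivlMr //.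
near: b; apply: (cvg_within (F := nbhs a)); apply/nbhs_ballP.
exists (e / (`|L| + 1)); first exact: divr_gt0.
by move=> b; rewrite -ball_normE.
Unshelve. all: by end_near. Qed.

Lemma compact_cluster_seq (R : realType) (V : normedModType R) (A : set V)
    (a : nat -> V) : compact A -> (forall m, A (a m)) ->
  exists2 l, A l & forall e, 0 < e -> forall N, exists2 m, (N <= m)%N &
    `|l - a m| < e.
Proof.
move=> cA aA.
have FA : (a @ \oo) A by exists 0%N => // m _; exact: aA.
have [l [Al cl]] := cA _ _ FA.
exists l => // e e0 N.
have h1 : (a @ \oo) [set b | exists2 m, (N <= m)%N & b = a m].
  by exists N => // m /= Nm; exists m.
have [b [[m Nm ->] h2]] := cl _ _ h1 (nbhsx_ballx l e e0).
by exists m => //; move: h2; rewrite -ball_normE.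
Qed.

Lemma le_of_small_errors (R : realType) (a b C e0 : R) : 0 < e0 ->
  (forall e, 0 < e -> e < e0 -> a <= b + C * e) -> a <= b.
Proof.
move=> e00 h; rewrite leNgt; apply/negP => ba.
have C1 : 0 < `|C| + 1 by rewrite ltr_wpDl.
have ab : 0 < a - b by rewrite subr_gt0.
pose e := Num.min (e0 / 2) ((a - b) / (2 * (`|C| + 1))).
have ep : 0 < e by rewrite lt_min !divr_gt0 // mulr_gt0.
have ee0 : e < e0 by rewrite gt_min ltr_pdivrMr //; apply/orP; left; lra.
have := h e ep ee0.
have : C * e <= (`|C| + 1) * e.
  by apply: ler_wpM2r; [exact: ltW|rewrite (le_trans (ler_norm C)) // lerDl].
have : (`|C| + 1) * e <= (a - b) / 2.
  rewrite mulrC -ler_pdivlMr // -mulrA -invfM ge_min.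
  by apply/orP; right; rewrite mulrC.
lra.
Qed.

Section Directions.
Variables (R : realType) (n : nat).
Implicit Types (x y d e : 'rV[R]_n).

Lemma orthogonal_exists d : (1 < n)%N -> d != 0 ->
  exists2 e, e != 0 & dot d e = 0.
Proof.
move=> n1 d0.
have [i di] : exists i, d 0 i != 0.
  apply/existsP; apply: contraNT d0; rewrite negb_exists => /forallP h.
  by apply/eqP/rowP => i; rewrite mxE; apply/eqP; have := h i; rewrite negbK.
have [j ji] : exists j : 'I_n, j != i.
  have [i0|i0] := eqVneq i (Ordinal (ltnW n1)).
    by exists (Ordinal n1); rewrite i0.
  by exists (Ordinal (ltnW n1)); rewrite eq_sym.
exists (d 0 j *: delta_mx 0 i - d 0 i *: delta_mx 0 j).
  apply/eqP => /rowP/(_ j); rewrite !mxE !eqxx /= (negbTE ji) mulr0 mulr1 sub0r.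
  by move/eqP; rewrite oppr_eq0 (negbTE di).
have dd (l : 'I_n) : dot d (delta_mx 0 l) = d 0 l.
  rewrite /dot (bigD1 l) //= big1 => [|m ml]; rewrite mxE eqxx /=.
    by rewrite eqxx mulr1 addr0.
  by rewrite (negbTE ml) mulr0.
by rewrite dotDr dotNr !dotZr !dd; ring.
Qed.

Lemma dot_inj_dim1 d x y : n = 1%N -> d != 0 -> dot d x = dot d y -> x = y.
Proof.
move=> n1; case: _ / (esym n1) d x y => d x y d0.
rewrite /dot !big_ord1 => /mulfI h; apply/rowP => i; rewrite ord1; apply: h.
apply: contraNneq d0 => h; apply/eqP/rowP => l; rewrite ord1 mxE //.
Qed.

End Directions.

Section RayDirections.
Variables (R : realType) (n : nat) (kappa : R).
Hypothesis kappa_gt1 : 1 < kappa.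
Implicit Types (x y z w v : 'rV[R]_n) (X Y Z L : pt R n) (b t : R).

Local Notation k := (kappa ^+ 2 - 1).
Local Notation drop := (drop kappa).
Let k0 : 0 < k := k_gt0 kappa_gt1.
Let kappa0 : 0 < kappa := kappa_gt0 kappa_gt1.

Lemma Dxphi_slope X Y : 0 < cfun kappa X Y ->
  Dxphi kappa X.1 Y X = - slope kappa X.1 X.1 Y.1 (cfun kappa X Y).
Proof.
move=> c0; rewrite DxphiE // /slope scaleNr; congr (- _).
have -> : X.1 + X.1 - 2 *: Y.1 = 2 *: (X.1 - Y.1).
  by apply/rowP => i; rewrite !mxE; ring.
rewrite scalerA; congr (_ *: _).
rewrite -mulr2n -[_ *+ 2]mulr_natl [k * (2 * _)]mulrCA [(2 * _)^-1]invfM.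
by rewrite mulrAC mulVf ?mul1r // pnatr_eq0.
Qed.

Lemma Dxphi_lt X Y : 0 < cfun kappa X Y ->
  enorm (Dxphi kappa X.1 Y X) < (Num.sqrt k)^-1.
Proof. by move=> c0; rewrite Dxphi_slope // enormN slope_lt. Qed.

(** Along a ray both x - y and the [drop] at the vertex are proportional to the distance r, which
    cancels: the slope sees the direction only. *)
Lemma Dxphi_ray X L r : 0 < r -> pnorm L = 1 -> 0 < cfun kappa X (raypt X r L) ->
  Dxphi kappa X.1 (raypt X r L) X = (kappa - L.2)^-1 *: L.1.
Proof.
move=> r0 L1 c0; rewrite DxphiE // drop_vertex //.
have -> : X - raypt X r L = - r *: L.
  by rewrite -[raypt X r L]/(X + r *: L) opprD addrA subrr sub0r scaleNr.
rewrite pnormZ normrN gtr0_norm // L1 mulr1 /raypt /=.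
have -> : X.1 - (X.1 + r *: L.1) = - r *: L.1.
  by rewrite opprD addrA subrr sub0r scaleNr.
have L2 : L.2 <= 1 by rewrite -L1 (le_trans (ler_norm _)) // snd_le_pnorm.
have kL : 0 < kappa - L.2 by rewrite subr_gt0 (le_lt_trans L2).
rewrite scalerA; congr (_ *: _).
have -> : kappa * r - (X.2 + r * L.2 - X.2) = r * (kappa - L.2) by ring.
by field; rewrite !gt_eqF.
Qed.

Lemma Lam_unit v : enorm v <= (Num.sqrt k)^-1 ->
  pnorm (Lam kappa v) = 1 /\ 0 < Qfun kappa v.
Proof.
move=> hv.
have hv2 : k * enorm v ^+ 2 <= 1.
  have := lerXn2r 2 (_ : enorm v \in Num.nneg) (_ : _ \in Num.nneg) hv.
  rewrite !nnegrE enorm_ge0 invr_ge0 sqrtr_ge0 => /(_ isT isT).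
  rewrite exprVn sqrtk_sqr // -[leRHS]mul1r ler_pdivlMr // mulrC //.
have v20 : 0 <= enorm v ^+ 2 by exact: sqr_ge0.
have d0 : 0 < 1 + enorm v ^+ 2 by rewrite ltr_wpDr.
have w0 : 0 <= 1 - k * enorm v ^+ 2 by rewrite subr_ge0.
have w1 : Num.sqrt (1 - k * enorm v ^+ 2) <= 1.
  by rewrite -[leRHS]sqrtr1 ler_wsqrtr // gerBl mulr_ge0 // ltW.
have q0 : 0 < Qfun kappa v by rewrite divr_gt0 // subr_gt0 (le_lt_trans w1).
split=> //.
rewrite pnorm_fst enormZ exprMn real_normK ?num_real //.
suff -> : Qfun kappa v ^+ 2 * enorm v ^+ 2 + (- Qfun kappa v + kappa) ^+ 2 = 1.
  by rewrite sqrtr1.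
have w2 := sqr_sqrtr w0.
rewrite /Qfun; set w := Num.sqrt _ in w2 *; set e := enorm v ^+ 2 in w2 d0 *.
have -> : ((kappa - w) / (1 + e)) ^+ 2 * e + (- ((kappa - w) / (1 + e)) + kappa) ^+ 2
   = (w ^+ 2 + kappa ^+ 2 * e) / (1 + e).
  by field; rewrite gt_eqF.
by rewrite w2; field; rewrite gt_eqF.
Qed.

(** Under the root in Q stands ((kappa L.2 - 1)/(kappa - L.2))^2. The condition kappa^-1 <= L.2
    fixes the sign of its root, and Q becomes kappa - L.2. *)
Lemma Lam_of_unit L : pnorm L = 1 -> kappa^-1 <= L.2 ->
  Lam kappa ((kappa - L.2)^-1 *: L.1) = L.
Proof.
move=> L1 hL.
have L2 : L.2 <= 1 by rewrite -L1 (le_trans (ler_norm _)) // snd_le_pnorm.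
have kL : 0 < kappa - L.2 by rewrite subr_gt0 (le_lt_trans L2).
have e : enorm L.1 ^+ 2 = 1 - L.2 ^+ 2.
  by have := pnorm_sqr L; rewrite L1 expr1n => ->; ring.
have hk : 0 <= kappa * L.2 - 1.
  by rewrite subr_ge0 -[leLHS](mulfV (x := kappa)) ?gt_eqF // ler_pM2l.
have ev : enorm ((kappa - L.2)^-1 *: L.1) ^+ 2 = (1 - L.2 ^+ 2) / (kappa - L.2) ^+ 2.
  by rewrite enormZ exprMn real_normK ?num_real // e exprVn mulrC.
have eQ : Qfun kappa ((kappa - L.2)^-1 *: L.1) = kappa - L.2.
  rewrite /Qfun ev.
  have -> : 1 - k * ((1 - L.2 ^+ 2) / (kappa - L.2) ^+ 2)
     = ((kappa * L.2 - 1) / (kappa - L.2)) ^+ 2.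
    by field; rewrite gt_eqF.
  rewrite sqrtr_sqr ger0_norm ?divr_ge0 ?(ltW kL) //.
  have kk : 0 < kappa ^+ 2 - 2 * kappa * L.2 + 1.
    have -> : kappa ^+ 2 - 2 * kappa * L.2 + 1 =
      kappa * (kappa - L.2) + (1 - kappa * L.2) by ring.
    have : L.2 * (kappa - L.2) <= 1 * (kappa - L.2) by rewrite ler_pM2r.
    have : L.2 ^+ 2 <= 1 by rewrite -subr_ge0 -e sqr_ge0.
    have -> : kappa * (kappa - L.2) + (1 - kappa * L.2) = (kappa - L.2) ^+ 2 + (1 - L.2 ^+ 2) by ring.
    move=> *; rewrite ltr_wpDr ?exprn_gt0 //; lra.
  set N := _ + 1 in kk.
  have -> : kappa - (kappa * L.2 - 1) / (kappa - L.2) = N / (kappa - L.2).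
    by rewrite /N; field; rewrite gt_eqF.
  have -> : 1 + (1 - L.2 ^+ 2) / (kappa - L.2) ^+ 2 = N / (kappa - L.2) ^+ 2.
    by rewrite /N; field; rewrite gt_eqF.
  by field; rewrite !gt_eqF.
rewrite /Lam eQ scalerA divff ?gt_eqF // scale1r.
by case: L {e ev eQ hL hk L1 L2 kL} => a b /=; congr (_, _); ring.
Qed.

End RayDirections.

Section VertexExpansion.
Variables (R : realType) (n : nat) (kappa : R).
Hypothesis kappa_gt1 : 1 < kappa.
Hypothesis n_gt0 : (0 < n)%N.
Variables (Omega : set 'rV[R]_n) (Sigma : set (pt R n)) (tau0 tau1 omega : R).
Variable s : pt R n -> pt R n -> R.
Hypothesis setting : parallel_setting kappa Omega Sigma tau0 tau1 omega s.
Variable K : nat -> R.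
Hypothesis K_bound : phi_derivative_bounds kappa Omega Sigma tau0 K.
Implicit Types (x y z w v p : 'rV[R]_n) (X Y Z : pt R n) (b t : R).

Local Notation k := (kappa ^+ 2 - 1).
Local Notation drop := (drop kappa).
Local Notation L := (slope_lip_const kappa K).
Let k0 : 0 < k := k_gt0 kappa_gt1.
Let kappa0 : 0 < kappa := kappa_gt0 kappa_gt1.
Let L0 : 0 < L := slope_lip_const_gt0 kappa_gt1 K.

(** The slope determines the direction, by [Lam_of_unit] and the cone condition, and the direction
    determines the point because the distance [s] is a function of it. *)
Lemma Dxphi_inj x t Y1 Y2 : Omega x -> 0 <= t <= tau0 -> Sigma Y1 -> Sigma Y2 ->
  Dxphi kappa x Y1 (x, t) = Dxphi kappa x Y2 (x, t) -> Y1 = Y2.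
Proof.
move=> Ox ht S1 S2.
have cyl : cylinder Omega tau0 (x, t) by [].
have c1 := cfun_gt0 kappa_gt1 setting Ox S1 (proj2 (andP ht)).
have c2 := cfun_gt0 kappa_gt1 setting Ox S2 (proj2 (andP ht)).
have [L1 [n1 r1 e1]] := radial setting cyl S1.
have [L2 [n2 r2 e2]] := radial setting cyl S2.
have dir Y M : Sigma Y -> 0 < s (x, t) M -> pnorm M = 1 ->
    Y = raypt (x, t) (s (x, t) M) M -> kappa^-1 <= M.2.
  move=> SY r0 M1 e; have := cone setting cyl SY; rewrite e.
  have -> : raypt (x, t) (s (x, t) M) M - (x, t) = s (x, t) M *: M.
    by rewrite -[raypt _ _ M]/((x, t) + s (x, t) M *: M) addrC addKr.
  rewrite pnormZ M1 mulr1 gtr0_norm // /raypt /= [t + _]addrC addrK mulrAC.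
  by rewrite divff ?gt_eqF // mul1r.
have d1 := dir _ _ S1 r1 n1 e1; have d2 := dir _ _ S2 r2 n2 e2.
rewrite e1 e2 in c1 c2 *.
rewrite (Dxphi_ray kappa_gt1 r1 n1 c1) (Dxphi_ray kappa_gt1 r2 n2 c2) => h.
by rewrite -(Lam_of_unit kappa_gt1 n1 d1) h Lam_of_unit.
Qed.

(** For L = [Lam kappa v] one has L.1 = Q(v) v and kappa - L.2 = Q(v), so the slope of [Yseg] is v
    itself. Both given slopes lie in the ball where [Lam] is a unit vector, and that ball is
    convex. *)
Lemma Dxphi_Yseg x t Ya Yb l : Omega x -> 0 <= t <= tau0 -> Sigma Ya -> Sigma Yb ->
  0 <= l <= 1 ->
  Dxphi kappa x (Yseg kappa s Ya Yb (x, t) l) (x, t) =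
  (1 - l) *: Dxphi kappa x Ya (x, t) + l *: Dxphi kappa x Yb (x, t).
Proof.
move=> Ox ht Sa Sb hl.
have cyl : cylinder Omega tau0 (x, t) by [].
have [r0 Sm] := arc_defined setting cyl Sa Sb hl.
have cm := cfun_gt0 kappa_gt1 setting Ox Sm (proj2 (andP ht)).
have ca := cfun_gt0 kappa_gt1 setting Ox Sa (proj2 (andP ht)).
have cb := cfun_gt0 kappa_gt1 setting Ox Sb (proj2 (andP ht)).
set v := vseg kappa Ya Yb (x, t) l in r0 *.
have hv : enorm v <= (Num.sqrt k)^-1.
  have da := Dxphi_lt kappa_gt1 ca; have db := Dxphi_lt kappa_gt1 cb.
  case/andP: hl => l0 l1; have l1' : 0 <= 1 - l by rewrite subr_ge0.
  rewrite /v /vseg /=; move: da db => /=.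
  move: (Dxphi _ x Ya _) (Dxphi _ x Yb _) => va vb da db.
  apply: (le_trans (enormD _ _)); rewrite !enormZ (ger0_norm l0) (ger0_norm l1').
  have := ler_wpM2l l1' (ltW da); have := ler_wpM2l l0 (ltW db).
  move: (enorm va) (enorm vb) => p q; lra.
have [u1 q0] := Lam_unit kappa_gt1 hv.
have := Dxphi_ray kappa_gt1 r0 u1 cm => /= ->.
by rewrite opprD opprK addrCA subrr addr0 scalerA mulVf ?gt_eqF // scale1r.
Qed.

Lemma Dxphi_lip x t Y1 Y2 : Omega x -> t <= tau0 -> Sigma Y1 -> Sigma Y2 ->
  enorm (Dxphi kappa x Y1 (x, t) - Dxphi kappa x Y2 (x, t)) <=
  L * (kappa + 2) * pnorm (Y1 - Y2).
Proof.
move=> Ox ht S1 S2.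
have c1 := cfun_gt0 kappa_gt1 setting Ox S1 ht.
have c2 := cfun_gt0 kappa_gt1 setting Ox S2 ht.
rewrite (Dxphi_slope kappa_gt1 c1) (Dxphi_slope kappa_gt1 c2) /=.
rewrite opprK addrC enormB.
have := slope_lip_setting kappa_gt1 n_gt0 setting K_bound x x x x Y2.1 Ox ht S1 c2.
rewrite enormB [slope _ _ _ Y2.1 _ - _]addrC.
rewrite !subrr enorm0 !add0r -mulrA => h; apply: (le_trans h).
apply: ler_wpM2l; first exact: ltW.
have h1 := enorm_le_pnorm (Y1 - Y2).
have := cfun_lip kappa_gt1 (x, t) (x, t) Y1 Y2.
rewrite subrr pnorm0 add0r /= in h1 *; lra.
Qed.

Lemma slope_Dxphi x x' t Y : Omega x -> t <= tau0 -> Sigma Y ->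
  enorm (slope kappa x' x Y.1 (cfun kappa (x, t) Y) + Dxphi kappa x Y (x, t))
  <= L * enorm (x' - x).
Proof.
move=> Ox ht SY; have c0 := cfun_gt0 kappa_gt1 setting Ox SY ht.
rewrite (Dxphi_slope kappa_gt1 c0) /=.
apply: (le_trans (slope_lip_setting kappa_gt1 n_gt0 setting K_bound _ _ _ _ _ Ox ht SY c0)).
by rewrite !subrr enorm0 normr0 !addr0.
Qed.

(** Both hyperboloids have the value [t] at x; dividing by e leaves divided differences that are
    within O(e) of the derivatives. *)
Lemma one_sided_slope x t Ya Yb d e0 : Omega x -> t <= tau0 -> Sigma Ya -> Sigma Yb ->
  0 < e0 ->
  (forall e, 0 < e -> e < e0 ->
     phi kappa (x + e *: d) Ya (x, t) <= phi kappa (x + e *: d) Yb (x, t)) ->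
  dot d (Dxphi kappa x Ya (x, t)) <= dot d (Dxphi kappa x Yb (x, t)).
Proof.
move=> Ox ht Sa Sb e00 h.
apply: (@le_of_small_errors _ _ _ (2 * L * enorm d ^+ 2) e0) => // e ep ee.
have := h e ep ee; rewrite !(phi_expand kappa_gt1 setting) // [x + _]addrC addrK !dotZl lerD2l lerN2.
rewrite ler_pM2l //.
set ga := slope _ _ _ Ya.1 _; set gb := slope _ _ _ Yb.1 _ => hg.
have ea : enorm (ga + Dxphi kappa x Ya (x, t)) <= L * (e * enorm d).
  have := slope_Dxphi (e *: d + x) Ox ht Sa.
  by rewrite addrK enormZ gtr0_norm.
have eb : enorm (gb + Dxphi kappa x Yb (x, t)) <= L * (e * enorm d).
  have := slope_Dxphi (e *: d + x) Ox ht Sb.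
  by rewrite addrK enormZ gtr0_norm.
move: (Dxphi kappa x Ya _) (Dxphi kappa x Yb _) ea eb => va vb ea eb.
have h1 := dot_le d (ga + va); have h2 := dot_le d (- (gb + vb)).
rewrite enormN dotNr !dotDr in h1 h2.
have d0 := enorm_ge0 d.
have h3 := ler_wpM2l d0 ea; have h4 := ler_wpM2l d0 eb.
move: h1 h2 h3 h4 hg; rewrite expr2.
lra.
Qed.


Lemma phi_rise_lt x p t Y : Omega x -> t <= tau0 -> Sigma Y -> p != 0 ->
  `|phi kappa (x + p) Y (x, t) - t| < enorm p / Num.sqrt k.
Proof.
move=> Ox ht SY p0; rewrite (phi_expand kappa_gt1 setting) // [x + p]addrC addrK.
have c0 := cfun_gt0 kappa_gt1 setting Ox SY ht.
have := slope_lt kappa_gt1 (p + x) x Y.1 c0; set g := slope _ _ _ _ _ => hg.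
have -> : t - dot p g - t = - dot p g by ring.
rewrite normrN; apply: (le_lt_trans (dot_norm_le _ _)).
rewrite ltr_pM2l // lt_def enorm_ge0 andbT.
by apply: contra_neq p0; exact: enorm_eq0.
Qed.

Definition vertex_drop x t Y : R := drop (cfun kappa (x, t) Y) (x - Y.1).

Lemma vertex_drop_gt0 x t Y : Omega x -> t <= tau0 -> Sigma Y ->
  0 < vertex_drop x t Y.
Proof.
by move=> Ox ht SY; apply: drop_gt0 => //; apply: (cfun_gt0 kappa_gt1 setting).
Qed.

(** This selects the sheet: a hyperboloid rises by less than |p| / sqrt(k), hence stays below the
    plane of symmetry of any other one through the vertex. The bound follows from k A >= (kappa - 1)
    h >= kappa Delta and sqrt(k) <= kappa, with h the height of [Y] above the vertex. *)
Lemma vertex_drop_ge x p t Y : Omega x -> Omega (x + p) -> t <= tau0 -> Sigma Y ->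
  enorm p / Num.sqrt k <= vertex_drop x t Y.
Proof.
move=> Ox Op ht SY.
have sk := sqrtk_gt0 kappa_gt1.
have pD : enorm p <= Delta Omega Sigma.
  rewrite -[p](addrK x) [p + x]addrC.
  by apply: (enorm_le_Delta setting SY); left.
have [h0 hD] := height_Delta kappa_gt1 setting SY ht.
have kp : 0 < kappa + 1 by rewrite addr_gt0.
have r : Y.2 - t <= pnorm ((x, t) - Y).
  rewrite pnormB; apply: le_trans (snd_le_pnorm _); exact: ler_norm.
have A : (kappa - 1) * (Y.2 - t) <= vertex_drop x t Y * k.
  have := drop_vertex kappa_gt1 (x, t) Y.
  rewrite /= -/(vertex_drop x t Y) => ->; rewrite divfK ?gt_eqF //.
  have := ler_wpM2l (ltW kappa0) r; lra.
have ks : Num.sqrt k <= kappa.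
  rewrite -[leRHS](gtr0_norm kappa0) -sqrtr_sqr ler_wsqrtr //.
  by rewrite gerBl.
rewrite ler_pdivrMr //.
rewrite -(ler_pM2r sk) -mulrA -expr2 sqrtk_sqr //.
apply: (le_trans _ (le_trans hD A)); rewrite mulrC.
by apply: ler_pM => //; exact: enorm_ge0.
Qed.

(** S is the [drop] at x + p, and t + A the height of the plane of symmetry. *)
Lemma vertex_expansion x p t Y : Omega x -> t <= tau0 -> Sigma Y ->
  let A := vertex_drop x t Y in
  exists S, [/\ 0 <= S, phi kappa (x + p) Y (x, t) = t + A - S &
    S ^+ 2 = A ^+ 2 - 2 * A * dot (Dxphi kappa x Y (x, t)) p + enorm p ^+ 2 / k].
Proof.
move=> Ox ht SY A.
have c0 := cfun_gt0 kappa_gt1 setting Ox SY ht.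
have A0 := vertex_drop_gt0 Ox ht SY.
exists (drop (cfun kappa (x, t) Y) (x + p - Y.1)); split.
- exact: drop_ge0.
- have := phi_vertex kappa_gt1 (x, t) Y; rewrite /= /phi !phibE /=.
  by rewrite -/(vertex_drop x t Y) -/A; lra.
rewrite DxphiE // -/(vertex_drop x t Y) dotZl drop_sqr // /A /vertex_drop.
rewrite [X in _ = X - _ + _]drop_sqr // -/(vertex_drop x t Y) !enorm_sqr.
rewrite [x + p - _]addrAC; move: (x - Y.1) => w.
rewrite !(dotDl, dotDr) (dotC p w).
by field; rewrite !gt_eqF.
Qed.

(* With [tau] a height above the vertex, the hyperboloid is the quadric
   |p|^2/k - tau^2 = 2 A (v . p - tau), with A the [vertex_drop]. *)
Lemma quadric_le x p t Y tau : Omega x -> t <= tau0 -> Sigma Y ->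
  tau <= vertex_drop x t Y ->
  (t + tau <= phi kappa (x + p) Y (x, t)) =
  (enorm p ^+ 2 / k - tau ^+ 2 <=
     2 * vertex_drop x t Y * (dot (Dxphi kappa x Y (x, t)) p - tau)).
Proof.
move=> Ox ht SY hA; have [S [S0 -> eS]] := vertex_expansion p Ox ht SY.
move: hA eS; move: (vertex_drop _ _ _) (dot _ _) (enorm p ^+ 2 / k) => A d q hA eS.
have -> : (t + tau <= t + A - S) = (S <= A - tau) by apply/idP/idP; lra.
rewrite -ler_sqr ?nnegrE ?subr_ge0 // eS sqrrB -mulr_natl.
by apply/idP/idP; lra.
Qed.

Lemma quadric_eq x p t Y : Omega x -> t <= tau0 -> Sigma Y ->
  enorm p ^+ 2 / k - (phi kappa (x + p) Y (x, t) - t) ^+ 2 =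
     2 * vertex_drop x t Y * (dot (Dxphi kappa x Y (x, t)) p
       - (phi kappa (x + p) Y (x, t) - t)).
Proof.
move=> Ox ht SY; have [S [S0 -> eS]] := vertex_expansion p Ox ht SY.
move: eS; move: (vertex_drop _ _ _) (dot _ _) (enorm p ^+ 2 / k) => A d q eS.
have -> : t + A - S - t = A - S by ring.
have -> : (A - S) ^+ 2 = A ^+ 2 - 2 * A * S + S ^+ 2 by ring.
by rewrite eS; ring.
Qed.

End VertexExpansion.

(** * Curvature and the maximum principle *)

(** Dividing by 2 A and averaging gives (a + b)/2 - tau < q/2 times the mean of 1/Aa and 1/Ab, which
    is at most q / (2 Am). *)
Lemma middle_quadric (R : realFieldType) (Aa Ab Am q a b tau : R) :
  0 < Aa -> 0 < Ab -> 0 < Am -> 0 < q ->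
  2 * Aa * (a - tau) < q -> 2 * Ab * (b - tau) < q ->
  (Aa^-1 + Ab^-1) / 2 <= Am^-1 -> q <> 2 * Am * (2^-1 * (a + b) - tau).
Proof.
move=> Aa0 Ab0 Am0 q0 ha hb hA eq.
have ha2 : a - tau < q / 2 * Aa^-1 by rewrite ltr_pdivlMr // ltr_pdivlMr //; lra.
have hb2 : b - tau < q / 2 * Ab^-1 by rewrite ltr_pdivlMr // ltr_pdivlMr //; lra.
have em : 2^-1 * (a + b) - tau = q / 2 * Am^-1.
  by rewrite eq; field; rewrite gt_eqF.
have hq : 0 <= q / 2 by rewrite divr_ge0 // ltW.
have := ler_wpM2l hq hA; lra.
Qed.

(* Intermediate values along a segment that avoids the origin and joins points
   where [dot d] has opposite signs and dominates the quadratic term. *)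
Lemma crossing_direction (R : realType) (n : nat) (d : 'rV[R]_n)
    (Q : 'rV[R]_n -> R) (beta C M rho : R) : (1 < n)%N -> d != 0 -> 0 < rho ->
  (forall p p', `|Q p - Q p'| <= C * enorm (p - p')) ->
  (forall p, enorm p <= rho -> `|Q p| <= M * enorm p ^+ 2) ->
  exists p, [/\ p != 0, enorm p <= rho & dot d p = beta * Q p].
Proof.
move=> n1 d0 rho0 Qlip Qle.
have [e e0 de] := orthogonal_exists n1 d0.
have dd0 : 0 < dot d d.
  by rewrite lt_def dotxx_ge0 andbT; apply: contra_neq d0; exact: dotxx_eq0.
have ee0 : 0 < dot e e.
  by rewrite lt_def dotxx_ge0 andbT; apply: contra_neq e0; exact: dotxx_eq0.
pose E := enorm d + enorm e.
have E0 : 0 < E.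
  rewrite ltr_wpDr ?enorm_ge0 // lt_def enorm_ge0 andbT.
  by apply: contra_neq d0; exact: enorm_eq0.
pose N := `|beta| * (`|M| * E ^+ 2).
have N0 : 0 <= N.
  by rewrite /N; apply: mulr_ge0 => //; apply: mulr_ge0 => //; exact: sqr_ge0.
have N1 : 0 < N + 1 by rewrite ltr_wpDl.
(* The first bound keeps the path in the ball of radius rho. The second makes the quadratic term, at
   most eps^2 N, no larger than the linear one, which is eps |d|^2 in absolute value at the ends of
   the path. *)
pose eps := Num.min (rho / E) (dot d d / (N + 1)).
have eps0 : 0 < eps by rewrite lt_min !divr_gt0.
have eE : eps * E <= rho by rewrite -ler_pdivlMr // ge_min lexx.
have eN : eps * N <= dot d d.
  apply: (@le_trans _ _ (eps * (N + 1))).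
    by rewrite ler_pM2l // lerDl.
  by rewrite -ler_pdivlMr // ge_min lexx orbT.
clearbody eps.
pose p (h : R) : 'rV[R]_n := eps *: (h *: d + e).
have pE h : -1 <= h <= 1 -> enorm (p h) <= eps * E.
  move=> hh; rewrite enormZ gtr0_norm // ler_pM2l //.
  apply: (le_trans (enormD _ _)); rewrite lerD2r enormZ.
  rewrite -[leRHS]mul1r; apply: ler_wpM2r; first exact: enorm_ge0.
  by rewrite ler_norml.
have p0 h : p h != 0.
  apply/eqP => /(congr1 (fun w => dot w e)); rewrite dot0l dotZl dotDl dotZl de.
  by rewrite mulr0 add0r => /eqP; rewrite mulf_eq0 !gt_eqF.
have dp h : dot d (p h) = eps * h * dot d d.
  by rewrite dotZr dotDr de addr0 dotZr mulrA.
have bQ h : -1 <= h <= 1 -> `|beta * Q (p h)| <= eps * dot d d.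
  move=> hh; have ph := pE h hh; rewrite normrM.
  apply: (@le_trans _ _ (`|beta| * (`|M| * (eps * E) ^+ 2))).
    apply: ler_wpM2l => //; apply: (le_trans (Qle _ (le_trans ph eE))).
    apply: (@le_trans _ _ (`|M| * enorm (p h) ^+ 2)).
      by apply: ler_wpM2r; [exact: sqr_ge0|exact: ler_norm].
    apply: ler_wpM2l => //; rewrite lerXn2r ?nnegrE ?enorm_ge0 //.
    by rewrite mulr_ge0 // ltW.
  have -> : `|beta| * (`|M| * (eps * E) ^+ 2) = eps * (eps * N) by rewrite /N; ring.
  by rewrite ler_pM2l.
have pab a b : enorm (p a - p b) = eps * enorm d * `|a - b|.
  have -> : p a - p b = (eps * (a - b)) *: d.
    by apply/rowP => i; rewrite !mxE; ring.
  by rewrite enormZ normrM gtr0_norm //; ring.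
clearbody p.
have N11 : -1 <= 1 :> R by rewrite (@le_trans _ _ 0) // lerN10.
have f1 : 0 <= dot d (p 1) - beta * Q (p 1).
  have := bQ 1; rewrite lexx N11 => /(_ isT).
  by rewrite dp mulr1 ler_norml => /andP[_]; lra.
have fN1 : dot d (p (-1)) - beta * Q (p (-1)) <= 0.
  have := bQ (-1); rewrite lexx N11 => /(_ isT).
  by rewrite dp mulrN1 mulNr ler_norml => /andP[]; lra.
have [h] : exists2 h, h \in `[-1, 1] & dot d (p h) - beta * Q (p h) = 0.
  apply: (@IVT _ (fun h => dot d (p h) - beta * Q (p h)) (-1) 1 0) => //.
    apply: (@lipschitz_within _ _ _ _ (eps * dot d d +
      `|beta| * (C * (eps * enorm d)))) => a b _ _.
    have -> : dot d (p a) - beta * Q (p a) - (dot d (p b) - beta * Q (p b)) =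
       eps * dot d d * (a - b) - beta * (Q (p a) - Q (p b)) by rewrite !dp; ring.
    apply: (le_trans (ler_normB _ _)); rewrite !normrM mulrDl.
    rewrite (gtr0_norm eps0) (gtr0_norm dd0) lerD2l -mulrA.
    apply: ler_wpM2l => //; apply: (le_trans (Qlip _ _)).
    by rewrite pab mulrA.
  by rewrite ge_min fN1 le_max f1 orbT.
rewrite in_itv /= => hh /eqP; rewrite subr_eq0 => /eqP fh.
by exists (p h); split => //; exact: le_trans (pE h hh) eE.
Qed.

Section Curvature.
Variables (R : realType) (n : nat) (kappa : R).
Hypothesis kappa_gt1 : 1 < kappa.
Hypothesis n_gt0 : (0 < n)%N.
Variables (Omega : set 'rV[R]_n) (Sigma : set (pt R n)) (tau0 tau1 omega : R).
Variable s : pt R n -> pt R n -> R.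
Hypothesis setting : parallel_setting kappa Omega Sigma tau0 tau1 omega s.
Variable K : nat -> R.
Hypothesis K_bound : phi_derivative_bounds kappa Omega Sigma tau0 K.
Implicit Types (x y z w v p d e : 'rV[R]_n) (X Y Z : pt R n) (b t : R).

Local Notation k := (kappa ^+ 2 - 1).
Local Notation L := (slope_lip_const kappa K).
Local Notation vertex_drop := (vertex_drop kappa).
Let k0 : 0 < k := k_gt0 kappa_gt1.
Let kappa0 : 0 < kappa := kappa_gt0 kappa_gt1.

(** Slopes are strictly below 1 / sqrt(k), whence the positivity; the second part is the sheet
    condition in [quadric_le]. *)
Lemma rise_bounds x p t Y : Omega x -> Omega (x + p) -> t <= tau0 -> Sigma Y ->
  p != 0 ->
  0 < enorm p ^+ 2 / k - (phi kappa (x + p) Y (x, t) - t) ^+ 2 /\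
  forall Y', Sigma Y' -> phi kappa (x + p) Y (x, t) - t <= vertex_drop x t Y'.
Proof.
move=> Ox Op ht SY p0.
have h := phi_rise_lt kappa_gt1 setting Ox ht SY p0; split.
  rewrite subr_gt0 -(real_normK (num_real (_ - t))).
  have -> : enorm p ^+ 2 / k = (enorm p / Num.sqrt k) ^+ 2.
    by rewrite exprMn exprVn sqrtk_sqr.
  by rewrite ltrXn2r ?nnegrE.
move=> Y' SY'; apply: (le_trans (ler_norm _)); apply: (le_trans (ltW h)).
exact: (vertex_drop_ge kappa_gt1 setting Ox Op ht SY').
Qed.

(** If the middle hyperboloid were strictly above both others at x + p, with rise tau, [quadric_le]
    would put the point strictly on one side of the other two quadrics, and [middle_quadric] would
    contradict the equation of the middle one. *)
Lemma phi_le_max_of_drop x x' t Ya Yb Ym : Omega x -> Omega x' -> t <= tau0 ->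
  Sigma Ya -> Sigma Yb -> Sigma Ym ->
  Dxphi kappa x Ym (x, t) =
    2^-1 *: (Dxphi kappa x Ya (x, t) + Dxphi kappa x Yb (x, t)) ->
  ((vertex_drop x t Ya)^-1 + (vertex_drop x t Yb)^-1) / 2 <=
    (vertex_drop x t Ym)^-1 ->
  phi kappa x' Ym (x, t) <=
    Num.max (phi kappa x' Ya (x, t)) (phi kappa x' Yb (x, t)).
Proof.
move=> Ox Ox' ht Sa Sb Sm ev eA.
have [xx|xx] := eqVneq x' x.
  rewrite xx; have e Y := phi_vertex kappa_gt1 (x, t) Y.
  by rewrite /= in e; rewrite !e maxxx.
have p0 : x' - x != 0 by rewrite subr_eq0.
have ex' : x' = x + (x' - x) by rewrite addrC subrK.
move: p0 ex' Ox'; move: (x' - x) => p p0 -> Op.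
have [q0 hA] := rise_bounds Ox Op ht Sm p0.
rewrite leNgt; apply/negP; rewrite gt_max => /andP[ha hb].
have := quadric_eq kappa_gt1 setting p Ox ht Sm.
have := quadric_le kappa_gt1 setting p Ox ht Sa (hA _ Sa).
have := quadric_le kappa_gt1 setting p Ox ht Sb (hA _ Sb).
have -> : t + (phi kappa (x + p) Ym (x, t) - t) = phi kappa (x + p) Ym (x, t).
  by ring.
rewrite [in X in X -> _]leNgt hb [in X in _ -> X -> _]leNgt ha /= ev dotZl dotDl.
move=> /esym/negbT; rewrite -ltNge => hb' /esym/negbT; rewrite -ltNge => ha'.
have Aa0 := vertex_drop_gt0 kappa_gt1 setting Ox ht Sa.
have Ab0 := vertex_drop_gt0 kappa_gt1 setting Ox ht Sb.
have Am0 := vertex_drop_gt0 kappa_gt1 setting Ox ht Sm.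
exact: (middle_quadric Aa0 Ab0 Am0 q0 ha' hb' eA).
Qed.

(* If [1/A] were too small at the middle direction, the middle hyperboloid
   would rise above both others near [x], along a curve where the latter cross
   suitably. *)
Lemma drop_of_phi_le_max x t Ya Yb Ym c2 : (1 < n)%N -> Omega x -> t <= tau0 ->
  Sigma Ya -> Sigma Yb -> Sigma Ym ->
  Dxphi kappa x Ym (x, t) =
    2^-1 *: (Dxphi kappa x Ya (x, t) + Dxphi kappa x Yb (x, t)) ->
  Dxphi kappa x Ya (x, t) != Dxphi kappa x Yb (x, t) ->
  0 < c2 ->
  (forall x', Omega x' -> enorm (x' - x) <= c2 ->
    phi kappa x' Ym (x, t) <=
    Num.max (phi kappa x' Ya (x, t)) (phi kappa x' Yb (x, t))) ->
  ((vertex_drop x t Ya)^-1 + (vertex_drop x t Yb)^-1) / 2 <=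
    (vertex_drop x t Ym)^-1.
Proof.
move=> n1 Ox ht Sa Sb Sm ev vab c20 loc.
have Aa0 := vertex_drop_gt0 kappa_gt1 setting Ox ht Sa.
have Ab0 := vertex_drop_gt0 kappa_gt1 setting Ox ht Sb.
have Am0 := vertex_drop_gt0 kappa_gt1 setting Ox ht Sm.
rewrite leNgt; apply/negP => hlt.
have [r r0 hr] := Omega_ball setting Ox.
have qeq p := quadric_eq kappa_gt1 setting p Ox ht Sm.
have qla p tau := @quadric_le _ _ _ kappa_gt1 _ _ _ _ _ _ setting x p t _ tau Ox ht Sa.
have qlb p tau := @quadric_le _ _ _ kappa_gt1 _ _ _ _ _ _ setting x p t _ tau Ox ht Sb.
have rb p : Omega (x + p) -> p != 0 ->
    [/\ 0 < enorm p ^+ 2 / k - (phi kappa (x + p) Ym (x, t) - t) ^+ 2,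
      phi kappa (x + p) Ym (x, t) - t <= vertex_drop x t Ya &
      phi kappa (x + p) Ym (x, t) - t <= vertex_drop x t Yb].
  by move=> Op p0; have [h1 h2] := rise_bounds Ox Op ht Sm p0; split => //; exact: h2.
have taulip p p' : `|phi kappa (x + p) Ym (x, t) - phi kappa (x + p') Ym (x, t)| <=
    enorm (p - p') / Num.sqrt k.
  have := phib_lipx kappa_gt1 Ym (cfun kappa (x, t) Ym) (x + p) (x + p').
  by rewrite [x + p]addrC addrKA.
rewrite ev in qeq; clear ev.
move: (Dxphi kappa x Ya (x, t)) (Dxphi kappa x Yb (x, t)) vab qeq qla qlb
  => va vb vab qeq qla qlb.
move: (vertex_drop x t Ya) (vertex_drop x t Yb) (vertex_drop x t Ym)
  Aa0 Ab0 Am0 hlt qeq qla qlb rb => Aa Ab Am Aa0 Ab0 Am0 hlt qeq qla qlb rb.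
have : exists tau : 'rV[R]_n -> R, forall p, phi kappa (x + p) Ym (x, t) = t + tau p.
  by exists (fun p => phi kappa (x + p) Ym (x, t) - t) => p; rewrite addrCA subrr addr0.
case=> tau tauE.
have rho0 : 0 < Num.min c2 (r / 2) by rewrite lt_min c20 divr_gt0.
have qE p : enorm p ^+ 2 / k - tau p ^+ 2 =
    2 * Am * (dot (2^-1 *: (va + vb)) p - tau p).
  by have := qeq p; rewrite tauE [t + _]addrC addrK.
have d0 : vb - va != 0 by rewrite subr_eq0 eq_sym.
have rO p : enorm p <= Num.min c2 (r / 2) -> enorm p <= c2 /\ Omega (x + p).
  rewrite le_min => /andP[h1 h2]; split => //; apply: hr.
  by apply: (le_lt_trans h2); rewrite ltr_pdivrMr //; lra.
have q0 p : enorm p <= Num.min c2 (r / 2) -> p != 0 ->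
    0 < enorm p ^+ 2 / k - tau p ^+ 2.
  move=> pr p0; have [_ Op] := rO p pr; have [] := rb p Op p0.
  by rewrite tauE [t + _]addrC addrK.
have tau00 : tau 0 = 0.
  have := tauE 0; rewrite addr0; have /= -> := phi_vertex kappa_gt1 (x, t) Ym.
  by move=> /esym/eqP; rewrite addrC -subr_eq0 addrK => /eqP.
(* Let q = |p|^2/k - tau(p)^2, and let a, b be the products of the two slopes with p. This multiple
   of q makes a - q/(2 Aa) and b - q/(2 Ab) equal. Their common value is also their mean, which
   [hlt] puts strictly below tau, so both outer hyperboloids are below the middle one. *)
have [p p'|p pr|p [p0 pr dpq]] := @crossing_direction _ _ (vb - va)
  (fun p => enorm p ^+ 2 / k - tau p ^+ 2) ((Ab^-1 - Aa^-1) / 2)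
  (2 * Am * (enorm (2^-1 *: (va + vb)) + (Num.sqrt k)^-1)) k^-1 _ n1 d0 rho0.
(* The equation of the middle quadric makes q linear in p and tau, hence globally Lipschitz although
   it is written with squares. *)
- rewrite !qE; have := taulip p p'; rewrite !tauE.
  move: (2^-1 *: (va + vb)) (tau p) (tau p') => w ta tb lt.
  have -> : 2 * Am * (dot w p - ta) - 2 * Am * (dot w p' - tb) =
     2 * Am * (dot w (p - p') - (t + ta - (t + tb))).
    by rewrite dotDr dotNr; ring.
  have A20 : 0 < 2 * Am by rewrite mulr_gt0.
  rewrite normrM (gtr0_norm A20) -mulrA ler_pM2l //.
  apply: (le_trans (ler_normB _ _)).
  by have := dot_norm_le w (p - p'); lra.
- have [->|p0] := eqVneq p 0.
    by rewrite tau00 enorm0 expr0n /= mul0r subr0 normr0 mulr0.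
  by rewrite gtr0_norm ?q0 // mulrC gerBl sqr_ge0.
have [pc Op] := rO p pr.
have [_ hAa hAb] := rb p Op p0.
have := loc _ Op; rewrite [x + p]addrC addrK => /(_ pc).
have qh := q0 p pr p0; have em := qE p.
rewrite dotZl dotDl in em; rewrite dotDl dotNl in dpq.
rewrite [p + x]addrC le_max tauE.
rewrite tauE [t + _]addrC addrK in hAa; rewrite tauE [t + _]addrC addrK in hAb.
rewrite (qla p _ hAa) (qlb p _ hAb).
move: (dot va p) (dot vb p) (tau p) (enorm p ^+ 2 / k) qh em dpq => a b ta q.
move: (q - ta ^+ 2) => {q}q qh em dpq.
have em' : 2^-1 * (a + b) - ta = q / 2 * Am^-1.
  by rewrite em; field; rewrite gt_eqF.
have hq : q * Am^-1 < q * ((Aa^-1 + Ab^-1) / 2) by rewrite ltr_pM2l.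
case/orP => hx.
  have : q / 2 * Aa^-1 <= a - ta by rewrite ler_pdivrMr // ler_pdivrMr //; lra.
  lra.
have : q / 2 * Ab^-1 <= b - ta by rewrite ler_pdivrMr // ler_pdivrMr //; lra.
lra.
Qed.

End Curvature.

(** * Local supports are global *)

Lemma small_inv (R : realType) (e : R) : 0 < e ->
  exists N, forall m, (N <= m)%N -> m.+1%:R^-1 < e.
Proof.
move=> e0; exists (Num.truncn e^-1) => m hm.
have h : e^-1 < m.+1%:R.
  apply: (lt_le_trans (truncnS_gt e^-1)); by rewrite ler_nat ltnS.
by rewrite -[e]invrK ltf_pV2 ?posrE ?invr_gt0 // ltr0n.
Qed.

Lemma ler_error_sum (R : numDomainType) (a1 a2 a3 a4 q1 q2 e : R) :
  a1 <= a2 + a4 -> a4 <= q1 * e -> a2 - a3 <= q2 * e -> a1 <= a3 + (q1 + q2) * e.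
Proof.
move=> h1 h2 h3; rewrite mulrDl; apply: (le_trans h1).
by rewrite addrCA [a2 + _]addrC lerD // -lerBlDl.
Qed.

(** Since w . g > 0, |w - h g|^2 falls below |w|^2 for small h > 0. The h are dyadic because the
    slopes of supports are shown to be closed under midpoints. *)
Lemma no_dyadic_minimum (R : realType) (n : nat) (w g : 'rV[R]_n) :
  0 < dot w w -> dot w w <= dot w g ->
  ~ (forall j : nat, enorm w <= enorm (w - 2^-1 ^+ j *: g)).
Proof.
move=> wp wg wmin.
have key (j : nat) : 2 * dot w w <= 2^-1 ^+ j * dot g g.
  have := wmin j; rewrite -ler_sqr ?nnegrE ?enorm_ge0 // !enorm_sqr.
  rewrite !(dotDl, dotDr, dotNl, dotNr, dotZl, dotZr) (dotC g w).
  have h0 : 0 < 2^-1 ^+ j :> R by rewrite exprn_gt0.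
  move: (2^-1 ^+ j) h0 => h h0 hh.
  rewrite -(ler_pM2l h0); have := ler_wpM2l (ltW h0) wg; lra.
have gp : 0 <= dot g g by exact: dotxx_ge0.
pose j := Num.truncn (dot g g / (2 * dot w w)).
have hj : dot g g / (2 * dot w w) < j.+1%:R by exact: truncnS_gt.
have w2 : 0 < 2 * dot w w by rewrite mulr_gt0.
rewrite ltr_pdivrMr // in hj.
have pow : j.+1%:R <= 2 ^+ j.+1 :> R by rewrite -natrX ler_nat ltnW // ltn_expl.
have := key j.+1; rewrite exprVn [X in _ <= X]mulrC ler_pdivlMr ?exprn_gt0 // => h.
by have := lt_le_trans hj (ler_wpM2r (ltW w2) pow); rewrite [X in _ < X]mulrC ltNge h.
Qed.

Section LocalToGlobal.
Variables (R : realType) (n : nat) (kappa : R).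
Hypothesis kappa_gt1 : 1 < kappa.
Hypothesis n_gt0 : (0 < n)%N.
Variables (Omega : set 'rV[R]_n) (Sigma : set (pt R n)) (tau0 tau1 omega : R).
Variable s : pt R n -> pt R n -> R.
Hypothesis setting : parallel_setting kappa Omega Sigma tau0 tau1 omega s.
Variable K : nat -> R.
Hypothesis K_bound : phi_derivative_bounds kappa Omega Sigma tau0 K.
Variable u : 'rV[R]_n -> R.
Hypothesis refractor : parallel_refractor kappa Omega Sigma tau0 u.
Implicit Types (x y z w v p d : 'rV[R]_n) (X Y Z : pt R n) (b t e : R).

Local Notation k := (kappa ^+ 2 - 1).
Local Notation L := (slope_lip_const kappa K).
Local Notation F := (Fu kappa Omega Sigma u).
Local Notation c x Y := (cfun kappa (x, u x) Y).
Local Notation Dphi x Y := (Dxphi kappa x Y (x, u x)).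
Let k0 : 0 < k := k_gt0 kappa_gt1.
Let kappa0 : 0 < kappa := kappa_gt0 kappa_gt1.
Let L0 : 0 < L := slope_lip_const_gt0 kappa_gt1 K.
Let kp : 0 < kappa + 1. Proof. by rewrite addr_gt0. Qed.
Let ule x : Omega x -> u x <= tau0 := @refractor_le _ _ _ _ _ _ _ refractor x.

Local Notation graph_const := (1 + (Num.sqrt k)^-1).

Lemma graph_lip x x' : Omega x -> Omega x' ->
  pnorm ((x, u x) - (x', u x')) <= graph_const * enorm (x - x').
Proof.
move=> Ox Ox'; apply: (le_trans (pnorm_le _)) => /=.
by have := refractor_lip kappa_gt1 setting refractor Ox Ox'; lra.
Qed.

Lemma cfun_graph_lip x x' Y : Omega x -> Omega x' ->
  `|c x Y - c x' Y| <= (kappa + 1) * graph_const * enorm (x - x').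
Proof.
move=> Ox Ox'; apply: (le_trans (cfun_lip kappa_gt1 _ _ _ _)).
rewrite subrr pnorm0 addr0 -mulrA ler_pM2l //; exact: graph_lip.
Qed.

(** By hypothesis x1 maximizes x -> c(x, Ys m) up to an error tending to 0; as c is Lipschitz in the
    focus, this passes to a cluster point in the compact [Sigma]. *)
Lemma Fu_cluster x1 (Ys : nat -> pt R n) C : Omega x1 ->
  (forall m, Sigma (Ys m)) ->
  (forall m x, Omega x -> c x (Ys m) <= c x1 (Ys m) + C * m.+1%:R^-1) ->
  exists2 Y, F x1 Y & forall e, 0 < e ->
    exists m, m.+1%:R^-1 < e /\ pnorm (Y - Ys m) < e.
Proof.
move=> Ox1 SYs hYs.
have [Y SY cl] := compact_cluster_seq (Sigma_compact setting) SYs.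
have cl' e : 0 < e -> exists m, m.+1%:R^-1 < e /\ pnorm (Y - Ys m) < e.
  move=> e0; have [N hN] := small_inv e0.
  have n1 : 0 < n%:R + 1 :> R by rewrite ltr_wpDl.
  have [m Nm hm] := cl _ (divr_gt0 e0 n1) N.
  exists m; split; first exact: hN.
  by apply: (le_lt_trans (pnorm_le_norm _)); rewrite mulrC -ltr_pdivlMr.
exists Y => //; apply/(Fu_cfun kappa_gt1 setting refractor _ Ox1); split => // x Ox.
apply: (@le_of_small_errors _ _ _ (`|C| + 2 * (kappa + 1)) 1) => // e e0 _.
have [m [me Ym]] := cl' e e0.
have h1 := cfun_lip kappa_gt1 (x, u x) (x, u x) Y (Ys m).
have h2 := cfun_lip kappa_gt1 (x1, u x1) (x1, u x1) Y (Ys m).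
rewrite subrr pnorm0 add0r in h1; rewrite subrr pnorm0 add0r in h2.
have h3 := ler_wpM2l (ltW kp) (ltW Ym).
have h4 : C * m.+1%:R^-1 <= `|C| * e.
  apply: (@le_trans _ _ (`|C| * m.+1%:R^-1)).
    by apply: ler_wpM2r; [rewrite invr_ge0|exact: ler_norm].
  by apply: ler_wpM2l => //; exact: ltW.
rewrite !ler_norml in h1 h2; case/andP: h1 => _ h1; case/andP: h2 => h2 _.
move: (hYs m x Ox) h4 h3 h2 h1; move: (C * _) (`|C|) => a C'.
by move: (c x Y) (c x (Ys m)) (c x1 Y) (c x1 (Ys m)) (pnorm _) => *; lra.
Qed.

(** [Fu_cluster] with zero error, applied to a minimizing sequence. *)
Lemma Fu_min x1 (f : pt R n -> R) C : Omega x1 -> (forall Y, 0 <= f Y) ->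
  (forall Y Y', Sigma Y -> Sigma Y' -> `|f Y - f Y'| <= C * pnorm (Y - Y')) ->
  exists2 Y, F x1 Y & forall Y', F x1 Y' -> f Y <= f Y'.
Proof.
move=> Ox1 f0 flip.
pose A := [set f Y | Y in F x1].
have A0 : has_inf A.
  split; last by exists 0 => _ [Y _ <-].
  have [Y FY] := Fu_nonempty kappa_gt1 setting refractor Ox1.
  by exists (f Y), Y.
have /choice[Ys hYs] : forall m : nat, exists Y, F x1 Y /\ f Y < inf A + m.+1%:R^-1.
  move=> m; have m0 : 0 < m.+1%:R^-1 :> R by rewrite invr_gt0 ltr0n.
  by have [_ [Y FY <-] h] := inf_adherent m0 A0; exists Y.
have SYs m : Sigma (Ys m) by have [[]] := hYs m.
have [|Y FY cl] := @Fu_cluster x1 Ys 0 Ox1 SYs.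
  move=> m x Ox; rewrite mul0r addr0.
  have [/(Fu_cfun kappa_gt1 setting refractor _ Ox1)[_ h] _] := hYs m.
  exact: h.
exists Y => // Y' FY'.
have hY' : inf A <= f Y' by apply: ge_inf; [case: A0|exists Y'].
have SY : Sigma Y by case: FY.
apply: (@le_of_small_errors _ _ _ (1 + `|C|) 1) => // e e0 _.
have [m [me Ym]] := cl e e0; have [_ fm] := hYs m.
have := flip _ _ SY (SYs m); rewrite ler_norml => /andP[_ h].
have : C * pnorm (Y - Ys m) <= `|C| * e.
  apply: (@le_trans _ _ (`|C| * pnorm (Y - Ys m))).
    by apply: ler_wpM2r; [exact: pnorm_ge0|exact: ler_norm].
  by apply: ler_wpM2l => //; exact: ltW.
move: h fm me hY'; move: (m.+1%:R^-1) (inf A) (C * _) (`|C|) => i a d C'.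
by move: (f Y) (f Y') (f _) => *; lra.
Qed.

(* Moving from [x1] to [x1 + e w] along a local support of slope v forces the
   supports at the new point to have slope at least v in the direction w. *)
Lemma Fu_step x1 Y w e Y' : Omega x1 -> Omega (x1 + e *: w) -> Sigma Y ->
  0 < e -> phi kappa (x1 + e *: w) Y (x1, u x1) <= u (x1 + e *: w) ->
  F (x1 + e *: w) Y' ->
  dot w (Dphi x1 Y) <= dot w (Dphi x1 Y') +
    (enorm w * (L * (2 + (kappa + 1) * graph_const) * enorm w)) * e /\
  forall x, Omega x ->
    c x Y' <= c x1 Y' + (kappa + 1) * graph_const * enorm w * e.
Proof.
move=> Ox1 Oxe SY e0 hY /(Fu_cfun kappa_gt1 setting refractor _ Oxe)[SY' hY'].
have ew : enorm (x1 + e *: w - x1) = e * enorm w.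
  by rewrite addrC addKr enormZ gtr0_norm.
set xe := x1 + e *: w in Oxe hY hY' ew *.
have cl := cfun_graph_lip Y' Oxe Ox1; rewrite ew in cl.
split; last first.
  move=> x Ox; have := hY' x Ox; rewrite ler_norml in cl.
  by case/andP: cl => _; lra.
have hx1 := hY' _ Ox1.
rewrite -(phi_le_cfun kappa_gt1 setting) ?ule // in hx1.
rewrite (phi_expand kappa_gt1 setting _ Oxe (ule Oxe) SY') in hx1.
rewrite (phi_expand kappa_gt1 setting _ Ox1 (ule Ox1) SY) in hY.
have xew : xe - x1 = e *: w by rewrite /xe addrC addKr.
rewrite xew -(opprB xe) xew dotNl !dotZl in hx1 hY.
have g1 := slope_Dxphi kappa_gt1 n_gt0 setting K_bound xe Ox1 (ule Ox1) SY.
rewrite ew in g1.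
have cpos := cfun_gt0 kappa_gt1 setting Ox1 SY' (ule Ox1).
have g2 : enorm (slope kappa x1 xe Y'.1 (c xe Y') + Dphi x1 Y') <=
    L * (e * enorm w + (kappa + 1) * graph_const * (e * enorm w)).
  rewrite (Dxphi_slope kappa_gt1 cpos) /=.
  apply: (le_trans (slope_lip_setting kappa_gt1 n_gt0 setting K_bound
    _ _ _ _ _ Oxe (ule Oxe) SY' cpos)).
  by rewrite !subrr enorm0 add0r addr0 ew ler_pM2l // lerD2l.
move: g1 g2 hx1 hY.
move: (slope _ _ _ _ _) (slope _ _ _ _ _) (Dphi x1 Y) (Dphi x1 Y')
  => ga gb va vb g1 g2 hx1 hY.
have hg : dot w ga <= dot w gb.
  by rewrite -(ler_pM2l e0); lra.
have h1 := dot_le w (gb + va); have h2 := dot_le w (- (ga + vb)).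
rewrite enormN dotNr !dotDr in h1 h2.
have w0 := enorm_ge0 w.
have h3 := ler_wpM2l w0 g1; have h4 := ler_wpM2l w0 g2.
move: h1 h2 h3 h4 hg; move: (enorm w) => W; lra.
Qed.

(** By [Fu_step], supports at x1 + e w have slopes at least that of [Y] in the direction w, up to
    O(e). As e tends to 0, their foci cluster at an element of F x1. *)
Lemma Fu_separation x1 Y r w : Omega x1 -> Sigma Y -> 0 < r ->
  (forall x, Omega x -> enorm (x - x1) < r -> phi kappa x Y (x1, u x1) <= u x) ->
  exists2 Y', F x1 Y' & dot w (Dphi x1 Y) <= dot w (Dphi x1 Y').
Proof.
move=> Ox1 SY r0 loc; have [r' r'0 hr'] := Omega_ball setting Ox1.
have w1 : 0 < enorm w + 1 by rewrite ltr_wpDl // enorm_ge0.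
pose rho := Num.min r r' / (enorm w + 1).
have rho0 : 0 < rho by rewrite divr_gt0 // lt_min r0.
have m0 (m : nat) : 0 < m.+1%:R^-1 :> R by rewrite invr_gt0 ltr0n.
have m1 (m : nat) : m.+1%:R^-1 <= 1 :> R by rewrite invf_le1 ?ltr0n // ler1n.
pose e (m : nat) := rho * m.+1%:R^-1.
have e0 m : 0 < e m by rewrite mulr_gt0.
have ew m : enorm (e m *: w) < Num.min r r'.
  rewrite enormZ gtr0_norm //.
  apply: (@le_lt_trans _ _ (rho * enorm w)).
    apply: ler_wpM2r; first exact: enorm_ge0.
    by rewrite /e -[leRHS]mulr1 ler_pM2l.
  apply: (@lt_le_trans _ _ (rho * (enorm w + 1))); first by rewrite ltr_pM2l // ltrDl.
  by rewrite /rho divfK // gt_eqF.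
have Oe m : Omega (x1 + e m *: w).
  by apply: hr'; apply: (lt_le_trans (ew m)); rewrite ge_min lexx orbT.
have he m : phi kappa (x1 + e m *: w) Y (x1, u x1) <= u (x1 + e m *: w).
  apply: loc => //; rewrite [x1 + _]addrC addrK.
  by apply: (lt_le_trans (ew m)); rewrite ge_min lexx.
have /choice[Ys hYs] : forall m, exists Y', F (x1 + e m *: w) Y'.
  by move=> m; apply: (Fu_nonempty kappa_gt1 setting refractor).
have SYs m : Sigma (Ys m) by have [] := hYs m.
set C1 := enorm w * (L * (2 + (kappa + 1) * graph_const) * enorm w).
set C2 := (kappa + 1) * graph_const * enorm w.
have st m := Fu_step Ox1 (Oe m) SY (e0 m) (he m) (hYs m).
have [|Y' FY' cl] := @Fu_cluster x1 Ys (C2 * rho) Ox1 SYs.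
  by move=> m x Ox; have [_ /(_ x Ox)] := st m; rewrite -/C2 /e mulrA.
have SY' : Sigma Y' by case: FY'.
exists Y'; first exact: FY'.
have sk0 : 0 <= (Num.sqrt k)^-1 by rewrite invr_ge0 sqrtr_ge0.
have C10 : 0 <= C1.
  apply: mulr_ge0; first exact: enorm_ge0.
  apply: mulr_ge0; last exact: enorm_ge0.
  apply: mulr_ge0; first exact: ltW.
  by rewrite addr_ge0 // mulr_ge0 ?(ltW kp) // addr_ge0.
apply: (@le_of_small_errors _ _ _ (C1 * rho + enorm w * (L * (kappa + 2))) 1) => //.
move=> eta eta0 _; have [m [me Ym]] := cl eta eta0.
have [h1 _] := st m; rewrite -/C1 in h1.
have h2 := Dxphi_lip kappa_gt1 n_gt0 setting K_bound Ox1 (ule Ox1) (SYs m) SY'.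
rewrite pnormB in h2.
have h3 : C1 * e m <= C1 * rho * eta.
  rewrite -mulrA; apply: ler_wpM2l => //; rewrite /e ler_pM2l //; exact: ltW.
have h4 : dot w (Dphi x1 (Ys m)) - dot w (Dphi x1 Y') <= enorm w * (L * (kappa + 2)) * eta.
  move: h2; move: (Dphi x1 (Ys m)) (Dphi x1 Y') => va vb h2.
  rewrite -dotNr -dotDr; apply: (le_trans (dot_le _ _)); rewrite -mulrA.
  apply: ler_wpM2l; first exact: enorm_ge0.
  apply: (le_trans h2); apply: ler_wpM2l; last exact: ltW.
  by rewrite mulr_ge0 ?(ltW L0) // addr_ge0 // ltW.
exact: ler_error_sum h1 h3 h4.
Qed.

(** Regularity at the midpoint, with the quadratic gain weakened to 0: the form from which midpoint
    convexity of the slopes of supports is derived. *)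
Definition locally_regular x1 c2 := forall Ya Yb x, Sigma Ya -> Sigma Yb ->
  Omega x -> enorm (x - x1) <= c2 ->
  phi kappa x (Yseg kappa s Ya Yb (x1, u x1) (1 / 2)) (x1, u x1) <=
  Num.max (phi kappa x Ya (x1, u x1)) (phi kappa x Yb (x1, u x1)).

Lemma Fu_midpoint x1 c2 Ya Yb : (1 < n)%N -> Omega x1 -> 0 < c2 ->
  locally_regular x1 c2 -> F x1 Ya -> F x1 Yb ->
  exists2 Ym, F x1 Ym & Dphi x1 Ym = 2^-1 *: (Dphi x1 Ya + Dphi x1 Yb).
Proof.
move=> n1 Ox1 c20 reg Fa Fb; have [Sa ha] := Fa; have [Sb hb] := Fb.
(* Equal slopes leave no direction for [drop_of_phi_le_max], but then [Ya] itself serves as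
   midpoint. *)
have [vab|vab] := eqVneq (Dphi x1 Ya) (Dphi x1 Yb).
  have half v : v = 2^-1 *: (v + v).
    by apply/rowP => i; rewrite !mxE; field.
  by exists Ya; [exact: Fa|rewrite -vab; exact: half].
have cyl := refractor_cylinder refractor Ox1.
have [_ /= t01] := cyl.
have hl : (0 <= 1 / 2 :> R) && (1 / 2 <= 1 :> R) by apply/andP; split; lra.
set Ym := Yseg kappa s Ya Yb (x1, u x1) (1 / 2).
have [_ Sm] := arc_defined setting cyl Sa Sb hl.
have ev : Dphi x1 Ym = 2^-1 *: (Dphi x1 Ya + Dphi x1 Yb).
  rewrite (Dxphi_Yseg kappa_gt1 setting Ox1 t01 Sa Sb hl).
  move: (Dphi x1 Ya) (Dphi x1 Yb) => va vb.
  by rewrite scalerDr; congr (_ *: _ + _ *: _); lra.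
have reg' x : Omega x -> enorm (x - x1) <= c2 -> phi kappa x Ym (x1, u x1) <=
  Num.max (phi kappa x Ya (x1, u x1)) (phi kappa x Yb (x1, u x1)) by move=> Ox; exact: reg.
exists Ym => //; split => // x Ox.
apply: (@le_trans _ _ (Num.max (phi kappa x Ya (x1, u x1)) (phi kappa x Yb (x1, u x1)))).
  apply: (phi_le_max_of_drop kappa_gt1 setting Ox1 Ox (ule Ox1) Sa Sb Sm ev).
  exact: (drop_of_phi_le_max kappa_gt1 setting n1 Ox1 (ule Ox1) Sa Sb Sm ev vab c20 reg').
by rewrite ge_max ha // hb.
Qed.


(** Let [Y0] in F x1 have the slope nearest to that of [Y], and w be the difference of these slopes.
    If w is not 0, separation gives a support [Y1] at least as far as [Y] in the direction w, and
    bisecting from [Y1] towards [Y0] reaches slopes nearer to that of [Y] than that of [Y0]. *)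
Lemma local_to_global_multidim x1 Y r c2 : (1 < n)%N -> Omega x1 -> Sigma Y ->
  0 < r ->
  (forall x, Omega x -> enorm (x - x1) < r -> phi kappa x Y (x1, u x1) <= u x) ->
  0 < c2 -> locally_regular x1 c2 -> F x1 Y.
Proof.
move=> n1 Ox1 SY r0 loc c20 reg.
have flip Ya Yb : Sigma Ya -> Sigma Yb ->
    `|enorm (Dphi x1 Y - Dphi x1 Ya) - enorm (Dphi x1 Y - Dphi x1 Yb)| <=
    L * (kappa + 2) * pnorm (Ya - Yb).
  move=> Sa Sb.
  have := Dxphi_lip kappa_gt1 n_gt0 setting K_bound Ox1 (ule Ox1) Sa Sb.
  move: (Dphi x1 Y) (Dphi x1 Ya) (Dphi x1 Yb) => v va vb; apply: le_trans.
  by apply: (le_trans (enorm_lip _ _)); rewrite subrACA subrr sub0r enormN.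
have [Y0 F0 Ymin] := Fu_min Ox1 (fun Y' => enorm_ge0 (Dphi x1 Y - Dphi x1 Y')) flip.
have [e0|ne0] := eqVneq (Dphi x1 Y) (Dphi x1 Y0).
  have S0 : Sigma Y0 by case: F0.
  have [_ /= t01] := refractor_cylinder refractor Ox1.
  by rewrite (Dxphi_inj kappa_gt1 setting Ox1 t01 SY S0 e0).
exfalso.
pose w := Dphi x1 Y - Dphi x1 Y0.
have [Y1 F1 sep] := Fu_separation w Ox1 SY r0 loc.
pose g := Dphi x1 Y1 - Dphi x1 Y0.
have bis (j : nat) : exists2 Yj, F x1 Yj & Dphi x1 Yj = Dphi x1 Y0 + 2^-1 ^+ j *: g.
  elim: j => [|j [Yj Fj ej]].
    exists Y1; first exact: F1.
    by rewrite expr0 scale1r /g addrC subrK.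
  have [Ym Fm em] := Fu_midpoint n1 Ox1 c20 reg F0 Fj.
  exists Ym; first exact: Fm.
  have half v0 g' : 2^-1 *: (v0 + (v0 + 2^-1 ^+ j *: g')) =
      v0 + 2^-1 ^+ j.+1 *: g' :> 'rV[R]_n.
    by apply/rowP => i; rewrite !mxE exprS; field.
  by rewrite em ej; exact: half.
have wg : dot w w <= dot w g.
  have gen v v1 v0 w' : dot w' v <= dot w' v1 ->
      dot w' (v - v0) <= dot w' (v1 - v0) by rewrite !dotDr lerD2r.
  exact: gen sep.
have wp : 0 < dot w w.
  rewrite lt_def dotxx_ge0 andbT; apply/eqP => /dotxx_eq0 /eqP.
  by rewrite subr_eq0; apply/negP.
have wmin (j : nat) : enorm w <= enorm (w - 2^-1 ^+ j *: g).
  have [Yj Fj ej] := bis j.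
  by have := Ymin _ Fj; rewrite ej opprD addrA -/w.
exact: (no_dyadic_minimum wp wg wmin).
Qed.

(* A strict failure beyond a local maximum of [c x Y] along a segment creates
   an interior minimum, where the hyperboloid with focus [Y] touches [u] from
   above; in dimension one its slope is then that of a support of [u]. *)
Lemma local_to_global_dim1 x1 Y r : n = 1%N -> Omega x1 -> Sigma Y ->
  0 < r ->
  (forall x, Omega x -> enorm (x - x1) < r -> phi kappa x Y (x1, u x1) <= u x) ->
  F x1 Y.
Proof.
move=> n1 Ox1 SY r0 loc.
apply/(Fu_cfun kappa_gt1 setting refractor _ Ox1); split => // x2 Ox2.
rewrite leNgt; apply/negP => hlt.
pose d := x2 - x1; pose x h := x1 + h *: d.
have d0 : d != 0.
  by rewrite subr_eq0; apply: contraTneq hlt => ->; rewrite ltxx.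
have xO h : 0 <= h <= 1 -> Omega (x h).
  move=> hh; have -> : x h = (1 - h) *: x1 + h *: x2.
    by apply/rowP => i; rewrite /x /d !mxE; ring.
  exact: (Omega_conv setting).
have xx a b : x a - x b = (a - b) *: d.
  by apply/rowP => i; rewrite /x !mxE; ring.
have x0 : x 0 = x1 by rewrite /x scale0r addr0.
have x11 : x 1 = x2 by rewrite /x scale1r /d addrC subrK.
have locc h : 0 <= h <= 1 -> h * enorm d < r -> c (x h) Y <= c x1 Y.
  move=> hh hr; have Oh := xO _ hh.
  rewrite -(phi_le_cfun kappa_gt1 setting Oh Ox1 (ule Oh) (ule Ox1) SY).
  apply: loc; first exact: Oh.
  by rewrite /x addrC addKr enormZ ger0_norm //; case/andP: hh.
have [h0] : exists2 h0, h0 \in `[0, 1] & forall h, h \in `[0, 1] -> c (x h0) Y <= c (x h) Y.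
  apply: (@EVT_min R (fun h => c (x h) Y) 0 1) => //.
  apply: (@lipschitz_within _ _ _ _ ((kappa + 1) * graph_const * enorm d)) => a b.
  rewrite /= !in_itv /= => ha hb; apply: (le_trans (cfun_graph_lip _ (xO _ ha) (xO _ hb))).
  by rewrite xx enormZ [`|a - b| * _]mulrC mulrA.
rewrite in_itv /= => h01 hmin'.
have hmin h : 0 <= h <= 1 -> c (x h0) Y <= c (x h) Y.
  by move=> hh; apply: hmin'; rewrite in_itv.
have [h3 /andP[h30 h31] h3min] : exists2 h3, 0 < h3 < 1 &
    forall h, 0 <= h <= 1 -> c (x h3) Y <= c (x h) Y.
  have z01 : (0 <= 0 :> R) && (0 <= 1 :> R) by rewrite lexx ler01.
  have [hp|hn] := ltP 0 h0.
    exists h0 => //; rewrite hp /= lt_neqAle; case/andP: h01 => _ ->.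
    rewrite andbT; apply/eqP => h1; have := hmin 0 z01.
    by rewrite h1 x11 x0 leNgt hlt.
  (* A minimum at 0 meets the local maximum there, so c is constant near 0 and a small positive h3
     is a minimum as well. *)
  have h00 : h0 = 0 by apply/eqP; rewrite eq_le hn; case/andP: h01.
  have d1 : 0 < enorm d + 1 by rewrite ltr_wpDl // enorm_ge0.
  pose h3 := Num.min (1 / 2) (r / (enorm d + 1)).
  have p3 : 0 < h3 by rewrite lt_min divr_gt0 //= divr_gt0.
  have l3 : h3 < 1 by rewrite gt_min; apply/orP; left; lra.
  exists h3; first by rewrite p3.
  move=> h hh; apply: le_trans (hmin h hh); rewrite h00 x0; apply: locc.
    by rewrite !ltW.
  apply: (@lt_le_trans _ _ (h3 * (enorm d + 1))); first by rewrite ltr_pM2l // ltrDl.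
  by rewrite -ler_pdivlMr // ge_min lexx orbT.
have Ox3 : Omega (x h3) by apply: xO; rewrite !ltW.
have [Y3 F3] := Fu_nonempty kappa_gt1 setting refractor Ox3.
have [S3 sup3] := F3.
have touch e : 0 <= h3 + e <= 1 -> phi kappa (x h3 + e *: d) Y3 (x h3, u (x h3)) <=
    phi kappa (x h3 + e *: d) Y (x h3, u (x h3)).
  move=> he; have -> : x h3 + e *: d = x (h3 + e).
    by apply/rowP => i; rewrite /x !mxE; ring.
  have Oe := xO _ he; apply: (le_trans (sup3 _ Oe)).
  rewrite (phi_ge_cfun kappa_gt1 setting Oe Ox3 (ule Oe) (ule Ox3) SY).
  exact: h3min.
have e0 : 0 < Num.min h3 (1 - h3) by rewrite lt_min h30 subr_gt0.
have t1 := @one_sided_slope _ _ _ kappa_gt1 n_gt0 _ _ _ _ _ _ setting _ K_bound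
  (x h3) (u (x h3)) Y3 Y d _ Ox3 (ule Ox3) S3 SY e0 _.
have t2 := @one_sided_slope _ _ _ kappa_gt1 n_gt0 _ _ _ _ _ _ setting _ K_bound
  (x h3) (u (x h3)) Y3 Y (- d) _ Ox3 (ule Ox3) S3 SY e0 _.
have e1 : dot d (Dphi (x h3) Y3) = dot d (Dphi (x h3) Y).
  have {}t1 : dot d (Dphi (x h3) Y3) <= dot d (Dphi (x h3) Y).
    apply: t1 => e ep; rewrite lt_min => /andP[ea eb]; apply: touch.
    by rewrite addr_ge0 ?(ltW h30) ?(ltW ep) //= -lerBrDl ltW.
  have {}t2 : dot (- d) (Dphi (x h3) Y3) <= dot (- d) (Dphi (x h3) Y).
    apply: t2 => e ep; rewrite lt_min => /andP[ea eb]; rewrite scalerN -scaleNr.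
    apply: touch.
    by rewrite subr_ge0 (ltW ea) /= (le_trans _ (ltW h31)) // gerBl ltW.
  move: t1 t2; move: (Dphi _ Y3) (Dphi _ Y) => va vb; rewrite !dotNl lerN2 => t1 t2.
  by apply/eqP; rewrite eq_le t1 t2.
have [_ /= t01] := refractor_cylinder refractor Ox3.
have e2 : Y3 = Y.
  apply: (Dxphi_inj kappa_gt1 setting Ox3 t01 S3 SY).
  exact: (dot_inj_dim1 n1 d0 e1).
rewrite e2 in F3.
have [_ hF] := iffLR (Fu_cfun kappa_gt1 setting refractor _ Ox3) F3.
have := hF _ Ox2; have := h3min 0; rewrite lexx ler01 x0 => /(_ isT) ha hb.
by have := lt_le_trans hlt (le_trans hb ha); rewrite ltxx.
Qed.

Lemma local_to_global x1 Y r c2 : Omega x1 -> Sigma Y -> 0 < r ->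
  (forall x, Omega x -> enorm (x - x1) < r -> phi kappa x Y (x1, u x1) <= u x) ->
  0 < c2 -> locally_regular x1 c2 -> F x1 Y.
Proof.
move=> Ox1 SY r0 loc c20 reg; have [n1|n1] := ltnP 1 n.
  exact: (local_to_global_multidim n1 Ox1 SY r0 loc c20 reg).
apply: (local_to_global_dim1 _ Ox1 SY r0 loc).
by apply/eqP; rewrite eqn_leq n1.
Qed.

End LocalToGlobal.

(** * The inclusion of the neighborhood of the arc *)

Lemma enorm_ball_compact (R : realType) (n : nat) (x0 : 'rV[R]_n) (r : R) :
  compact [set x | enorm (x - x0) <= r].
Proof.
apply: bounded_closed_compact.
  exists (`|x0| + `|r|); split; first exact: num_real.
  move=> b hb x /= hx; apply: ltW; apply: le_lt_trans hb.
  rewrite -[x](subrK x0) (le_trans (ler_normD _ _)) // addrC lerD2l.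
  by rewrite (le_trans (mx_norm_le_enorm _)) // (le_trans hx) // ler_norm.
apply: (@preimage_closed _ _ (fun x : 'rV[R]_n => enorm (x - x0)) [set y | y <= r]).
  move=> x _; apply: (@lipschitz_continuous R _ _ n%:R) => a b.
  apply: (le_trans (enorm_lip _ _)).
  by rewrite subrACA subrr subr0 enorm_le_mx_norm.
exact: closed_le.
Qed.

Lemma powR32_powR12 (R : realType) (D a : R) : 0 < D -> 0 <= a ->
  D `^ (3 / 2) * a `^ (1 / 2) = D ^+ 2 * (a / D) `^ (1 / 2).
Proof.
move=> D0 a0; rewrite div1r.
have -> : 3 / 2 = 1 + 2^-1 :> R by field.
rewrite powRD; last by rewrite (gt_eqF D0) implybT.
rewrite powRr1 ?(ltW D0) // !powR12_sqrt ?(ltW D0) ?divr_ge0 ?(ltW D0) //.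
have -> : Num.sqrt a = Num.sqrt D * Num.sqrt (a / D).
  by rewrite -(sqrtrM _ (ltW D0)) mulrCA divff ?mulr1 // gt_eqF.
have -> : D ^+ 2 = D * Num.sqrt D ^+ 2 by rewrite sqr_sqrtr ?(ltW D0).
by ring.
Qed.

Section Conclusion.
Variables (R : realType) (n : nat) (kappa : R).
Hypothesis kappa_gt1 : 1 < kappa.
Hypothesis n_gt0 : (0 < n)%N.
Variables (Omega : set 'rV[R]_n) (Sigma : set (pt R n)) (tau0 tau1 omega : R).
Variable s : pt R n -> pt R n -> R.
Hypothesis setting : parallel_setting kappa Omega Sigma tau0 tau1 omega s.
Variable K : nat -> R.
Hypothesis K_bound : phi_derivative_bounds kappa Omega Sigma tau0 K.
Variable u : 'rV[R]_n -> R.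
Hypothesis refractor : parallel_refractor kappa Omega Sigma tau0 u.

Local Notation c x Y := (cfun kappa (x, u x) Y).
Let ule x : Omega x -> u x <= tau0 := @refractor_le _ _ _ _ _ _ _ refractor x.

(* The hyperboloid with focus [Y] and least parameter touching [u] on the ball
   touches it in the interior when it is already below [u] on the sphere. *)
Lemma Fu_ball x0 eta c2 Y : 0 < eta -> 0 < c2 ->
  (forall x, enorm (x - x0) <= eta ->
     Omega x /\ locally_regular kappa Omega Sigma s u x c2) ->
  Sigma Y ->
  (forall x, enorm (x - x0) = eta -> phi kappa x Y (x0, u x0) < u x) ->
  Fu_set kappa Omega Sigma u (eball x0 eta) Y.
Proof.
move=> eta0 c20 hB SY sphere.
pose B := [set x : 'rV[R]_n | enorm (x - x0) <= eta].
have Bx0 : B x0 by rewrite /B /= subrr enorm0 ltW.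
have [x1] : exists2 x1, x1 \in B & forall x, x \in B -> c x Y <= c x1 Y.
  apply: (@EVT_max_rV R n (fun x => c x Y) B).
  - by exists x0.
  - exact: enorm_ball_compact.
  apply: (@lipschitz_within _ _ _ _
    ((kappa + 1) * (1 + (Num.sqrt (kappa ^+ 2 - 1))^-1) * n%:R)) => a b Ba Bb.
  apply: (le_trans (cfun_graph_lip kappa_gt1 setting refractor Y (hB _ Ba).1 (hB _ Bb).1)).
  rewrite -[leRHS]mulrA; apply: ler_wpM2l (enorm_le_mx_norm _).
  by rewrite mulr_ge0 // addr_ge0 ?invr_ge0 ?sqrtr_ge0 // ltW // (kappa_gt0 kappa_gt1).
rewrite inE => Bx1 hmax'.
have hmax x : B x -> c x Y <= c x1 Y by move=> Bx; apply: hmax'; rewrite inE.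
have [Ox0 _] := hB _ Bx0; have [Ox1 reg1] := hB _ Bx1.
have lt1 : enorm (x1 - x0) < eta.
  rewrite lt_neqAle Bx1 andbT; apply/eqP => e.
  have := sphere _ e; rewrite ltNge.
  by rewrite (phi_ge_cfun kappa_gt1 setting Ox1 Ox0 (ule Ox1) (ule Ox0) SY) hmax.
exists x1; first exact: lt1.
have r0 : 0 < eta - enorm (x1 - x0) by rewrite subr_gt0.
apply: (local_to_global kappa_gt1 n_gt0 setting K_bound refractor Ox1 SY r0 _ c20 reg1).
move=> x Ox hx.
rewrite (phi_le_cfun kappa_gt1 setting Ox Ox1 (ule Ox) (ule Ox1) SY).
apply: hmax; apply: (le_trans (enorm_dist x x1 x0)).
by rewrite -lerBrDr ltW.
Qed.

Lemma property_conclusion_holds xstar delta C c1 c2 :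
  0 < delta -> 0 < C -> 0 < c1 -> 0 < c2 -> eball xstar delta `<=` Omega ->
  (forall x, eball xstar delta x -> locally_regular kappa Omega Sigma s u x c2) ->
  property_P kappa Omega Sigma s u xstar delta C c1 c2 ->
  property_conclusion kappa Omega Sigma s u xstar delta c2 (1 + 2 * C / c1).
Proof.
move=> delta0 C0 c10 c20 dO reg P xbar xhat Ybar Yhat bh bb Fb Fh hmax.
set M := 1 + _.
have M1 : 1 <= M by rewrite lerDl divr_ge0 ?(ltW c10) // mulr_ge0 // ltW.
have M0 : 0 < M by apply: lt_le_trans M1.
set a := enorm (xbar - xhat) in hmax *; set D := pnorm (Ybar - Yhat) in hmax *.
(* For a = 0 also mu = 0, and a neighborhood defined by a strict inequality is then empty. *)
have [a0|a0] := eqVneq a 0.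
  exists xbar; first by exists 0; rewrite /= ?lexx ?ler01 // subr0 scale1r scale0r addr0.
  move=> /= Y [[W _]]; rewrite a0 powR0 ?mulr0; last by rewrite div1r invr_eq0 pnatr_eq0.
  by move=> h; have := le_lt_trans (pnorm_ge0 (Y - W)) h; rewrite ltxx.
have ap : 0 < a by rewrite lt_def a0 enorm_ge0.
have Dge q : q <= Num.max 1 (Num.max ((2 * M / delta) ^+ 2) ((2 * M / c2) ^+ 2)) ->
    q * a <= D.
  by move=> hq; apply: le_trans hmax; rewrite ler_pM2r.
have Da : a <= D by rewrite -[a]mul1r; apply: Dge; rewrite le_max lexx.
have Dp : 0 < D by exact: lt_le_trans Da.
have half (x : 'rV[R]_n) : eball xstar (delta / 2) x -> eball xstar delta x.
  by rewrite /eball /= => h; apply: (lt_le_trans h); rewrite ler_pdivrMr //; lra.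
have [x0 seg hP] := P _ _ _ _ (half _ bb) (half _ bh) Fb Fh Da.
exists x0 => //.
have b0 := eball_segment bb bh seg.
(* Here mu = D^2 rt and eta = M rt with rt = sqrt(a / D), so that real powers reduce to square
   roots. *)
rewrite /= powR32_powR12 ?(ltW ap) //.
rewrite div1r powR12_sqrt; last by rewrite divr_ge0 // ltW.
set rt := Num.sqrt (a / D).
have rt0 : 0 < rt by rewrite sqrtr_gt0 divr_gt0.
have rt2 : D ^+ 2 * rt ^+ 2 = D * a.
  by rewrite /rt sqr_sqrtr ?divr_ge0 ?(ltW ap) ?(ltW Dp) //; field; rewrite gt_eqF.
(* The squared entries of the maximum are made for this: with q = delta the ball of radius eta about
   x0 remains in the ball where regularity holds, with q = c2 in the range of (P). *)
have small q : 0 < q -> (2 * M / q) ^+ 2 * a <= D -> M * rt <= q / 2.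
  move=> q0 hq.
  have p0 : 0 <= 2 * M / q by rewrite divr_ge0 ?(ltW q0) // mulr_ge0 // ltW.
  have h1 : (2 * M / q * rt) ^+ 2 <= 1.
    rewrite exprMn /rt sqr_sqrtr; last by apply: divr_ge0; exact: ltW.
    by rewrite mulrA ler_pdivrMr // mul1r.
  have : 2 * M / q * rt <= 1.
    rewrite -(@expr_le1 _ 2) //; apply: mulr_ge0 => //; exact: ltW.
  by rewrite mulrAC ler_pdivrMr // mul1r ler_pdivlMr // => h; lra.
have etad : M * rt <= delta / 2.
  by apply: small => //; apply: Dge; rewrite !le_max lexx orbT.
have etac : M * rt <= c2 / 2.
  by apply: small => //; apply: Dge; rewrite !le_max lexx !orbT.
have eta0 : 0 < M * rt by rewrite mulr_gt0.
move=> Y [[W [lambda hl [-> arc]] hYW] SY].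
have inball x : enorm (x - x0) <= M * rt -> eball xstar delta x.
  move=> hx; rewrite /eball /=; apply: (le_lt_trans (enorm_dist x x0 xstar)).
  by rewrite /eball /= in b0; lra.
apply: (Fu_ball eta0 c20 _ SY).
  by move=> x hx; split; [apply: dO|apply: reg]; exact: inball.
move=> x hx.
have Ox : Omega x by apply: dO; apply: inball; rewrite hx.
have hxc : eball x0 c2 x.
  by rewrite /eball /= hx (le_lt_trans etac) // ltr_pdivrMr //; lra.
have := hP lambda Y x hl arc SY Ox hxc.
rewrite -subr_gt0; apply: lt_le_trans.
rewrite -/D -/a hx.
have h1 : C * pnorm (Yseg kappa s Ybar Yhat (x0, u x0) lambda - Y) * (M * rt) <=
    C * M * (D * a).
  rewrite pnormB -rt2.
  have -> : C * M * (D ^+ 2 * rt ^+ 2) = C * (D ^+ 2 * rt) * (M * rt) by ring.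
  by rewrite ler_pM2r // ler_pM2l // ltW.
have h2 : c1 * D ^+ 2 * (M * rt) ^+ 2 = c1 * M ^+ 2 * (D * a).
  by rewrite -rt2; ring.
rewrite h2 !mulNr.
have DA : 0 < D * a by rewrite mulr_gt0.
(* The origin of M = 1 + 2 C / c1: from c1 M = c1 + 2 C one gets c1 M^2 = c1 M + 2 C M, and M >= 1
   leaves at least c1. *)
have key : 0 < c1 * M ^+ 2 - C * M - C.
  have e1 : c1 * M = c1 + 2 * C by rewrite /M; field; rewrite gt_eqF.
  have -> : c1 * M ^+ 2 - C * M - C = c1 * M * M - C * M - C by ring.
  rewrite e1; have := ler_wpM2l (ltW C0) M1; have := ler_wpM2l (ltW c10) M1; lra.
have := mulr_gt0 key DA.
set p := C * pnorm _ * _ in h1 *.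
have -> : C * D * a = C * (D * a) by ring.
by move: (D * a) p h1 => q p h1 h3; lra.
Qed.

End Conclusion.

Theorem theorem5p3 (R : realType) (n : nat) (kappa : R)
    (n_gt0 : (0 < n)%N) (kappa_gt1 : 1 < kappa) :
  exists (Cof : (nat -> R) -> R) (Mof : R -> R -> R),
    (forall K, 0 < Cof K) /\
    forall (Omega : set 'rV[R]_n) (Sigma : set (pt R n)) (tau0 tau1 omega : R)
           (s : pt R n -> pt R n -> R),
    parallel_setting kappa Omega Sigma tau0 tau1 omega s ->
    forall K : nat -> R, phi_derivative_bounds kappa Omega Sigma tau0 K ->
    let C := Cof K in
    forall Xstar : pt R n,
    cylinder Omega tau0 Xstar ->
    regular_from kappa Omega Sigma tau0 s Xstar ->
    exists delta C1 C2 : R,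
      [/\ 0 < delta, 0 < C1, 0 < C2 & eball Xstar.1 delta `<=` Omega] /\
      forall u : 'rV[R]_n -> R,
      parallel_refractor kappa Omega Sigma tau0 u ->
      u Xstar.1 = Xstar.2 ->
      let M := Mof C C1 in
      property_P kappa Omega Sigma s u Xstar.1 delta C C1 C2 /\
      property_conclusion kappa Omega Sigma s u Xstar.1 delta C2 M.
Proof.
exists (P_const kappa), (fun C C1 => 1 + 2 * C / C1).
split=> [K|]; first exact: P_const_gt0.
move=> Omega Sigma tau0 tau1 omega s setting K K_bound C Xstar [Oxs _].
move=> [U [c1 [c2 [nU c10 c20 reg]]]].
have [r r0 hr] := Omega_ball setting Oxs.
have /nbhs_ballP[r' r'0 hr'] := nU.
have sk0 : 0 <= (Num.sqrt (kappa ^+ 2 - 1))^-1 by rewrite invr_ge0 sqrtr_ge0.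
have g0 : 0 < 1 + (Num.sqrt (kappa ^+ 2 - 1))^-1 by rewrite ltr_pwDl.
(* Over the ball of radius delta the graph of any refractor through [Xstar] remains in [U], because
   the Lipschitz constant 1 / sqrt(k) is common to all of them; hence delta can be chosen before
   [u]. *)
pose delta := Num.min r (r' / (1 + (Num.sqrt (kappa ^+ 2 - 1))^-1)).
have delta0 : 0 < delta by rewrite lt_min r0 divr_gt0.
have dO : eball Xstar.1 delta `<=` Omega.
  move=> x; rewrite /eball /= lt_min => /andP[h _].
  by rewrite -(subrK Xstar.1 x) addrC; exact: hr.
exists delta, c1, c2; split=> // u refractor uX M.
have inU x : eball Xstar.1 delta x -> U (x, u x).
  move=> hx; have Ox := dO _ hx; apply: hr'.
  move: hx; rewrite /eball /= lt_min => /andP[_]; rewrite ltr_pdivlMr // => hx.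
  have h1 := refractor_lip kappa_gt1 setting refractor Ox Oxs.
  have e0 := enorm_ge0 (x - Xstar.1).
  have h2 := mulr_ge0 e0 sk0.
  rewrite -ball_normE /= prod_normE /= gt_max; apply/andP; split.
    apply: (le_lt_trans (mx_norm_le_enorm _)); rewrite enormB; lra.
  by rewrite -uX distrC; apply: (le_lt_trans h1); lra.
have reg' x0 Ybar Yhat x lambda : eball Xstar.1 delta x0 ->
    Sigma Ybar -> Sigma Yhat -> Omega x -> enorm (x - x0) <= c2 ->
    1 / 4 <= lambda <= 3 / 4 ->
    phi kappa x (Yseg kappa s Ybar Yhat (x0, u x0) lambda) (x0, u x0) <=
      Num.max (phi kappa x Ybar (x0, u x0)) (phi kappa x Yhat (x0, u x0))
      - c1 * pnorm (Ybar - Yhat) ^+ 2 * enorm (x - x0) ^+ 2.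
  move=> bx0 Sb Sh Ox hx hl; apply: reg => //; first exact: inU.
  exact: (refractor_cylinder refractor (dO _ bx0)).
have P := property_P_holds kappa_gt1 n_gt0 setting K_bound refractor (ltW c10) dO reg'.
split; first exact: P.
apply: (property_conclusion_holds kappa_gt1 n_gt0 setting K_bound refractor
  delta0 (P_const_gt0 kappa_gt1 K) c10 c20 dO _ P).
move=> x1 bx1 Ya Yb x Sa Sb Ox hx.
apply: (le_trans (reg' x1 Ya Yb x (1 / 2) bx1 Sa Sb Ox hx _)).
  by apply/andP; split; lra.
rewrite gerBl; apply: mulr_ge0; last exact: sqr_ge0.
by apply: mulr_ge0; [exact: ltW|exact: sqr_ge0].
Qed.
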